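(* Let $\Phi=[\phi_1,\dots,\phi_N]$ be a sequence of nonzero vectors generating the lattice $\mathbb{Z}^r\subset\mathbb{R}^r$ and lying in an open half-space. Let $W\subset\mathbb{R}^r$ be a wall of $\Phi$, determined by a primitive vector $E$ of the dual lattice of $\mathbb{Z}^r$, i.e. $W=\{a\in\mathbb{R}^r:\langle a,E\rangle=0\}$, and let $\mathfrak{c}_1,\mathfrak{c}_2$ be two chambers of $\Phi$ adjacent along $W$ and lying on the two sides of $W$, with $\langle E,\mathfrak{c}_1\rangle>0$. Let $\Phi_0=\Phi\cap W$ (the subsequence of elements of $\Phi$ lying in $W$) and let $\mathfrak{c}_{12}$ be the chamber of $\Phi_0$ in $W$ whose closure contains $\overline{\mathfrak{c}_1}\cap\overline{\mathfrak{c}_2}$. (1) Let $v_{12}=v(\Phi_0,\mathfrak{c}_{12})$ be the polynomial function on $W$ associated to $\mathfrak{c}_{12}$, and let $V_{12}$ be any polynomial function on $\mathbb{R}^r$ extending $v_{12}$. Then for all $a\in\mathbb{R}^r$ $$v(\Phi,\mathfrak{c}_1)(a)-v(\Phi,\mathfrak{c}_2)(a)=\mathrm{Res}_{z=0}\left(V_{12}(\partial_x)\cdot\frac{e^{\langle a,x+zE\rangle}}{\prod_{\phi\in\Phi\setminus\Phi_0}\langle\phi,x+zE\rangle}\right)_{x=0}.$$ (2) Suppose $\Phi$ is unimodular. Let $k_{12}=k(\Phi_0,\mathfrak{c}_{12})$ be the polynomial function on $W$ associated to $\mathfrak{c}_{12}$, and let $K_{12}$ be any polynomial function on $\mathbb{R}^r$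 extending $k_{12}$. Then for all $a\in\mathbb{R}^r$ $$k(\Phi,\mathfrak{c}_1)(a)-k(\Phi,\mathfrak{c}_2)(a)=\mathrm{Res}_{z=0}\left(K_{12}(\partial_x)\cdot\frac{e^{\langle a,x+zE\rangle}}{\prod_{\phi\in\Phi\setminus\Phi_0}(1-e^{-\langle\phi,x+zE\rangle})}\right)_{x=0}.$$
   Context: Setting. $V=\mathbb{R}^r$, $U=V^*$ (variable $x\in U$, $a\in V$), $\langle\cdot,\cdot\rangle$ is the pairing. $\mathrm{Res}_{z=0}$ is the coefficient of $z^{-1}$ in the Laurent expansion at $z=0$. For a polynomial function $P$ on $V$, $P(\partial_x)$ is the constant coefficient differential operator acting on functions of $x\in U$ with $P(\partial_x)e^{\langle a,x\rangle}=P(a)e^{\langle a,x\rangle}$; in the formulas it is applied in $x$, then $x$ is set to $0$, giving a meromorphic function of $z$ near $0$. Polytopes. For a sequence $\Phi$ generating a space, $P(\Phi,a)=\{t\in\mathbb{R}_{\ge0}^N:\sum_i t_i\phi_i=a\}$. $k(\Phi)(a)=|P(\Phi,a)\cap\mathbb{Z}^N|$. $\mathrm{vol}(\Phi)(a)$ is the volume of $P(\Phi,a)$ in the affine space $\{t\in\mathbb{R}^N:\sum_i t_i\phi_i=a\}$ for the quotient measure $dt/da$, where $dt$ is Lebesgue measure on $\mathbb{R}^N$ and $da$ is the Lebesgue measure giving covolume $1$ to $\mathbb{Z}^r$; for $\Phi_0$ in $W$, $da$ is replaced by the Lebesgue measure $dw$ on $W$ giving covolume $1$ to $W\cap\mathbb{Z}^r$.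 Chambers. $C(\nu)$ is the closed convex cone generated by $\nu$. $C(\Phi)_{\mathrm{sing}}$ is the union of the cones $C(\nu)$ over subsets $\nu\subset\Phi$ of cardinality $<\dim V$; chambers are the connected components of $V\setminus C(\Phi)_{\mathrm{sing}}$. The exterior of $C(\Phi)$ is a chamber $\mathfrak{c}_{\mathrm{ext}}$; the others, contained in $C(\Phi)$, are called interior. The same definitions apply to $\Phi_0$ in $W$. A wall of $\Phi$ is a hyperplane generated by $r-1$ linearly independent elements of $\Phi$. ''Adjacent along $W$ and on the two sides of $W$, with $\langle E,\mathfrak{c}_1\rangle>0$'' means: $\langle a,E\rangle>0$ for $a\in\mathfrak{c}_1$; either $\langle a,E\rangle<0$ for all $a\in\mathfrak{c}_2$ or $\mathfrak{c}_2=\mathfrak{c}_{\mathrm{ext}}$; and $\overline{\mathfrak{c}_1}\cap\overline{\mathfrak{c}_2}$ is contained in $W$ up to its part of empty relative interior, more precisely $\overline{\mathfrak{c}_1}\cap\overline{\mathfrak{c}_2}\cap W$ has non-empty interior in $W$ (when $\mathfrak{c}_2=\mathfrak{c}_{\mathrm{ext}}$, read $\overline{\mathfrak{c}_1}\cap\overline{\mathfrak{c}_2}$ as $\overline{\mathfrak{c}_1}\cap\overline{\mathfrak{c}_2}\cap W$). Polynomials. For an interior chamber $\mathfrak{c}$, $v(\Phi,\mathfrak{c})$ is the unique polynomial function on $V$ equal to $\mathrm{vol}(\Phi)$ on $\overline{\mathfrak{c}}$. $\Phi$ is unimodular if every subset of $\Phi$ that is a basis of $V$ is a $\mathbb{Z}$-basis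 of the lattice $\mathbb{Z}\Phi$ generated by $\Phi$; then $\Phi_0$ is unimodular for $W\cap\mathbb{Z}^r$, and $k(\Phi,\mathfrak{c})$ is the unique polynomial function on $V$ equal to $k(\Phi)$ on $\overline{\mathfrak{c}}\cap\mathbb{Z}^r$ (similarly for $\Phi_0$, $W$, $W\cap\mathbb{Z}^r$). By convention $v(\Phi,\mathfrak{c}_{\mathrm{ext}})=0$ and $k(\Phi,\mathfrak{c}_{\mathrm{ext}})=0$. *)

(* Defs.v *)
From HB Require Import structures.
From mathcomp Require Import all_boot all_order all_algebra finmap.
From mathcomp Require Import all_classical all_reals all_analysis.
(* mpoly is not imported: its notations clash with those of MathComp-Analysis. *)
From mathcomp Require mpoly.

Set Implicit Arguments.
Unset Strict Implicit.
Unset Printing Implicit Defensive.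

Import Order.TTheory GRing.Theory Num.Theory.
Import numFieldNormedType.Exports.

Local Open Scope classical_set_scope.
Local Open Scope ring_scope.

(* V is the space 'rV_r of row vectors and U = V^* the space 'cV_r of column
   vectors. *)
Definition pairing (K : nzRingType) (r : nat) (a : 'rV[K]_r) (x : 'cV[K]_r) : K :=
  (a *m x) 0 0.

(* A sequence of lattice vectors is identified with the matrix of which they
   are the rows; t *m A is then the combination of the vectors with
   coefficients t. *)
Definition seqmx (r : nat) (Phi : seq 'rV[int]_r) : 'M[int]_(size Phi, r) :=
  \matrix_(i < size Phi) Phi`_i.

Definition rseqmx (R : realType) (r : nat) (Phi : seq 'rV[int]_r) :
    'M[R]_(size Phi, r) :=
  map_mx intr (seqmx Phi).

Definition Zspan (r : nat) (Phi : seq 'rV[int]_r) : set 'rV[int]_r :=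
  [set x | exists u : 'rV[int]_(size Phi), x = u *m seqmx Phi].

Definition Rspan (R : realType) (r : nat) (Phi : seq 'rV[int]_r) : set 'rV[R]_r :=
  [set a | (a <= rseqmx R Phi)%MS].

Arguments Rspan R {r} Phi _.

(* The rows of b form a Z-basis of the subgroup L of Z^r. *)
Definition Zbasis (d r : nat) (b : 'M[int]_(d, r)) (L : set 'rV[int]_r) : Prop :=
  forall x, L x <-> exists! u : 'rV[int]_d, x = u *m b.

Definition primitive (r : nat) (E : 'cV[int]_r) : Prop :=
  forall (k : int) (F : 'cV[int]_r), E = k *: F -> k \is a GRing.unit.

Definition in_open_half_space (R : realType) (r : nat) (Phi : seq 'rV[int]_r) : Prop :=
  exists h : 'cV[R]_r, forall phi, phi \in Phi -> 0 < pairing (map_mx intr phi) h.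

Definition unimodular (R : realType) (r : nat) (Phi : seq 'rV[int]_r) : Prop :=
  forall nu : seq 'rV[int]_r, subseq nu Phi ->
    row_free (rseqmx R nu) -> Rspan R nu = Rspan R Phi ->
    Zbasis (seqmx nu) (Zspan Phi).

Definition hyperplane (R : realType) (r : nat) (E : 'cV[int]_r) : set 'rV[R]_r :=
  [set a | pairing a (map_mx intr E) = 0].

Arguments hyperplane R {r} E _.

Definition wall (R : realType) (r : nat) (Phi : seq 'rV[int]_r) (W : set 'rV[R]_r) : Prop :=
  exists nu : seq 'rV[int]_r,
    [/\ subseq nu Phi, (size nu).+1 = r, row_free (rseqmx R nu) & W = Rspan R nu].

(* In the definitions below the ambient space of Phi is its linear span, and
   the ambient lattice is the set of integral points of this span. *)

Definition polytope (R : realType) (r : nat) (Phi : seq 'rV[int]_r) (a : 'rV[R]_r) :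
    set 'rV[R]_(size Phi) :=
  [set t : 'rV[R]_(size Phi) | (forall i, 0 <= t 0 i) /\ t *m rseqmx R Phi = a].

Arguments polytope {R r} Phi a _.

Definition num_points (R : realType) (r : nat) (Phi : seq 'rV[int]_r) (a : 'rV[R]_r) : nat :=
  #|` fset_set [set t : 'rV[int]_(size Phi) | polytope Phi a (map_mx intr t)] |%fset.

(* n-dimensional Lebesgue measure (on Borel sets), as an iterated integral. *)
Fixpoint lebesgue_rV (R : realType) (n : nat) : set 'rV[R]_n -> \bar R :=
  match n return set 'rV[R]_n -> \bar R with
  | 0 => fun S => (\1_S 0)%:E
  | n'.+1 => fun S =>
      (\int[@lebesgue_measure R]_(x in setT)
         lebesgue_rV [set u : 'rV[R]_n' |
           S (row_mx (const_mx x : 'rV[R]_1) u : 'rV[R]_(1 + n'))])%E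
  end.

Definition span_lattice (R : realType) (r : nat) (Phi : seq 'rV[int]_r) : set 'rV[int]_r :=
  [set x | Rspan R Phi (map_mx intr x)].

Arguments span_lattice R {r} Phi _.

Definition span_lattice_basis (R : realType) (r : nat) (Phi : seq 'rV[int]_r) :
    'M[int]_(\rank (rseqmx R Phi), r) :=
  xget 0 [set b | Zbasis b (span_lattice R Phi)].

Fact rank_add_ker (F : fieldType) (m n : nat) (A : 'M[F]_(m, n)) :
  (\rank A + \rank (kermx A))%N = m.
Proof. by rewrite mxrank_ker subnKC ?rank_leq_row. Qed.

(* Write A for the matrix of Phi, b for a Z-basis of the lattice of its span,
   s for a lift of b (so that s *m A = b) and K for a basis of ker A.  In the
   coordinates t = alpha *m s + u *m K the Lebesgue measure dt is
   |det (s; K)| d(alpha) du, and d(alpha) is the Lebesgue measure of the span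
   giving covolume 1 to the lattice; hence |det (s; K)| du is the quotient
   measure on each fibre of t |-> t *m A.  The result does not depend on the
   choices made. *)
Definition vol (R : realType) (r : nat) (Phi : seq 'rV[int]_r) (a : 'rV[R]_r) : R :=
  let A := rseqmx R Phi in
  let s := map_mx intr (span_lattice_basis R Phi) *m pinvmx A in
  let K := row_base (kermx A) in
  `|\det (castmx (rank_add_ker A, erefl) (col_mx s K))| *
  fine (lebesgue_rV [set u : 'rV[R]_(\rank (kermx A)) | polytope Phi a (a *m pinvmx A + u *m K)]).

Definition cone (R : realType) (r : nat) (nu : seq 'rV[int]_r) : set 'rV[R]_r :=
  [set a | polytope nu a !=set0].

Arguments cone R {r} nu _.

Definition cone_sing (R : realType) (r : nat) (Phi : seq 'rV[int]_r) : set 'rV[R]_r :=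
  [set a | exists nu : seq 'rV[int]_r,
    [/\ subseq nu Phi, (size nu < \rank (rseqmx R Phi))%N & cone R nu a]].

Arguments cone_sing R {r} Phi _.

Definition chamber (R : realType) (r : nat) (Phi : seq 'rV[int]_r) (c : set 'rV[R]_r) : Prop :=
  exists2 a, (Rspan R Phi `\` cone_sing R Phi) a &
    c = connected_component (Rspan R Phi `\` cone_sing R Phi) a.

Definition exterior (R : realType) (r : nat) (Phi : seq 'rV[int]_r) : set 'rV[R]_r :=
  Rspan R Phi `\` cone R Phi.

Arguments exterior R {r} Phi _.

(* c1 and c2 are distinct chambers on the two sides of the hyperplane W
   orthogonal to E.  If c2 is not the exterior, the intersection of the closures
   is automatically contained in W. *)
Definition adjacent_chambers (R : realType) (r : nat) (Phi : seq 'rV[int]_r) (E : 'cV[int]_r)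
    (c1 c2 : set 'rV[R]_r) : Prop :=
  [/\ c1 <> c2,
      forall a, c1 a -> 0 < pairing a (map_mx intr E),
      (forall a, c2 a -> pairing a (map_mx intr E) < 0) \/ c2 = exterior R Phi &
      exists O : set 'rV[R]_r, [/\ open O, O `&` hyperplane R E !=set0 &
        O `&` hyperplane R E `<=` closure c1 `&` closure c2]].

Definition polyval (R : realType) (r : nat) (P : mpoly.mpoly r R) (a : 'rV[R]_r) : R :=
  mpoly.meval (fun i => a 0 i) P.

Definition polynomial_on (R : realType) (r : nat) (W : set 'rV[R]_r) (f : 'rV[R]_r -> R) : Prop :=
  exists P : mpoly.mpoly r R, forall a, W a -> f a = polyval P a.

(* f is the polynomial function v(Phi, c) on the span of Phi; its values
   outside of the span are irrelevant. *)
Definition is_vol_poly (R : realType) (r : nat) (Phi : seq 'rV[int]_r)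
    (c : set 'rV[R]_r) (f : 'rV[R]_r -> R) : Prop :=
  [/\ polynomial_on (Rspan R Phi) f,
      c = exterior R Phi -> forall a, Rspan R Phi a -> f a = 0 &
      c <> exterior R Phi -> forall a, closure c a -> f a = vol Phi a].

(* Likewise for k(Phi, c). *)
Definition is_num_poly (R : realType) (r : nat) (Phi : seq 'rV[int]_r)
    (c : set 'rV[R]_r) (f : 'rV[R]_r -> R) : Prop :=
  [/\ polynomial_on (Rspan R Phi) f,
      c = exterior R Phi -> forall a, Rspan R Phi a -> f a = 0 &
      c <> exterior R Phi -> forall x : 'rV[int]_r, closure c (map_mx intr x) ->
        f (map_mx intr x) = (num_points Phi (map_mx intr x : 'rV[R]_r))%:R].

(* The monomial a^m acts as the iterated partial derivative of multi-exponent m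
   with respect to the coordinates of x dual to those of a. *)
Definition partials (R : realType) (r : nat) (m : mpoly.multinom r) (f : 'cV[R]_r -> R) :
    'cV[R]_r -> R :=
  foldr (fun (i : 'I_r) g => iter (mpoly.fun_of_multinom m i)
           (fun h x => 'D_(delta_mx i 0) h x) g) f (enum 'I_r).

Definition diffop (R : realType) (r : nat) (P : mpoly.mpoly r R) (f : 'cV[R]_r -> R) :
    'cV[R]_r -> R :=
  fun x => \sum_(m <- mpoly.msupp P) mpoly.mcoeff m P * partials m f x.

(* g has the Laurent expansion sum_k c_k z^(k - m - 1) at 0, in which rho is
   the coefficient of z^-1.  A Laurent expansion is determined by its values at
   real z. *)
Definition has_residue0 (R : realType) (g : R -> R) (rho : R) : Prop :=
  exists (m : nat) (c : nat -> R),
    (\forall z \near 0^', series (fun k => c k * z ^ (k%:Z - m.+1%:Z)) @ \oo --> g z) /\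
    rho = c m.

(* Main.v *)
Require Import Defs.
From HB Require Import structures.
From mathcomp Require Import all_boot all_order all_algebra finmap.
From mathcomp Require Import all_classical all_reals all_analysis.
From mathcomp Require Import perm measurable_realfun ring lra zify.
From mathcomp Require mpoly.
Set Implicit Arguments.
Unset Strict Implicit.
Unset Printing Implicit Defensive.
Import Order.TTheory GRing.Theory Num.Theory.
Import numFieldNormedType.Exports.
Local Open Scope classical_set_scope.
Local Open Scope ring_scope.

(** Write Phi as S ++ Phi0, where S = [s_0; ..; s_(p-1)] consists of the vectors
    off the wall W, and put the vectors of S in front of Phi0 one at a time.  With
    nabla_s f (a) = f a - f (a - s), putting s in front of a sequence T changes
    the two functions by

      nabla_s k(s :: T) (a) = k(T) (a)                            (num_points_cons)
      nabla_s vol(s :: T) (a) = int_0^1 vol(T) (a - t s) dt       (vol_nabla)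

    so that the operators nabla_s, s in S, lead from Phi to Phi0, whose functions
    are supported on W and are known there near c12.

    The formulas of the theorem obey the same recursion.  Let Q_d (a) be the
    residue in which the product runs over s_d, .., s_(p-1) only (num_res,
    vol_res).  Translating a by - s_d multiplies the integrand by exp(- s_d), and
    1 - exp(- s_d) cancels a denominator: nabla_(s_d) Q_d = Q_(d+1) (num_res_rec).
    In the case of volumes the derivative of Q_d along s_d is Q_(d+1)
    (vol_res_line).  On W the parameter <a, E> vanishes and the residue becomes an
    elementary number (num_res_wall, vol_res_wall).  These values are exactly what
    makes the function A_d equal to Q_d on the positive side of W and to 0 on the
    negative side satisfy the recursion across W as well (nabla_num_model,
    has_integral_vol_model).

    Consequently nabla_S kills the difference k(Phi) - A_0, in the sense of germs
    at infinity: there is an integral vector w of W such that, for every a, the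
    point a + n w lies for large n in c1, c2 or c12 according to the sign of
    <a, E> (local_cone), and functions are compared at these points.  A germ which
    is killed by nabla_S and vanishes on a half-space vanishes everywhere, since
    one can step from point to point by the vectors of S.  On the negative side
    k(Phi) - A_0 is the polynomial k(Phi, c2); hence it is this polynomial on the
    positive side too, where it is also k(Phi, c1) - Q_0 (wall_jump).  This gives
    k(Phi, c1) - k(Phi, c2) = Q_0, and the same argument works for volumes.

    What makes the residues accessible is that F z = 1 / (1 - exp(- z)), resp.
    F z = 1 / z, satisfies the Riccati equation F' = F - F^2, resp. F' = - F^2.  So
    the derivatives of exp <a, x> H(y), where H is a polynomial in the
    y_k = F <phi_k, x + z E>, are again of this form, and P(d/dx) acts on the
    polynomials H as an operator Dpoly which is polynomial in a (diffop_eq).  At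
    x = 0 every y_k is a polynomial in F z, because F (- z) = 1 - F z and
    (c z)^-1 = c^-1 z^-1, and the residue of exp(j z) g(F z) is a linear form res
    in g which is polynomial in j (has_residue_res).

    The volumes themselves are handled through iterated integrals: the linear
    change of variables (change_var_unitmx) shows that vol can be computed with any
    lift and any basis of the relations (mvol_indep, vol_eq), which permits the
    choice of coordinates adapted to a vector in front of the sequence
    (vol_cons_same, vol_cons_wall). *)

(** * Translations and dilations of integrals on the line *)

Section OneDim.
Context {R : realType}.
Local Notation mu := (@lebesgue_measure R).

Let shift (c x : R) : measurableTypeR R := c + x.
Let scale (c x : R) : measurableTypeR R := c * x.

Let measurable_shift c : measurable_fun [set: measurableTypeR R] (shift c).
Proof. exact: measurable_funD. Qed.

Let measurable_scale c : measurable_fun [set: measurableTypeR R] (scale c).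
Proof. exact: measurable_funM. Qed.

HB.instance Definition _ c := isMeasurableFun.Build _ _ _ _ (shift c) (measurable_shift c).
HB.instance Definition _ c := isMeasurableFun.Build _ _ _ _ (scale c) (measurable_scale c).

Lemma lebesgue_measureD (c : R) (A : set R) : measurable A ->
  pushforward mu (shift c) A = mu A.
Proof.
move=> mA; apply/esym/lebesgue_measure_unique => //= _ [[a b]] _ <-.
rewrite /pushforward.
rewrite (_ : _ @^-1` _ = `]a - c, b - c]%classic); last first.
  apply/seteqP; split => x /=; rewrite /shift ?in_itv/= => /andP[h1 h2];
    apply/andP; split; lra.
rewrite !lebesgue_measure_itv/= !lte_fin ltrD2r.
case: ifPn => // _; rewrite -!EFinB; congr EFin; lra.
Qed.

Lemma lebesgue_measureM (c : R) (c0 : 0 < c) (A : set R) : measurable A ->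
  (c%:E * pushforward mu (scale c) A)%E = mu A.
Proof.
move=> mA; pose nu := pushforward mu (scale c).
have c0' : 0 <= c by exact: ltW.
rewrite (_ : (_ * _)%E = mscale (NngNum c0') nu A) //.
apply/esym/lebesgue_measure_unique => //= _ [[a b]] _ <-.
rewrite /mscale/= /nu /pushforward.
rewrite (_ : _ @^-1` _ = `]a / c, b / c]%classic); last first.
  apply/seteqP; split => x /=; rewrite /scale !in_itv/= ltr_pdivrMr// ler_pdivlMr//.
    by rewrite mulrC.
  by rewrite mulrC.
rewrite !lebesgue_measure_itv/= !lte_fin ltr_pM2r ?invr_gt0//.
case: ifPn => _; last by rewrite mule0.
by rewrite -!EFinB -EFinM -mulrBl mulrC mulfVK ?gt_eqF.
Qed.

Local Open Scope ereal_scope.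

Lemma ge0_integralD_shift (f : R -> \bar R) (c : R) :
  measurable_fun setT f -> (forall x, 0 <= f x) ->
  \int[mu]_x f (x + c)%R = \int[mu]_x f x.
Proof.
move=> mf f0.
have mD := measurable_shift c.
transitivity (\int[mu]_x (f \o shift c) x).
  by apply: eq_integral => x _ /=; rewrite addrC.
have := @ge0_integral_pushforward _ _ _ _ _ _ mD mu setT f measurableT.
rewrite preimage_setT => <- //.
by apply: eq_measure_integral => //= A mA _; exact: lebesgue_measureD.
Qed.

Lemma ge0_integralN (f : R -> \bar R) :
  measurable_fun setT f -> (forall x, 0 <= f x) ->
  \int[mu]_x f (- x)%R = \int[mu]_x f x.
Proof.
move=> mf f0.
have mD : measurable_fun [set: measurableTypeR R] (-%R : measurableTypeR R -> measurableTypeR R).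
  by apply: measurable_funN.
have := @ge0_integral_pushforward _ _ _ _ _ _ mD mu setT f measurableT.
rewrite preimage_setT => <- //.
by apply: eq_measure_integral => //= A mA _; exact: lebesgue_measureN.
Qed.

Lemma ge0_integral_scale (f : R -> \bar R) (c : R) : (c != 0)%R ->
  measurable_fun setT f -> (forall x, 0 <= f x) ->
  `|c|%:E * \int[mu]_x f (x * c)%R = \int[mu]_x f x.
Proof.
move=> c0.
wlog : c c0 f / (0 < c)%R.
  move=> H mf f0; have [c0'|] := ltP 0%R c; first exact: H.
  rewrite le_eqVlt (negPf c0) /= => c0'.
  have cN : (0 < - c)%R by rewrite oppr_gt0.
  rewrite -[RHS](H (- c)%R _ f cN mf f0) ?oppr_eq0// normrN; congr *%E.
  rewrite -[LHS](@ge0_integralN (fun x => f (x * c)%R)).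
  - by apply: eq_integral => x _; rewrite mulNr mulrN.
  - apply: measurableT_comp => //; exact: measurable_funM.
  - by move=> x; apply: f0.
move=> c_gt0 mf f0; rewrite gtr0_norm//.
have mD := measurable_scale c.
have := @ge0_integral_pushforward _ _ _ _ _ _ mD mu setT f measurableT mf (fun y _ => f0 y).
rewrite preimage_setT => E.
transitivity (c%:E * \int[pushforward mu (scale c)]_y f y).
  by rewrite E; congr *%E; apply: eq_integral => x _ /=; rewrite mulrC.
have c0' : (0 <= c)%R by exact: ltW.
rewrite -(@ge0_integral_mscale _ _ _ _ _ measurableT (NngNum c0'))//.
apply: eq_measure_integral => //= A mA _.
exact: lebesgue_measureM.
Qed.

End OneDim.

(** * Iterated integrals *)

Section Iint.
Context {R : realType}.
Local Notation mu := (@lebesgue_measure R).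
Local Notation RM := (measurableTypeR R).

Definition rowt n (t : n.-tuple RM) : 'rV[R]_n := \row_i tnth t i.

Definition consr n (x : R) (u : 'rV[R]_n) : 'rV[R]_n.+1 :=
  row_mx (const_mx x : 'rV[R]_1) u : 'rV[R]_(1 + n).

Lemma consr0 n x (u : 'rV[R]_n) : consr x u 0 ord0 = x.
Proof.
have -> : ord0 = lshift n (0 : 'I_1) by apply/val_inj.
by apply: etrans (row_mxEl _ _ _ _) _; rewrite mxE.
Qed.

Lemma consrS n x (u : 'rV[R]_n) i : consr x u 0 (lift ord0 i) = u 0 i.
Proof.
have -> : lift ord0 i = rshift 1 i by apply/val_inj.
by apply: etrans (row_mxEr _ _ _ _) _.
Qed.

(** The integral of which lebesgue_rV is the special case of indicator functions; for it
    the change of variables can be proved by induction. *)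
Fixpoint iint n : ('rV[R]_n -> \bar R) -> \bar R :=
  match n return ('rV[R]_n -> \bar R) -> \bar R with
  | 0 => fun f => f 0
  | n'.+1 => fun f => (\int[mu]_x iint (fun u => f (consr x u)))%E
  end.

Lemma lebesgue_rVE n (S : set 'rV[R]_n) :
  lebesgue_rV S = iint (fun u => (\1_S u)%:E).
Proof.
elim: n S => [|n IH] S //=; apply: eq_integral => x _; rewrite IH.
by congr iint; apply/funext => u; rewrite /indic /=; congr (_%:R%:E); rewrite !inE.
Qed.

(** Measurability jointly in a parameter and in the row.  Rows carry no measurable
    structure of their own, so that n.-tuples stand for them. *)
Definition pmeas d (T : measurableType d) n (f : T -> 'rV[R]_n -> \bar R) :=
  measurable_fun [set: T * n.-tuple RM] (fun p => f p.1 (rowt p.2)).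

(** A row depending measurably on a parameter, checked coordinate by coordinate. *)
Definition vmeas d (T : measurableType d) n (g : T -> 'rV[R]_n) :=
  forall i, measurable_fun setT (fun x => g x 0 i : RM).

Lemma pmeas_comp d d' (T : measurableType d) (S : measurableType d') n
    (f : T -> 'rV[R]_n -> \bar R) (h : S -> T) (g : S -> 'rV[R]_n) :
  pmeas f -> measurable_fun setT h -> vmeas g ->
  measurable_fun setT (fun s => f (h s) (g s)).
Proof.
move=> mf mh mg.
pose k (s : S) : T * n.-tuple RM := (h s, [tuple (g s 0 i : RM) | i < n]).
have -> : (fun s => f (h s) (g s)) = (fun p => f p.1 (rowt p.2)) \o k.
  apply/funext => s /=; congr f; apply/rowP => i.
  by rewrite mxE tnth_mktuple.
apply: measurableT_comp => //; apply/measurable_fun_pairP; split => //.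
apply/measurable_fun_tnthP => i.
rewrite (_ : _ \o _ = fun s => g s 0 i); first exact: mg.
by apply/funext => s /=; rewrite tnth_mktuple.
Qed.

Lemma vmeas_comp d d' (T : measurableType d) (S : measurableType d') n
    (g : T -> 'rV[R]_n) (h : S -> T) :
  vmeas g -> measurable_fun setT h -> vmeas (g \o h).
Proof. by move=> mg mh i; apply: (measurableT_comp (mg i)). Qed.

Lemma vmeas_rowt n : vmeas (@rowt n).
Proof.
move=> i; rewrite (_ : (fun _ => _) = fun t => tnth t i); last first.
  by apply/funext => t; rewrite mxE.
exact: measurable_tnth.
Qed.

Lemma vmeas_cst d (T : measurableType d) n (c : 'rV[R]_n) : vmeas (fun _ : T => c).
Proof. by move=> i; exact: measurable_cst. Qed.

Lemma vmeasD d (T : measurableType d) n (f g : T -> 'rV[R]_n) :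
  vmeas f -> vmeas g -> vmeas (fun x => f x + g x).
Proof.
move=> mf mg i; under eq_fun do rewrite mxE.
by apply: measurable_funD; [exact: mf|exact: mg].
Qed.

Lemma vmeasM d (T : measurableType d) (m n : nat) (f : T -> 'rV[R]_m) (A : 'M[R]_(m, n)) :
  vmeas f -> vmeas (fun x => f x *m A).
Proof.
move=> mf i; under eq_fun do rewrite mxE.
apply: measurable_sum => j; apply: measurable_funM => //; exact: mf.
Qed.

Lemma vmeasZ d (T : measurableType d) n (c : T -> RM) (a : 'rV[R]_n) :
  measurable_fun setT c -> vmeas (fun x => c x *: a).
Proof.
move=> mc i; under eq_fun do rewrite mxE.
exact: measurable_funM.
Qed.

Lemma vmeas_consr d (T : measurableType d) n (c : T -> RM) (f : T -> 'rV[R]_n) :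
  measurable_fun setT c -> vmeas f -> vmeas (fun x => consr (c x) (f x)).
Proof.
move=> mc mf i; case: (unliftP ord0 i) => [j|] ->.
  by under eq_fun do rewrite consrS; exact: mf.
by under eq_fun do rewrite consr0.
Qed.

Lemma iint_ge0 n (f : 'rV[R]_n -> \bar R) :
  (forall u, 0 <= f u)%E -> (0 <= iint f)%E.
Proof.
elim: n f => [|n IH] f f0 //=; apply: integral_ge0 => x _.
by apply: IH => u; exact: f0.
Qed.

Lemma eq_iint n (f g : 'rV[R]_n -> \bar R) : f =1 g -> iint f = iint g.
Proof. by move=> /funext ->. Qed.

Lemma pmeas_consr d (T : measurableType d) n (f : T -> 'rV[R]_n.+1 -> \bar R) :
  pmeas f -> pmeas (fun (p : T * RM) u => f p.1 (consr p.2 u)).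
Proof.
move=> mf; apply: (pmeas_comp (h := fun s : T * RM * n.-tuple RM => s.1.1)
  (g := fun s : T * RM * n.-tuple RM => consr s.1.2 (rowt s.2)) mf).
  exact: (measurableT_comp measurable_fst measurable_fst).
apply: vmeas_consr; first exact: (measurableT_comp measurable_snd measurable_fst).
exact: (vmeas_comp (@vmeas_rowt n) measurable_snd).
Qed.

Lemma measurable_iint d (T : measurableType d) n (f : T -> 'rV[R]_n -> \bar R) :
  (forall x u, 0 <= f x u)%E -> pmeas f -> measurable_fun setT (fun x => iint (f x)).
Proof.
elim: n d T f => [|n IH] d T f f0 mf /=.
  apply: (pmeas_comp mf (@measurable_id _ _ _)); exact: vmeas_cst.
have := IH _ _ _ (fun (p : T * RM) u => f0 p.1 (consr p.2 u)) (pmeas_consr mf).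
move=> m; apply: (@measurable_fun_fubini_tonelli_F _ _ T RM R mu _ m).
by move=> p; apply: iint_ge0 => u; exact: f0.
Qed.

(** Tonelli's theorem for one variable against all the others. *)
Lemma iint_swap n (f : R -> 'rV[R]_n -> \bar R) :
  (forall x u, 0 <= f x u)%E -> pmeas (f : RM -> _) ->
  (\int[mu]_x iint (f x))%E = iint (fun u => \int[mu]_x f x u)%E.
Proof.
elim: n f => [|n IH] f f0 mf //=.
have m := measurable_iint (fun (p : RM * RM) u => f0 p.1 (consr p.2 u)) (pmeas_consr mf).
have := @fubini_tonelli _ _ _ _ _ mu mu _ m.
rewrite /= => -> //; last by move=> p; apply: iint_ge0 => u; exact: f0.
apply: eq_integral => y _; rewrite IH //.
apply: (pmeas_comp (h := fun s : RM * n.-tuple RM => s.1)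
  (g := fun s : RM * n.-tuple RM => consr y (rowt s.2)) mf).
  exact: measurable_fst.
by apply: vmeas_consr => //; exact: (vmeas_comp (@vmeas_rowt n) measurable_snd).
Qed.

End Iint.

(** * Linear changes of variables *)

Section CVar.
Context {R : realType}.
Local Notation mu := (@lebesgue_measure R).
Local Notation RM := (measurableTypeR R).

(** Measurability of a function of rows, stated by composition with all measurable
    rows; unlike pmeas it is stable under every substitution that occurs below. *)
Definition rvmeas n (f : 'rV[R]_n -> \bar R) :=
  forall d (T : measurableType d) (g : T -> 'rV[R]_n), vmeas g ->
    measurable_fun setT (fun s => f (g s)).

Lemma consrM n (M : 'M[R]_(1 + n)) (x : R) (u : 'rV_n) :
  (consr x u : 'rV_(1 + n)) *m M = 
  consr (x * M 0 0 + (u *m dlsubmx M) 0 0) (x *: ursubmx M + u *m drsubmx M).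
Proof.
rewrite -[in LHS](submxK M) /consr mul_row_block; congr row_mx.
  apply/rowP => i; rewrite !ord1 !mxE; congr (_ + _).
  rewrite big_ord1 !mxE; congr (_ * M _ _); exact/val_inj.
congr (_ + _); apply/rowP => i; rewrite !mxE big_ord1 !mxE //.
Qed.

Lemma consrD n (x y : R) (u v : 'rV[R]_n) :
  consr x u + consr y v = consr (x + y) (u + v).
Proof.
apply/rowP => i; rewrite mxE; case: (unliftP ord0 i) => [j|] ->.
  by rewrite !consrS mxE.
by rewrite !consr0.
Qed.

Lemma consr_eta n (u : 'rV[R]_n.+1) : u = consr (u 0 0) (\row_j u 0 (lift ord0 j)).
Proof.
apply/rowP => i; case: (unliftP ord0 i) => [j|] ->.
  by rewrite !consrS mxE.
by rewrite !consr0.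
Qed.

Lemma rvmeas_comp n m (f : 'rV[R]_n -> \bar R) (h : 'rV[R]_m -> 'rV[R]_n) :
  (forall d (T : measurableType d) (g : T -> 'rV[R]_m), vmeas g -> vmeas (h \o g)) ->
  rvmeas f -> rvmeas (f \o h).
Proof. by move=> H mf d T g mg; apply: mf; exact: H. Qed.

Lemma rvmeas_affine n m (f : 'rV[R]_n -> \bar R) (A : 'M[R]_(m, n)) c :
  rvmeas f -> rvmeas (fun u => f (u *m A + c)).
Proof.
apply: rvmeas_comp => d T g mg.
exact: (vmeasD (vmeasM A mg) (@vmeas_cst R _ T _ c)).
Qed.

Lemma rvmeas_mulmx n m (f : 'rV[R]_n -> \bar R) (A : 'M[R]_(m, n)) :
  rvmeas f -> rvmeas (fun u => f (u *m A)).
Proof. by apply: rvmeas_comp => d T g mg; exact: (vmeasM A mg). Qed.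

Lemma rvmeas_consr n (f : 'rV[R]_n.+1 -> \bar R) x :
  rvmeas f -> rvmeas (fun u => f (consr x u)).
Proof.
apply: rvmeas_comp => d T g mg; apply: (@vmeas_consr _ _ _ _ (fun=> x) g) => //.
Qed.

Lemma pmeas_rvmeas_consr n (f : 'rV[R]_n.+1 -> \bar R) :
  rvmeas f -> pmeas (fun (x : RM) u => f (consr x u)).
Proof.
move=> mf; apply: mf; apply: vmeas_consr; first exact: measurable_fst.
exact: (vmeas_comp (@vmeas_rowt R n) measurable_snd).
Qed.

Lemma measurable_iint_consr n (f : 'rV[R]_n.+1 -> \bar R) :
  (forall u, 0 <= f u)%E -> rvmeas f ->
  measurable_fun [set: RM] (fun x => iint (fun u => f (consr x u))).
Proof.
move=> f0 mf; apply: measurable_iint; first by move=> x u; exact: f0.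
exact: pmeas_rvmeas_consr.
Qed.

Lemma iint_shift n (f : 'rV[R]_n -> \bar R) c :
  (forall u, 0 <= f u)%E -> rvmeas f -> iint (fun u => f (u + c)) = iint f.
Proof.
elim: n f c => [|n IH] f c f0 mf /=; first by congr f; apply/rowP => -[].
have := ge0_integralD_shift (c 0 0) (measurable_iint_consr f0 mf) _.
move=> <-; last by move=> x; apply: iint_ge0.
apply: eq_integral => x _; rewrite [in LHS](consr_eta c).
under eq_iint do rewrite consrD.
by rewrite (IH (fun u => f (consr (x + c 0 0) u))) //; exact: rvmeas_consr.
Qed.

Definition change_var n (M : 'M[R]_n) := forall f : 'rV[R]_n -> \bar R,
  (forall u, 0 <= f u)%E -> rvmeas f ->
  (`|\det M|%:E * iint (fun u => f (u *m M)) = iint f)%E.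

Lemma change_var_mul n (A B : 'M[R]_n) : change_var A -> change_var B -> change_var (A *m B).
Proof.
move=> cA cB f f0 mf; rewrite det_mulmx normrM mulrC EFinM -muleA.
under eq_iint do rewrite mulmxA.
by rewrite (cA (fun u => f (u *m B))) ?cB //; exact: rvmeas_mulmx.
Qed.

(** The first variable is dilated by d, and the others undergo a translation and the
    change of variables U. *)
Lemma change_var_upper n (d : R) (c : 'rV[R]_n) (U : 'M[R]_n) : d != 0 -> change_var U ->
  change_var (block_mx d%:M c 0 U : 'M[R]_(1 + n)).
Proof.
move=> d0 cU f f0 mf; rewrite det_ublock det_scalar1 normrM EFinM /=.
rewrite -[RHS](ge0_integral_scale d0 (measurable_iint_consr f0 mf)); last first.
  by move=> x; exact: iint_ge0.
rewrite -muleA -ge0_integralZl//=; last 2 first.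
- apply: measurable_iint => [x u|]; first exact: f0.
  by have := pmeas_rvmeas_consr (rvmeas_mulmx (block_mx d%:M c 0 U : 'M[R]_(1 + n)) mf).
- by move=> x _; exact: iint_ge0.
congr *%E; apply: eq_integral => x _.
under eq_iint => u.
  rewrite (consrM (block_mx d%:M c 0 U : 'M[R]_(1 + n))).
  rewrite block_mxKdl block_mxKur block_mxKdr mulmx0 [X in _ + X]mxE addr0.
  rewrite addrC (_ : block_mx d%:M c 0 U 0 0 = d); last first.
    have -> : (0 : 'I_(1 + n)) = lshift n 0 by apply/val_inj.
    by rewrite block_mxEul mxE eqxx.
  over.
have H : rvmeas (fun u => f (consr (x * d) u)) by exact: rvmeas_consr.
rewrite (cU (fun u => f (consr (x * d) (u + x *: c)))) //.
  exact: (iint_shift (f := fun u => f (consr (x * d) u))).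
apply: rvmeas_comp H => dd T g mg.
exact: (vmeasD mg (@vmeas_cst R _ T _ (x *: c))).
Qed.

(** With the order of integration exchanged, the first variable is translated by an
    amount which depends on the others only. *)
Lemma change_var_lower n (y : 'cV[R]_n) : change_var (block_mx 1 0 y 1%:M : 'M[R]_(1 + n)).
Proof.
move=> f f0 mf; set M : 'M[R]_(1 + n) := block_mx _ _ _ _.
rewrite det_lblock !det1 mulr1 normr1 mul1e /=.
rewrite !iint_swap; last 4 first.
- by move=> *; exact: f0.
- exact: pmeas_rvmeas_consr.
- by move=> *; exact: f0.
- exact: (pmeas_rvmeas_consr (rvmeas_mulmx M mf)).
apply: eq_iint => u.
transitivity (\int[mu]_x f (consr (x + (u *m y) 0 0)%R u))%E.
  apply: eq_integral => x _; rewrite (consrM M) /M.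
  rewrite block_mxKdl block_mxKur block_mxKdr scaler0 add0r mulmx1.
  congr (f (consr (_ + _) _)).
  have -> : (0 : 'I_(1 + n)) = lshift n 0 by apply/val_inj.
  by rewrite block_mxEul mxE eqxx mulr1.
apply: (ge0_integralD_shift (f := fun x => f (consr x u))) => //.
apply: (mf _ _ (fun x : RM => consr x u)).
apply: vmeas_consr; [exact: measurable_id | exact: vmeas_cst].
Qed.

(** Gaussian elimination: a matrix with a nonzero corner is the product of a lower
    transvection and of a block upper triangular matrix; a column operation makes
    the corner nonzero. *)
Lemma change_var_unitmx n (M : 'M[R]_n) : M \in unitmx -> change_var M.
Proof.
elim: n M => [|n IH] M uM.
  move=> f f0 mf /=; rewrite det_mx00 normr1 mul1e; congr f.
  by apply/rowP => -[].
have pivot (M' : 'M[R]_(1 + n)) : M' \in unitmx -> M' 0 0 != 0 -> change_var M'.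
  move=> uM' d0; set d := M' 0 0 in d0.
  pose y := d^-1 *: dlsubmx M'; pose c := ursubmx M'.
  pose U := drsubmx M' - y *m c.
  have E : M' = (block_mx 1 0 y 1%:M : 'M[R]_(1 + n)) *m block_mx d%:M c 0 U.
    rewrite mulmx_block !mul1mx mulmx0 !mul0mx !addr0 /U addrCA subrr addr0.
    rewrite mul_mx_scalar scalerA divff // scale1r -[LHS]submxK; congr block_mx.
    apply/matrixP => i j; rewrite !ord1 !mxE eqxx mulr1n /d.
    by congr (M' _ _); exact/val_inj.
  rewrite E; apply: change_var_mul (change_var_lower _) _; apply: change_var_upper => //.
  apply: IH; move: uM'; rewrite E !unitmxE det_mulmx det_lblock det_ublock.
  by rewrite !det1 !mul1r det_scalar1 !unitfE mulf_eq0 (negPf d0).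
have [d0|d0] := eqVneq (M 0 0) 0; last exact: (pivot M).
have [j Mj] : exists j, M 0 j != 0.
  apply/existsP; apply: contraT; rewrite negb_exists => /forallP H.
  move: uM; rewrite unitmxE (expand_det_row _ 0) big1 ?unitr0 // => j _.
  by have := H j; rewrite negbK => /eqP ->; rewrite mul0r.
have [k Ek] : exists k, j = lift 0 k.
  case: (unliftP 0 j) => [k ->|jE]; first by exists k.
  by rewrite jE d0 eqxx in Mj.
pose y : 'cV[R]_n := delta_mx k 0.
pose L (z : 'cV[R]_n) : 'M[R]_(1 + n) := block_mx 1 0 z 1%:M.
have LK : L y *m L (- y) = 1%:M.
  rewrite /L mulmx_block !mul1mx !mulmx0 !mul0mx !mulmx1 !addr0 !add0r subrr.
  by rewrite -scalar_mx_block.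
have -> : M = (M : 'M[R]_(1 + n)) *m L y *m L (- y) by rewrite -mulmxA LK mulmx1.
apply: change_var_mul (change_var_lower _); apply: pivot.
  rewrite unitmx_mul uM /= unitmxE det_lblock !det1 mulr1 unitr1 //.
rewrite -[in X in X != _](submxK (M : 'M[R]_(1 + n))) /L mulmx_block.
have -> : (0 : 'I_(1 + n)) = lshift n 0 by apply/val_inj.
rewrite block_mxEul mulmx1 mxE.
have -> : ulsubmx (M : 'M[R]_(1 + n)) 0 0 = 0.
  by rewrite !mxE -[RHS]d0; congr (M _ _); exact/val_inj.
rewrite add0r /y -colE !mxE; apply: contra Mj => /eqP <-.
by rewrite Ek; apply/eqP; congr (M _ _); exact/val_inj.
Qed.
End CVar.

(** * Volumes of the fibres of a linear map *)

Section MVol.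
Context {R : realType}.
Local Notation mu := (@lebesgue_measure R).
Local Notation RM := (measurableTypeR R).

Lemma indic_iff T T' (A : set T) (B : set T') x y :
  (A x <-> B y) -> \1_A x = \1_B y :> R.
Proof.
move=> AB; rewrite /indic; congr (_%:R); congr nat_of_bool.
by apply/idP/idP; rewrite !inE => /AB.
Qed.

Definition nneg N : set 'rV[R]_N := [set t | forall i, 0 <= t 0 i].

Lemma measurable_nneg d (T : measurableType d) N (g : T -> 'rV[R]_N) :
  vmeas g -> measurable [set s | nneg (g s)].
Proof.
move=> mg; rewrite (_ : [set _ | _] = \bigcap_(i in [set: 'I_N]) [set s | 0 <= g s 0 i]).
  apply: fin_bigcap_measurable => [|i _]; first exact: finite_finset.
  rewrite (_ : [set _ | _] = setT `&` (fun s => g s 0 i) @^-1` `[0, +oo[%classic).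
    exact: mg.
  by rewrite setTI; apply/seteqP; split => s /=; rewrite in_itv/= andbT.
by apply/seteqP; split => s /= h i; [move=> _; exact: h | exact: (h i)].
Qed.

(** The coordinates u, on the fibre through t of a linear map with kernel K, of the
    nonnegative points. *)
Definition nnegfib k N (t : 'rV[R]_N) (K : 'M[R]_(k, N)) : set 'rV[R]_k :=
  [set u | nneg (t + u *m K)].

Lemma rvmeas_nneg k N (K : 'M[R]_(k, N)) t :
  rvmeas (fun u => (\1_(nnegfib t K) u : R)%:E).
Proof.
move=> d T g mg; apply/measurable_EFinP.
have m : vmeas (fun s => t + g s *m K).
  exact: (vmeasD (@vmeas_cst R _ T _ t) (vmeasM K mg)).
rewrite (_ : (fun s => _) = \1_[set s | nneg (t + g s *m K)]); last first.
  by apply/funext => s; exact: indic_iff.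
by apply: measurable_indic; exact: measurable_nneg.
Qed.

(** The expression of vol for an arbitrary choice of the lift s, of the basis K of the
    kernel and of the point t of the fibre. *)
Definition mvol N m k (H : (m + k)%N = N) (s : 'M[R]_(m, N)) (K : 'M[R]_(k, N))
    (t : 'rV[R]_N) : \bar R :=
  (`|\det (castmx (H, erefl) (col_mx s K))|%:E *
   lebesgue_rV (nnegfib t K))%E.

Lemma kermx_eq N m k r (A : 'M[R]_(N, r)) (K : 'M[R]_(k, N)) :
  (m + k)%N = N -> \rank A = m -> K *m A = 0 -> row_free K -> (K :=: kermx A)%MS.
Proof.
move=> H rA KA fK; apply/eqmxP; have sK : (K <= kermx A)%MS by apply/sub_kermxP.
by rewrite sK /= -(mxrank_leqif_sup sK) mxrank_ker rA (eqP fK) -H addKn.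
Qed.

(** Two choices differ by a block triangular matrix with diagonal blocks U and M; the
    determinant of M is absorbed by a change of variables in u, and the change of t
    by a translation of u. *)
Lemma mvol_indep N m k r (H : (m + k)%N = N) (A : 'M[R]_(N, r))
    (s s' : 'M[R]_(m, N)) (K K' : 'M[R]_(k, N)) (t t' : 'rV[R]_N) (U : 'M[R]_m) :
  \rank A = m -> K *m A = 0 -> row_free K -> K' *m A = 0 -> row_free K' ->
  s' *m A = U *m (s *m A) -> t' *m A = t *m A ->
  (mvol H s' K' t' = `|\det U|%:E * mvol H s K t)%E.
Proof.
move=> rA KA fK KA' fK' sA tA.
have eK := kermx_eq H rA KA fK.
have [M EM] : exists M, K' = M *m K.
  by apply/submxP; rewrite eK; apply/sub_kermxP.
have [X EX] : exists X, s' - U *m s = X *m K.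
  by apply/submxP; rewrite eK; apply/sub_kermxP; rewrite mulmxBl -mulmxA sA subrr.
have [y Ey] : exists y, t' - t = y *m K.
  by apply/submxP; rewrite eK; apply/sub_kermxP; rewrite mulmxBl tA subrr.
have uM : M \in unitmx.
  rewrite -row_free_unit /row_free eqn_leq rank_leq_row /=.
  by rewrite -{1}(eqP fK') EM mxrankM_maxl.
have Es : s' = U *m s + X *m K by rewrite -EX addrC subrK.
have Et : t' = t + y *m K by rewrite -Ey addrC subrK.
rewrite /mvol Es EM Et {Es EM Et EX Ey sA tA rA KA fK KA' fK' eK s' K' t'}.
case: _ / H in A s K t X y M uM *; rewrite !castmx_id.
have -> : col_mx (U *m s + X *m K) (M *m K) = block_mx U X 0 M *m col_mx s K.
  by rewrite mul_block_col mul0mx add0r.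
rewrite det_mulmx det_ublock !normrM !EFinM -!muleA; congr *%E.
rewrite muleCA; congr *%E.
rewrite !lebesgue_rVE.
pose f u := (\1_(nnegfib t K) u : R)%:E.
have f0 u : (0 <= f u)%E by rewrite lee_fin.
have mf : rvmeas f by exact: rvmeas_nneg.
rewrite -[RHS](iint_shift y f0 mf).
have mf' : rvmeas (fun u => f (u + y)).
  have -> : (fun u => f (u + y)) = fun u => f (u *m 1%:M + y).
    by apply/funext => u; rewrite mulmx1.
  exact: rvmeas_affine.
rewrite -(change_var_unitmx uM _ mf') //; congr *%E; apply: eq_iint => u.
rewrite /f; congr EFin; apply: indic_iff.
by rewrite /nnegfib /= mulmxDl mulmxA -addrA [y *m K + _]addrC.
Qed.

(** The permutations of blocks that bring the matrices below into triangular form are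
    orthogonal, and the absolute value hides their signs. *)
Lemma absdet_orth n n' (e : n' = n) (Z : 'M[R]_(n', n)) (B : 'M[R]_n) :
  Z *m Z^T = 1%:M -> `|\det (castmx (e, erefl) (Z *m B))| = `|\det B|.
Proof.
case: _ / e in B Z * => ZZ; rewrite castmx_id det_mulmx normrM.
have : \det Z ^+ 2 = 1 by rewrite expr2 -{2}(det_tr Z) -det_mulmx ZZ det1.
move=> /eqP; rewrite sqrf_eq1 => /orP[] /eqP ->; by rewrite ?normrN normr1 mul1r.
Qed.

End MVol.

Section Finite.
Context {R : realType}.
Local Notation mu := (@lebesgue_measure R).
Local Notation RM := (measurableTypeR R).

Lemma le_iint n (f g : 'rV[R]_n -> \bar R) :
  (forall u, 0 <= f u)%E -> rvmeas f -> rvmeas g -> (forall u, f u <= g u)%E ->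
  (iint f <= iint g)%E.
Proof.
elim: n f g => [|n IH] f g f0 mf mg fg //=.
apply: ge0_le_integral => //.
- by move=> x _; exact: iint_ge0.
- exact: measurable_iint_consr.
- apply: measurable_iint_consr => // u; exact: le_trans (fg u).
- move=> x _; apply: IH => //; exact: rvmeas_consr.
Qed.

Definition box n (M : R) : set 'rV[R]_n := [set u | forall i, `|u 0 i| <= M].

Lemma rvmeas_box n M : rvmeas (fun u => (\1_(@box n M) u : R)%:E).
Proof.
move=> d T g mg; apply/measurable_EFinP.
rewrite (_ : (fun s => _) = \1_[set s | box M (g s)]); last first.
  by apply/funext => s; exact: indic_iff.
apply: measurable_indic.
rewrite (_ : [set s | _] = [set s | nneg (const_mx M + g s)] `&`
                           [set s | nneg (const_mx M + g s *m (-1)%:M)]).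
  apply: measurableI; apply: measurable_nneg.
    exact: (vmeasD (@vmeas_cst R _ T _ (const_mx M)) mg).
  exact: (vmeasD (@vmeas_cst R _ T _ (const_mx M)) (vmeasM (-1)%:M mg)).
apply/seteqP; split => s /=; rewrite /box /nneg /= => h.
  by split => i; have := h i; rewrite ?mul_mx_scalar !mxE ler_norml; lra.
move=> i; have [h1 h2] := h; have := h1 i; have := h2 i.
by rewrite mul_mx_scalar !mxE ler_norml; lra.
Qed.

(** The bound is the volume of the box; it serves to show that polytopes have a finite
    volume. *)
Lemma iint_box n (M : R) : 0 <= M -> (iint (fun u => (\1_(@box n M) u : R)%:E) <= ((M *+ 2) ^+ n)%:E)%E.
Proof.
move=> M0; elim: n => [|n IH] /=.
  by rewrite expr0 lee_fin indicE lern1 leq_b1.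
apply: (@le_trans _ _ (\int[mu]_x (((M *+ 2) ^+ n)%:E * (\1_(`[- M, M]%classic) x)%:E))%E).
  apply: ge0_le_integral => //.
  - by move=> x _; apply: iint_ge0 => u; rewrite lee_fin.
  - apply: (measurable_iint_consr (f := fun u => (\1_(box M) u)%:E)) => [u|].
      by rewrite lee_fin.
    exact: rvmeas_box.
  - apply: measurable_funeM; apply/measurable_EFinP; exact: measurable_indic.
  move=> x _; have [xM|xM] := leP `|x| M; last first.
    rewrite (_ : iint _ = 0%E); last first.
      rewrite (_ : (fun u => _) = fun=> 0%E).
        by elim: n {IH} => [|n IH] //=; apply: integral0_eq => y _.
      apply/funext => u; rewrite indicE memNset // => /(_ ord0).
      by rewrite consr0 leNgt xM.
    by rewrite mule_ge0 // lee_fin // exprn_ge0 // mulrn_wge0.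
  rewrite [X in (_ * X)%E](_ : _ = 1%E) ?mule1; last first.
    by rewrite indicE mem_set //= in_itv /= -ler_norml.
  apply: le_trans IH; apply: le_iint => [u|||u].
  - by rewrite lee_fin.
  - apply: (rvmeas_consr (f := fun u => (\1_(box M) u)%:E)); exact: rvmeas_box.
  - exact: rvmeas_box.
  rewrite !indicE lee_fin ler_nat.
  have [xu|] := boolP (consr x u \in box M) => //.
  rewrite mem_set // => i; move: xu; rewrite inE => /(_ (lift ord0 i)).
  by rewrite consrS.
rewrite ge0_integralZl//; last 2 first.
- exact/measurable_EFinP.
- by rewrite lee_fin exprn_ge0 // mulrn_wge0.
rewrite integral_indic //= setIT lebesgue_measure_itv /= lte_fin.
case: ifPn => [h|h]; last by rewrite mule0 lee_fin exprn_ge0 // mulrn_wge0.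
by rewrite -EFinB -EFinM lee_fin exprSr opprK mulr2n.
Qed.

End Finite.

Section MVolRec.
Context {R : realType}.
Local Notation mu := (@lebesgue_measure R).
Local Notation RM := (measurableTypeR R).

Lemma mvol_ge0 N m k (H : (m + k)%N = N) s K (t : 'rV[R]_N) : (0 <= mvol H s K t)%E.
Proof.
rewrite /mvol lebesgue_rVE mule_ge0 //.
by apply: iint_ge0 => u; rewrite lee_fin.
Qed.

(** A linear form which is positive on all the vectors bounds the coordinates of a
    nonnegative point of the fibre, so that the fibre is contained in a box. *)
Lemma mvol_fin N m k r (H : (m + k)%N = N) s K (t : 'rV[R]_N) (A : 'M[R]_(N, r)) (h : 'cV[R]_r) :
  row_free K -> K *m A = 0 -> (forall i, 0 < (A *m h) i 0) ->
  mvol H s K t \is a fin_num.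
Proof.
move=> fK KA hA; rewrite ge0_fin_numE ?mvol_ge0 //.
apply: lte_mul_pinfty => //; rewrite lebesgue_rVE.
set c := (t *m A *m h) 0 0.
pose B i : R := c / (A *m h) i 0.
pose M := \sum_(i < k) \sum_(j < N) (`|B j| + `|t 0 j|) * `|(pinvmx K) j i|.
have M0 : 0 <= M.
  by apply: sumr_ge0 => i _; apply: sumr_ge0 => j _; rewrite mulr_ge0 // addr_ge0.
have sub u : nnegfib t K u -> box M u.
  rewrite /nnegfib /= => h0 i.
  set w := t + u *m K in h0.
  have cE : \sum_j w 0 j * (A *m h) j 0 = c.
    transitivity ((w *m (A *m h)) 0 0); first by rewrite mxE.
    by rewrite /c mulmxA mulmxDl -[u *m K *m A]mulmxA KA mulmx0 addr0.
  have wB j : `|w 0 j| <= `|B j|.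
    rewrite ger0_norm //; apply: le_trans (ler_norm _).
    rewrite /B ler_pdivlMr // -cE (bigD1 j) //= lerDl; apply: sumr_ge0 => l _.
    by rewrite mulr_ge0 // ltW.
  have -> : u = (w - t) *m pinvmx K.
    by rewrite /w addrC addKr mulmxKp.
  rewrite mxE; apply: le_trans (ler_norm_sum _ _ _) _.
  rewrite /M (bigD1 i) //= ler_wpDr //.
    by apply: sumr_ge0 => l _; apply: sumr_ge0 => j _; rewrite mulr_ge0 // addr_ge0.
  apply: ler_sum => j _; rewrite normrM ler_wpM2r //.
  rewrite [(w - t) 0 j]mxE [(- t) 0 j]mxE.
  by apply: le_trans (ler_normB _ _) _; apply: lerD.
apply: (@le_lt_trans _ _ ((M *+ 2) ^+ k)%:E); last exact: ltry.
apply: le_trans (iint_box k M0); apply: le_iint => [u|||u].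
- by rewrite lee_fin.
- exact: (rvmeas_nneg K t).
- exact: (@rvmeas_box R k M).
rewrite !indicE lee_fin ler_nat.
have [xu|] := boolP (u \in nnegfib t K) => //.
by rewrite mem_set //; apply: sub; rewrite inE in xu.
Qed.

Lemma nneg_row N1 N2 (a : 'rV[R]_N1) (b : 'rV[R]_N2) :
  nneg (row_mx a b) <-> nneg a /\ nneg b.
Proof.
split=> [h|[h1 h2] i].
  by split=> i; [have := h (lshift _ i) | have := h (rshift _ i)]; rewrite ?row_mxEl ?row_mxEr.
by case: (split_ordP i) => j ->; rewrite ?row_mxEl ?row_mxEr.
Qed.

Lemma measurable_halfline_indic :
  measurable_fun [set: RM] (fun x : RM => (\1_(`[0, +oo[%classic) x : R)%:E).
Proof. by apply/measurable_EFinP; exact: measurable_indic. Qed.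

Lemma measurable_leb_line N k (K : 'M[R]_(k, N)) (t p : 'rV[R]_N) :
  measurable_fun [set: RM] (fun x : RM => lebesgue_rV (nnegfib (t - x *: p) K)).
Proof.
rewrite (_ : (fun _ => _) =
    fun x : RM => iint (fun u => (\1_(nnegfib (t - x *: p) K) u : R)%:E)); last first.
  by apply/funext => x; rewrite lebesgue_rVE.
apply: (@measurable_iint R _ RM k
  (fun (x : RM) u => (\1_(nnegfib (t - x *: p) K) u)%:E)) => [x u|].
  by rewrite lee_fin.
apply/measurable_EFinP.
rewrite (_ : (fun _ => _) =
    \1_[set q : RM * k.-tuple RM | nneg (t + q.1 *: (- p) + rowt q.2 *m K)]); last first.
  by apply/funext => q; apply: indic_iff; rewrite /nnegfib /= scalerN.
apply: measurable_indic; apply: measurable_nneg.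
have m1 := @vmeasZ R _ (RM * k.-tuple RM)%type N fst (- p) measurable_fst.
have m2 := vmeasM K (vmeas_comp (@vmeas_rowt R k) (@measurable_snd _ _ RM (k.-tuple RM))).
exact: (vmeasD (vmeasD (@vmeas_cst R _ _ _ t) m1) m2).
Qed.

(** When the new vector lies in the span, its coefficient x becomes a new coordinate of
    the fibre, and the fibre is sliced according to x. *)
Lemma mvol_cons_same N m k (H : (m + k)%N = N) (H' : (m + (1 + k))%N = (1 + N)%N)
   (s : 'M[R]_(m, N)) (K : 'M[R]_(k, N)) (p t : 'rV[R]_N) :
  mvol H' (row_mx 0 s) (col_mx (row_mx 1 (- p)) (row_mx 0 K)) (row_mx 0 t) =
  (\int[mu]_x ((\1_(`[0, +oo[%classic) x)%:E * mvol H s K (t - x *: p)))%E.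
Proof.
case: _ / H in H' s K p t *; rewrite /mvol castmx_id.
have -> : col_mx (row_mx 0 s) (col_mx (row_mx 1 (- p)) (row_mx 0 K)) =
  (col_mx (row_mx 0 (row_mx 1%:M 0)) (col_mx (row_mx 1 0) (row_mx 0 (row_mx 0 1%:M))) :
     'M[R]_(m + (1 + k), 1 + (m + k))) *m
  (block_mx 1 (- p) 0 (col_mx s K)).
  rewrite /block_mx !mul_col_mx !mul_row_col !mul0mx !mul1mx !add0r !addr0.
  by rewrite !mul_mx_row !mulmx0 !mul_row_col !mul0mx !mul1mx !add0r !addr0.
rewrite absdet_orth; last first.
  rewrite !(tr_col_mx, tr_row_mx, trmx0, trmx1) !mul_col_mx !mul_mx_row.
  rewrite !(mul_row_col, mul_mx_row, mulmx0, mul0mx, mulmx1, addr0, add0r) ?row_mx0.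
  rewrite -[col_mx (row_mx 0 (row_mx 1 0)) _]/(block_mx 0 (row_mx 1 0) 0 (row_mx 0 1%:M)).
  rewrite block_mxEh col_mx0 -[col_mx (row_mx 1 0) (row_mx 0 1%:M)]/(block_mx 1 0 0 1%:M).
  by rewrite -scalar_mx_block -[col_mx _ _]/(block_mx 1%:M 0 0 1%:M) -scalar_mx_block.
rewrite det_ublock det1 mul1r.
have mf (x : RM) : rvmeas (fun u => (\1_(nnegfib (t - x *: p) K) u)%:E).
  exact: rvmeas_nneg.
under eq_integral do rewrite muleCA.
rewrite ge0_integralZl//; last 2 first.
- by apply: emeasurable_funM; [exact: measurable_halfline_indic|exact: measurable_leb_line].
- by move=> x _; rewrite mule_ge0 // ?lebesgue_rVE ?lee_fin //; apply: iint_ge0 => u; rewrite lee_fin.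
congr *%E; rewrite lebesgue_rVE /=; apply: eq_integral => x _.
rewrite lebesgue_rVE.
have E u : nnegfib (row_mx 0 t) (col_mx (row_mx 1 (- p)) (row_mx 0 K)) (consr x u) <->
    (0 <= x) /\ nnegfib (t - x *: p) K u.
  rewrite /nnegfib /= /consr mul_row_col !mul_mx_row mulmx0 mulmx1 add_row_mx add_row_mx.
  rewrite nneg_row add0r addr0 mulmxN addrA.
  rewrite (_ : (const_mx x : 'M[R]_1) *m p = x *: p); last first.
    by rewrite -mul_scalar_mx; congr mulmx; apply/matrixP => i j; rewrite !ord1 !mxE eqxx.
  split=> -[h1 h2]; split => //; first by have := h1 0; rewrite mxE.
  by move=> i; rewrite mxE.
have [x0|x0] := leP 0 x.
  rewrite indicE mem_set /= ?in_itv /= ?andbT// mul1e; apply: eq_iint => u.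
  by congr EFin; apply: indic_iff; rewrite E; split=> [[]|].
rewrite indicE memNset /= ?in_itv /= ?andbT ?leNgt ?x0// mul0e.
rewrite (eq_iint (g := fun=> 0%E)).
  by elim: (k) => [|j IH] //=; apply: integral0_eq.
move=> u; rewrite indicE memNset // E => -[]; by rewrite leNgt x0.
Qed.

(** When the new vector does not lie in the span, its coefficient x is determined by the
    point, and it only has to be nonnegative. *)
Lemma mvol_cons_wall N m k (H : (m + k)%N = N) (H' : (1 + m + k)%N = (1 + N)%N)
   (s : 'M[R]_(m, N)) (K : 'M[R]_(k, N)) (x : R) (t : 'rV[R]_N) :
  mvol H' (col_mx (row_mx 1 0) (row_mx 0 s)) (row_mx 0 K) (row_mx (const_mx x) t) =
  ((\1_(`[0, +oo[%classic) x)%:E * mvol H s K t)%E.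
Proof.
case: _ / H in H' s K t *; rewrite /mvol castmx_id.
have -> : col_mx (col_mx (row_mx 1 0) (row_mx 0 s)) (row_mx 0 K) =
  (col_mx (col_mx (row_mx 1%:M 0) (row_mx 0 (row_mx 1%:M 0))) (row_mx 0 (row_mx 0 1%:M)) :
     'M[R]_(1 + m + k, 1 + (m + k))) *m
  (block_mx 1 0 0 (col_mx s K)).
  rewrite /block_mx !mul_col_mx !mul_row_col !mul0mx !mul1mx !add0r !addr0.
  by rewrite !mul_mx_row !mulmx0 !mul_row_col !mul0mx !mul1mx !add0r !addr0.
rewrite absdet_orth; last first.
  rewrite !(tr_col_mx, tr_row_mx, trmx0, trmx1) !mul_col_mx !mul_mx_row.
  rewrite !(mul_row_col, mul_mx_row, mulmx0, mul0mx, mulmx1, addr0, add0r) ?row_mx0.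
  rewrite -[col_mx (row_mx (row_mx 1%:M 0) 0) _]/(block_mx (row_mx 1%:M 0) 0 (row_mx 0 1%:M) 0).
  rewrite block_mxEh col_mx0 -[col_mx (row_mx 1%:M 0) (row_mx 0 1%:M)]/(block_mx 1%:M 0 0 1%:M).
  by rewrite -scalar_mx_block -[col_mx _ _]/(block_mx 1%:M 0 0 1%:M) -scalar_mx_block.
rewrite det_ublock det1 mul1r muleCA; congr *%E.
have [x0|x0] := leP 0 x.
  rewrite [\1_(`[0, +oo[%classic) _]indicE mem_set /= ?in_itv /= ?andbT// mul1e; congr lebesgue_rV.
  apply/seteqP; split => u; rewrite /nnegfib /= mul_mx_row mulmx0 add_row_mx nneg_row addr0.
    by case.
  by split=> // i; rewrite mxE.
rewrite [\1_(`[0, +oo[%classic) _]indicE memNset /= ?in_itv /= ?andbT ?leNgt ?x0// mul0e.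
rewrite lebesgue_rVE (eq_iint (g := fun=> 0%E)).
  by elim: (k) => [|j IH] //=; apply: integral0_eq.
move=> u; rewrite indicE memNset //.
rewrite /nnegfib /= mul_mx_row mulmx0 add_row_mx nneg_row addr0 => -[/(_ 0)].
by rewrite mxE leNgt x0.
Qed.
End MVolRec.

(** * Volumes of partition polytopes *)

Section ZB.
Variable (d r : nat).
Implicit Type L : set 'rV[int]_r.

Lemma Zbasis_inj (b : 'M[int]_(d, r)) L : L 0 -> Zbasis b L -> injective (mulmx^~ b : 'rV_d -> 'rV_r).
Proof.
move=> L0 Lb u v /= uv; have [w [w1 w2]] := (Lb 0).1 L0.
have : w = w + (u - v).
  by apply: w2; rewrite mulmxDl -w1 mulmxBl uv subrr addr0.
by move=> /eqP; rewrite -{1}[w]addr0 (inj_eq (addrI _)) eq_sym subr_eq0 => /eqP.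
Qed.

Lemma Zbasis_in (b : 'M[int]_(d, r)) L (u : 'rV_d) : L 0 -> Zbasis b L -> L (u *m b).
Proof.
move=> L0 Lb; apply/Lb; exists u; split=> // v.
by move/(Zbasis_inj L0 Lb).
Qed.

Lemma Zbasis_change (b b' : 'M[int]_(d, r)) L : L 0 -> Zbasis b L -> Zbasis b' L ->
  exists2 V : 'M[int]_d, V \in unitmx & b' = V *m b.
Proof.
move=> L0.
have key (c c' : 'M[int]_(d, r)) : Zbasis c L -> Zbasis c' L -> exists V, c' = V *m c.
  move=> Lc Lc'.
  have : forall i, exists u : 'rV_d, row i c' = u *m c.
    move=> i; have : L (row i c') by rewrite rowE; exact: Zbasis_in.
    by move/Lc => [u [] ? _]; exists u.
  move/choice => [f fE]; exists (\matrix_i f i).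
  by apply/row_matrixP => i; rewrite row_mul rowK.
move=> Lb Lb'; have [V EV] := key _ _ Lb Lb'; have [V' EV'] := key _ _ Lb' Lb.
exists V => //; have : V *m V' = 1%:M.
  apply/row_matrixP => i; apply: (Zbasis_inj L0 Lb') => /=.
  by rewrite -!row_mul -mulmxA -EV' -EV mul1mx.
by move/mulmx1_unit => [].
Qed.

End ZB.

Lemma absdet_unit (R : realType) d (V : 'M[int]_d) :
  V \in unitmx -> `|\det (map_mx intr V : 'M[R]_d)| = 1.
Proof.
rewrite unitmxE det_map_mx => /orP[] /eqP ->.
  by rewrite normr1.
by rewrite rmorphN normrN normr1.
Qed.

Section VolEq.
Context {R : realType}.
Local Notation mu := (@lebesgue_measure R).

Lemma fineZ (c : R) (x : \bar R) : fine (c%:E * x)%E = c * fine x.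
Proof.
case: x => [x| |] //=; rewrite mulr0.
  by rewrite mulry; case: (sgrP c) => _; rewrite ?mul0e ?mul1e ?mulN1e.
by rewrite mulrNy; case: (sgrP c) => _; rewrite ?mul0e ?mul1e ?mulN1e.
Qed.

Variable r : nat.
Implicit Types (Phi : seq 'rV[int]_r) (a : 'rV[R]_r).

Lemma span_lattice0 Phi : span_lattice R Phi 0.
Proof. by rewrite /span_lattice /Rspan /= map_mx0 sub0mx. Qed.

(** The choices made in the definition of vol are immaterial; U is the matrix, in the
    basis b, of the image of s. *)
Lemma vol_eq Phi m k (H : (m + k)%N = size Phi) (s : 'M[R]_(m, _)) (K : 'M[R]_(k, _)) t
    (b : 'M[int]_(m, r)) (U : 'M[R]_m) a :
  \rank (rseqmx R Phi) = m -> Zbasis b (span_lattice R Phi) ->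
  K *m rseqmx R Phi = 0 -> row_free K ->
  s *m rseqmx R Phi = U *m map_mx intr b -> t *m rseqmx R Phi = a ->
  `|\det U| * vol Phi a = fine (mvol H s K t).
Proof.
move=> rA; have ek : k = \rank (kermx (rseqmx R Phi)).
  by apply/eqP; rewrite -(eqn_add2l m) H -[in eqbRHS]rA rank_add_ker.
move: H s K b U; rewrite ek -rA {ek rA m k} => H s K b U Lb KA fK sA tA.
pose b0 := span_lattice_basis R Phi.
have Lb0 : Zbasis b0 (span_lattice R Phi).
  apply: (@xgetPex _ 0 [set b | Zbasis b (span_lattice R Phi)]); exact: (ex_intro _ b Lb).
have [V uV Eb] := Zbasis_change (span_lattice0 Phi) Lb0 Lb.
have b0A : (map_mx intr b0 <= rseqmx R Phi)%MS.
  apply/row_subP => i; rewrite -map_row.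
  suff : span_lattice R Phi (row i b0) by [].
  by rewrite rowE; exact: (Zbasis_in (delta_mx 0 i) (span_lattice0 Phi) Lb0).
have aA : (a <= rseqmx R Phi)%MS by rewrite -tA submxMl.
rewrite (@mvol_indep R _ _ _ _ H (rseqmx R Phi)
   (map_mx intr b0 *m pinvmx (rseqmx R Phi)) s (row_base (kermx (rseqmx R Phi))) K
   (a *m pinvmx (rseqmx R Phi)) t (U *m map_mx intr V)) //.
- rewrite det_mulmx normrM absdet_unit // mulr1 fineZ; congr (_ * _).
  rewrite /vol /mvol fineZ (eq_irrelevance H (rank_add_ker _)).
  congr (_ * fine (lebesgue_rV _)).
  apply/seteqP; split => u; rewrite /polytope /nnegfib /=; first by case.
  move=> h; split=> //; rewrite mulmxDl mulmxKpV // -mulmxA.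
  by rewrite (_ : _ *m rseqmx R Phi = 0) ?mulmx0 ?addr0 //; apply/sub_kermxP; rewrite eq_row_base.
- by apply/sub_kermxP; rewrite eq_row_base.
- exact: row_base_free.
- by rewrite sA mulmxKpV // Eb map_mxM mulmxA.
- by rewrite tA mulmxKpV.
Qed.

Lemma iint0 n : iint (fun _ : 'rV[R]_n => 0%E) = 0%E.
Proof. by elim: n => [|n IH] //=; apply: integral0_eq. Qed.

Lemma vol_out Phi a : ~ cone R Phi a -> vol Phi a = 0.
Proof.
move=> aA; rewrite /vol (_ : [set u | _] = set0); last first.
  by apply/seteqP; split => u //= h; apply: aA; exists (a *m pinvmx (rseqmx R Phi) + u *m row_base (kermx (rseqmx R Phi))).
rewrite lebesgue_rVE (eq_iint (g := fun=> 0%E)); last by move=> u; rewrite indic0.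
by rewrite iint0 mulr0.
Qed.

Lemma vol_notin Phi a : ~ Rspan R Phi a -> vol Phi a = 0.
Proof. by move=> h; apply: vol_out => -[t [_ ta]]; apply: h; rewrite /Rspan /= -ta submxMl. Qed.

(** A permutation of the vectors is an orthogonal change of the coordinates t. *)
Lemma mvol_perm N N' m k (e : N' = N) (f : 'I_N' -> 'I_N) (bf : bijective f)
   (H : (m + k)%N = N) (H' : (m + k)%N = N')
   s K (t : 'rV[R]_N) (P : 'M[R]_(N, N')) : P = \matrix_(i, j) (f j == i)%:R ->
  mvol H' (s *m P) (K *m P) (t *m P) = mvol H s K t.
Proof.
have fE n (u : 'M[R]_(n, N)) i : P = \matrix_(i, j) (f j == i)%:R ->
    forall l, (u *m P) l i = u l (f i).
  move=> -> l; rewrite mxE (bigD1 (f i)) //= mxE eqxx mulr1 big1 ?addr0 // => j ji.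
  by rewrite mxE eq_sym (negPf ji) mulr0.
move=> EP; rewrite /mvol; congr (_%:E * _)%E; last first.
  congr lebesgue_rV; apply/seteqP; split => u; rewrite /nnegfib /= mulmxA -mulmxDl => h i.
    by have [g _ gK] := bf; have := h (g i); rewrite (fE _ _ _ EP) gK.
  by rewrite (fE _ _ _ EP); exact: h.
case: _ / e in f bf H H' s K t P fE EP *.
rewrite (eq_irrelevance H' H) -mul_col_mx.
have -> : castmx (H, erefl) (col_mx s K *m P) = castmx (H, erefl) (col_mx s K) *m P.
  by case: _ / H in H' s K t P f bf fE EP *; rewrite !castmx_id.
have PP : P *m P^T = 1%:M.
  have PTP : P^T *m P = 1%:M.
    by apply/matrixP => i j; rewrite (fE _ _ _ EP) EP !mxE (bij_eq bf) eq_sym.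
  exact: mulmx1C.
rewrite det_mulmx normrM.
have : \det P ^+ 2 = 1 by rewrite expr2 -{2}(det_tr P) -det_mulmx PP det1.
by move=> /eqP; rewrite sqrf_eq1 => /orP[] /eqP ->; rewrite ?normrN normr1 mulr1.
Qed.

Lemma perm_eq_index Phi Psi : perm_eq Psi Phi ->
  exists2 f : 'I_(size Psi) -> 'I_(size Phi), bijective f &
    forall i : 'I_(size Psi), Psi`_i = Phi`_(f i).
Proof.
move=> pe; have e := perm_size pe.
have /tuple_permP[p Ep] : perm_eq Psi (in_tuple Phi) by [].
exists (fun i => p (cast_ord e i)).
  apply: inj_card_bij; last by rewrite !card_ord e.
  by move=> i j /perm_inj/cast_ord_inj.
move=> i; rewrite {1}Ep (nth_map (cast_ord e i)) ?size_enum_ord -?e //.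
rewrite (tnth_nth 0) /=; congr (Phi`_(p _)); apply/val_inj => /=.
by rewrite nth_enum_ord // -e.
Qed.

Lemma vol_perm_eq Phi Psi a m (b : 'M[int]_(m, r)) :
  perm_eq Psi Phi -> \rank (rseqmx R Phi) = m -> Zbasis b (span_lattice R Phi) ->
  vol Psi a = vol Phi a.
Proof.
move=> pe rA Lb; have [f bf fE] := perm_eq_index pe.
pose P : 'M[R]_(size Phi, size Psi) := \matrix_(i, j) (f j == i)%:R.
have E1 : P *m rseqmx R Psi = rseqmx R Phi.
  have [g fK gK] := bf.
  apply/matrixP => i j; rewrite mxE (bigD1 (g i)) //= big1 ?addr0 => [|l li].
    by rewrite /P mxE gK eqxx mul1r !mxE fE gK.
  rewrite /P mxE; case: eqP => [E|]; last by rewrite mul0r.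
  by rewrite -E fK eqxx in li.
have E2 : P^T *m rseqmx R Phi = rseqmx R Psi.
  apply/matrixP => i j; rewrite mxE (bigD1 (f i)) //= big1 ?addr0 => [|l li].
    by rewrite /P !mxE eqxx mul1r fE.
  by rewrite /P !mxE eq_sym (negPf li) mul0r.
have ER : Rspan R Psi = Rspan R Phi.
  apply/seteqP; split => x /=; rewrite /Rspan /= => /submxP[y ->].
    by rewrite -E2 mulmxA submxMl.
  by rewrite -E1 mulmxA submxMl.
have rB : \rank (rseqmx R Psi) = m.
  apply/eqP; rewrite -rA eqn_leq -{1}E2 mxrankM_maxr /= -{1}E1 mxrankM_maxr //.
have [aA|aA] := pselect (Rspan R Phi a); last first.
  by rewrite !vol_notin // ER.
have [t Et] := submxP aA.
have Hk : (m + \rank (kermx (rseqmx R Phi)))%N = size Phi by rewrite -rA rank_add_ker.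
have Hk' : (m + \rank (kermx (rseqmx R Phi)))%N = size Psi by rewrite Hk (perm_size pe).
have Lb' : Zbasis b (span_lattice R Psi) by rewrite /span_lattice ER.
have bA : (map_mx intr b <= rseqmx R Phi)%MS.
  apply/row_subP => i; rewrite -map_row.
  suff : span_lattice R Phi (row i b) by [].
  by rewrite rowE; exact: (Zbasis_in (delta_mx 0 i) (span_lattice0 Phi) Lb).
have [s Es] := submxP bA.
pose K := row_base (kermx (rseqmx R Phi)).
have KA : K *m rseqmx R Phi = 0 by apply/sub_kermxP; rewrite eq_row_base.
have freeK : row_free K by exact: row_base_free.
clearbody K.
have PK : row_free P.
  apply/row_freeP; exists P^T; apply/matrixP => i j.
  have [g fK gK] := bf.
  rewrite !mxE (bigD1 (g i)) //= big1 ?addr0 => [|l li].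
    by rewrite !mxE gK eqxx mul1r.
  rewrite !mxE; case: eqP => [E|]; last by rewrite mul0r.
  by rewrite -E fK eqxx in li.
have := @vol_eq Phi _ _ Hk s K t b 1%:M a rA Lb KA freeK.
rewrite mul1mx => /(_ (esym Es) (esym Et)).
have := @vol_eq Psi _ _ Hk' (s *m P) (K *m P) (t *m P) b 1%:M a rB Lb'.
rewrite mul1mx -!mulmxA E1 => /(_ KA).
rewrite -Es -Et (mvol_perm (perm_size pe) bf Hk) // => <- //; last first.
  by rewrite /row_free mxrankMfree // -/(row_free K).
by rewrite det1 normr1 !mul1r.
Qed.

End VolEq.

(** The Smith normal form of a primitive vector is the first basis vector. *)
Lemma primitive_complete n (E : 'cV[int]_n.+1) : primitive E ->
  exists2 M : 'M[int]_n.+1, M \in unitmx & M *m E = delta_mx 0 0.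
Proof.
move=> pE; have [L uL [Q uQ [d _ ED]]] := int_Smith_normal_form E.
pose c : int := d`_0 * Q 0 0.
have E1 : E = c *: (L *m delta_mx 0 0).
  rewrite ED -mulmxA scalemxAr; congr (_ *m _); apply/colP => i.
  rewrite !mxE big_ord1 !mxE !ord1 /c eqxx andbT.
  case: (i =P 0) => [->|/eqP i0] /=; first by rewrite mulr1n mulr1.
  by rewrite -(inj_eq val_inj) /= in i0; rewrite (negPf i0) mul0r mulr0.
have uc := pE _ _ E1.
exists (c^-1 *: invmx L).
  by rewrite unitmxZ ?unitrV // unitmx_inv.
by rewrite E1 -scalemxAl -scalemxAr scalerA mulVr // scale1r mulKmx.
Qed.

Section VolRec.
Context {R : realType}.
Local Notation mu := (@lebesgue_measure R).
Local Notation intrmx := (map_mx (intr : int -> R)).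

Lemma pairing_int r (a : 'rV[int]_r) (x : 'cV[int]_r) :
  pairing (intrmx a) (intrmx x) = (pairing a x)%:~R.
Proof. by rewrite /pairing -map_mxM mxE. Qed.

Lemma pairingD (K : nzRingType) r (a b : 'rV[K]_r) x : pairing (a + b) x = pairing a x + pairing b x.
Proof. by rewrite /pairing mulmxDl mxE. Qed.
Lemma pairingB (K : nzRingType) r (a b : 'rV[K]_r) x : pairing (a - b) x = pairing a x - pairing b x.
Proof. by rewrite /pairing mulmxBl !mxE. Qed.
Lemma pairingZ (K : nzRingType) r c (b : 'rV[K]_r) x : pairing (c *: b) x = c * pairing b x.
Proof. by rewrite /pairing -scalemxAl mxE. Qed.
Lemma pairing0 (K : nzRingType) r (x : 'cV[K]_r) : pairing 0 x = 0.
Proof. by rewrite /pairing mul0mx mxE. Qed.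

Lemma rseqmx_cons r phi (Phi : seq 'rV[int]_r) :
  rseqmx R (phi :: Phi) = col_mx (intrmx phi) (rseqmx R Phi) :> 'M[R]_(1 + size Phi, r).
Proof.
apply/matrixP => i j; rewrite !mxE.
case: (split_ordP i) => k ->; rewrite ?col_mxEu ?col_mxEd !mxE //.
by rewrite !ord1.
Qed.

Lemma mulmx_rseqmx_cons r phi (Phi : seq 'rV[int]_r) (p : nat) (c : 'M[R]_(p, 1)) u :
  (row_mx c u : 'M[R]_(p, 1 + size Phi)) *m (rseqmx R (phi :: Phi) : 'M[R]_(1 + size Phi, r)) =
  c *m intrmx phi + u *m rseqmx R Phi.
Proof. by rewrite rseqmx_cons mul_row_col. Qed.

Definition half_space r (Phi : seq 'rV[int]_r) (h : 'cV[R]_r) :=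
  forall phi, phi \in Phi -> 0 < pairing (intrmx phi) h.

Lemma half_spaceP r (Phi : seq 'rV[int]_r) h : half_space Phi h ->
  forall i, 0 < (rseqmx R Phi *m h) i 0.
Proof.
move=> hP i; have := hP Phi`_i (mem_nth _ (ltn_ord i)).
suff -> : (rseqmx R Phi *m h) i 0 = pairing (intrmx Phi`_i) h by [].
by rewrite /pairing !mxE; apply: eq_bigr => j _; rewrite !mxE.
Qed.

Lemma Zbasis1 r : Zbasis (1%:M : 'M[int]_r) setT.
Proof.
move=> x; split=> // _; exists x; split; first by rewrite mulmx1.
by move=> y ->; rewrite mulmx1.
Qed.

Lemma rank_full r (Phi : seq 'rV[int]_r) : Rspan R Phi = setT -> \rank (rseqmx R Phi) = r.
Proof.
move=> full; apply/eqP; rewrite -[_ == _]/(row_full _) -sub1mx; apply/row_subP => i.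
by have : Rspan R Phi (row i 1%:M) by rewrite full.
Qed.

Lemma span_lattice_full r (Phi : seq 'rV[int]_r) : Rspan R Phi = setT -> span_lattice R Phi = setT.
Proof. by rewrite /span_lattice => ->. Qed.

Lemma vol_eq_full r (Phi : seq 'rV[int]_r) k (H : (r + k)%N = size Phi) s (K : 'M[R]_(k, _)) t U a :
  Rspan R Phi = setT -> K *m rseqmx R Phi = 0 -> row_free K ->
  s *m rseqmx R Phi = U -> t *m rseqmx R Phi = a ->
  `|\det U| * vol Phi a = fine (mvol H s K t).
Proof.
move=> full KA fK sA tA; apply: (@vol_eq _ _ _ _ _ H s K t 1%:M U) => //.
- exact: rank_full.
- by rewrite span_lattice_full //; exact: Zbasis1.
- by rewrite sA map_mx1 mulmx1.
Qed.

Lemma vol_eq1 r (Phi : seq 'rV[int]_r) k (H : (r + k)%N = size Phi) s (K : 'M[R]_(k, _)) t a :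
  Rspan R Phi = setT -> K *m rseqmx R Phi = 0 -> row_free K ->
  s *m rseqmx R Phi = 1%:M -> t *m rseqmx R Phi = a ->
  vol Phi a = fine (mvol H s K t).
Proof.
move=> full KA fK sA tA; rewrite -(vol_eq_full H full KA fK sA tA).
by rewrite det1 normr1 mul1r.
Qed.

(** The coefficient of phi in a point of the polytope is integrated over. *)
Lemma vol_cons_same r (phi : 'rV[int]_r) Phi h a : Rspan R Phi = setT ->
  half_space (phi :: Phi) h ->
  ((vol (phi :: Phi) a)%:E =
   \int[mu]_x ((\1_(`[0, +oo[%classic) x)%:E * (vol Phi (a - x *: intrmx phi))%:E))%E.
Proof.
move=> full hP.
have hP0 : half_space Phi h by move=> psi i; apply: hP; rewrite inE i orbT.
have rA := rank_full full.
have full' : Rspan R (phi :: Phi) = setT.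
  apply/seteqP; split=> // x _; rewrite /Rspan /=.
  have : Rspan R Phi x by rewrite full.
  move/submx_trans; apply; apply/submxP.
  exists (row_mx 0 1%:M : 'M[R]_(size Phi, 1 + size Phi)).
  by rewrite mulmx_rseqmx_cons mul0mx mul1mx add0r.
set A := rseqmx R Phi.
have fA : row_full A by rewrite /row_full rA.
have inA (y : 'rV[R]_r) : y *m pinvmx A *m A = y by rewrite -mulmxA mulVpmx ?mulmx1.
pose k := \rank (kermx A).
have H : (r + k)%N = size Phi by rewrite -{1}rA rank_add_ker.
have H' : (r + (1 + k))%N = (1 + size Phi)%N by lia.
pose K : 'M[R]_(k, _) := row_base (kermx A).
have KA : K *m A = 0 by apply/sub_kermxP; rewrite eq_row_base.
have freeK : row_free K by exact: row_base_free.
clearbody K.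
have E1 x : (vol Phi (a - x *: intrmx phi))%:E =
  mvol H (pinvmx A) K (a *m pinvmx A - x *: (intrmx phi *m pinvmx A)).
  rewrite (vol_eq1 H (s := pinvmx A) (K := K) 
    (t := a *m pinvmx A - x *: (intrmx phi *m pinvmx A))) ?mulVpmx //.
    by rewrite fineK //; apply: mvol_fin freeK KA (half_spaceP hP0).
  by rewrite mulmxBl -scalemxAl !inA.
under eq_integral do rewrite E1.
rewrite -(mvol_cons_same H H').
set s' := row_mx _ _; set K' := col_mx _ _; set t' := row_mx _ _.
have KA' : K' *m (rseqmx R (phi :: Phi)) = 0.
  rewrite /K' mul_col_mx !mulmx_rseqmx_cons mul1mx mulNmx inA subrr.
  by rewrite mul0mx add0r KA col_mx0.
have freeK' : row_free K'.
  apply/row_freeP; exists (block_mx 1 (intrmx phi *m pinvmx A *m pinvmx K) 0 (pinvmx K)).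
  rewrite -[K']/(block_mx _ _ _ _) mulmx_block !mulmx0 !mul0mx !mul1mx !addr0 add0r.
  by rewrite mulNmx subrr mulmxVp // -scalar_mx_block.
rewrite (vol_eq1 (Phi := phi :: Phi) H' (s := s') (K := K') (t := t')) //.
- by rewrite fineK //; apply: mvol_fin freeK' KA' (half_spaceP hP).
- by rewrite mulmx_rseqmx_cons mul0mx add0r mulVpmx.
- by rewrite mulmx_rseqmx_cons mul0mx add0r inA.
Qed.

Lemma Zbasis_hyperplane n (E : 'cV[int]_n.+1) (M : 'M[int]_n.+1) :
  M \in unitmx -> M *m E = delta_mx 0 0 ->
  Zbasis (dsubmx (M : 'M[int]_(1 + n, n.+1))) [set x | pairing x E = 0].
Proof.
move=> uM ME; set b := dsubmx _.
have ME' : row_mx (0 : 'M[int]_(n, 1)) 1%:M *m M = b.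
  by rewrite -[M in LHS](@vsubmxK _ 1 n) mul_row_col mul0mx add0r mul1mx.
have bi : injective (mulmx^~ b : 'rV_n -> 'rV_n.+1).
  move=> u v /=; rewrite -ME' !mulmxA => /(congr1 (mulmxr (invmx M))) /=.
  by rewrite !mulmxK // !mul_mx_row !mulmx0 !mulmx1 => /(congr1 (@rsubmx _ 1 1 n)); rewrite !row_mxKr.
move=> x; split=> /= [xE|[u [-> _]]]; last first.
  rewrite /pairing -ME' -!mulmxA ME mulmxA mul_mx_row mulmx0 mulmx1.
  rewrite -colE mxE.
  have -> : (0 : 'I_(1 + n)) = lshift n 0 by apply/val_inj.
  by rewrite row_mxEl mxE.
pose y : 'rV[int]_(1 + n) := x *m invmx M.
have y0 : lsubmx y = 0.
  apply/rowP => i; rewrite !ord1 [LHS]mxE [RHS]mxE.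
  transitivity ((y *m delta_mx 0 0 : 'M[int]_1) 0 0).
    by rewrite -colE [RHS]mxE; congr (y _ _); exact/val_inj.
  by rewrite -ME mulmxA mulmxKV.
exists (rsubmx y); split.
  rewrite -ME' mulmxA mul_mx_row mulmx0 mulmx1 -y0 hsubmxK /y.
  by rewrite mulmxKV.
by move=> v xv; apply: bi => /=; rewrite -xv -ME' mulmxA mul_mx_row mulmx0 mulmx1 -y0 hsubmxK mulmxKV.
Qed.

Lemma span_lattice_hyperplane n (Phi : seq 'rV[int]_n.+1) (E : 'cV[int]_n.+1) :
  Rspan R Phi = hyperplane R E -> span_lattice R Phi = [set x | pairing x E = 0].
Proof.
move=> EW; rewrite /span_lattice EW; apply/seteqP; split => x /=.
  by rewrite /hyperplane /= pairing_int => /eqP; rewrite intr_eq0 => /eqP.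
by rewrite /hyperplane /= pairing_int => ->.
Qed.

(** The coefficient x of phi is forced, and the index of the sublattice generated by phi
    and the lattice of the wall is the denominator. *)
Lemma vol_cons_wall n (phi : 'rV[int]_n.+1) Phi (E : 'cV[int]_n.+1) (a : 'rV[R]_n.+1) :
  primitive E -> Rspan R Phi = hyperplane R E -> \rank (rseqmx R Phi) = n ->
  pairing phi E != 0 ->
  let x := pairing a (intrmx E) / (pairing phi E)%:~R in
  vol (phi :: Phi) a =
   (0 <= x)%R%:R * vol Phi (a - x *: intrmx phi) / `|(pairing phi E)%:~R|.
Proof.
move=> pE EW rA phiE x.
have [M uM ME] := primitive_complete pE.
set c : R := (pairing phi E)%:~R.
have c0 : c != 0 by rewrite intr_eq0.
pose b : 'M[int]_(n, n.+1) := dsubmx (M : 'M[int]_(1 + n, n.+1)).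
have Lb : Zbasis b (span_lattice R Phi).
  by rewrite (span_lattice_hyperplane EW); exact: Zbasis_hyperplane.
set A := rseqmx R Phi.
pose k := \rank (kermx A).
have H : (n + k)%N = size Phi by rewrite -{1}rA rank_add_ker.
have H' : (1 + n + k)%N = (1 + size Phi)%N by lia.
pose K : 'M[R]_(k, _) := row_base (kermx A).
have KA : K *m A = 0 by apply/sub_kermxP; rewrite eq_row_base.
have freeK : row_free K by exact: row_base_free.
clearbody K.
have bA : (intrmx b <= A)%MS.
  apply/row_subP => i; rewrite -map_row.
  suff : span_lattice R Phi (row i b) by [].
  by rewrite rowE; exact: (Zbasis_in (delta_mx 0 i) (span_lattice0 _) Lb).
have inA (y : 'rV[R]_n.+1) : pairing y (intrmx E) = 0 -> (y <= A)%MS.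
  move=> yE; suff : Rspan R Phi y by [].
  by rewrite EW.
have wW : pairing (a - x *: intrmx phi) (intrmx E) = 0.
  by rewrite pairingB pairingZ pairing_int /x mulfVK // subrr.
pose s := intrmx b *m pinvmx A; pose t := (a - x *: intrmx phi) *m pinvmx A.
pose s' : 'M[R]_(1 + n, 1 + size Phi) := col_mx (row_mx 1 0) (row_mx 0 s).
pose K' : 'M[R]_(k, 1 + size Phi) := row_mx 0 K.
pose t' : 'rV[R]_(1 + size Phi) := row_mx (const_mx x) t.
pose U : 'M[R]_(1 + n) := col_mx (intrmx phi) (intrmx b).
have full' : Rspan R (phi :: Phi) = setT.
  apply/seteqP; split=> // y _; rewrite /Rspan /=; apply/submxP.
  pose d := pairing y (intrmx E) / c.
  have /submxP[w Ew] : (y - d *: intrmx phi <= A)%MS.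
    by apply: inA; rewrite pairingB pairingZ pairing_int -/c mulfVK // subrr.
  exists (row_mx d%:M w : 'M[R]_(1, 1 + size Phi)).
  by rewrite mulmx_rseqmx_cons -Ew mul_scalar_mx addrC subrK.
have freeK' : row_free K'.
  apply/row_freeP; exists (col_mx 0 (pinvmx K)).
  by rewrite mul_row_col mul0mx add0r mulmxVp.
have s'A : s' *m (rseqmx R (phi :: Phi) : 'M[R]_(1 + size Phi, n.+1)) = U.
  rewrite /s' mul_col_mx !mulmx_rseqmx_cons mul1mx !mul0mx add0r addr0.
  by rewrite mulmxKpV.
have t'A : t' *m (rseqmx R (phi :: Phi) : 'M[R]_(1 + size Phi, n.+1)) = a.
  rewrite /t' mulmx_rseqmx_cons mulmxKpV; last exact: inA.
  have -> : const_mx x = x%:M :> 'M[R]_1.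
    by apply/matrixP => i j; rewrite !ord1 !mxE eqxx.
  by rewrite mul_scalar_mx addrC subrK.
have EV := vol_eq_full (Phi := phi :: Phi) H' (s := s') (K := K') (t := t') (U := U) (a := a) full'.
have detU : `|\det U| = `|c|.
  pose y : 'rV[int]_(1 + n) := phi *m invmx M.
  have Ey : phi = y *m M by rewrite mulmxKV.
  have cy : lsubmx y = (pairing phi E)%:M.
    apply/rowP => i; rewrite !ord1 [LHS]mxE [RHS]mxE eqxx mulr1n.
    transitivity ((y *m delta_mx 0 0 : 'M[int]_1) 0 0).
      by rewrite -colE [RHS]mxE; congr (y _ _); exact/val_inj.
    by rewrite -ME mulmxA -Ey.
  have -> : U = intrmx ((block_mx (pairing phi E)%:M (rsubmx y) 0 1%:M : 'M[int]_(1 + n)) *m M).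
    rewrite /U -map_col_mx; congr map_mx.
    rewrite -[M in RHS](@vsubmxK _ 1 n) mul_block_col mul0mx add0r mul1mx; congr col_mx.
    by rewrite -cy -mul_row_col hsubmxK vsubmxK.
  rewrite map_mxM det_mulmx normrM (absdet_unit R uM) mulr1 det_map_mx det_ublock.
  by rewrite det1 mulr1 det_scalar1.
have Ewall := mvol_cons_wall H H' s K x t.
have EV0 : vol Phi (a - x *: intrmx phi) = fine (mvol H s K t).
  rewrite -(@vol_eq _ _ Phi _ _ H s K t b 1%:M (a - x *: intrmx phi)) //.
  - by rewrite det1 normr1 mul1r.
  - by rewrite mul1mx mulmxKpV.
  - by rewrite mulmxKpV //; exact: inA.
have {}EV : `|c| * vol (phi :: Phi) a = (0 <= x)%R%:R * vol Phi (a - x *: intrmx phi).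
  rewrite -detU EV.
  - rewrite EV0 Ewall fineZ; congr (_%:R * _).
    rewrite -[RHS]/(nat_of_bool _); congr nat_of_bool.
    by apply/idP/idP; rewrite inE /= in_itv /= andbT.
  - by rewrite /K' mulmx_rseqmx_cons mul0mx add0r.
  - exact: freeK'.
  - exact: s'A.
  - exact: t'A.
by rewrite -EV mulrC mulrA mulVf ?mul1r // normr_eq0.
Qed.

End VolRec.

(** * Germs at infinity and jumps across a hyperplane *)

Section Germ.
Context {R : realType} {G : zmodType}.
Variables (w : G) (e : G -> R).
Hypotheses (eD : forall a b, e (a + b) = e a + e b) (ew : e w = 0).
Implicit Types (f g : G -> R) (a b d : G).

Definition nabla d f a := f a - f (a - d).

Fixpoint nablas (ds : seq G) f := if ds is d :: ds' then nablas ds' (nabla d f) else f.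

(** The germ of f at infinity, in the direction w, at a. *)
Definition eventually0 f a := exists n0 : nat, forall n, (n0 <= n)%N -> f (a + w *+ n) = 0.

(** The trace on half-lines with integral steps of the notion of polynomial function; it
    makes sense on a lattice as well as on a vector space. *)
Definition poly_on_rays f := forall a b, exists p : {poly R}, forall n : nat, f (a + b *+ n) = p.[n%:R].

Let e0 : e 0 = 0.
Proof. by apply: (addIr (e 0)); rewrite -eD !add0r. Qed.
Let eN a : e (- a) = - e a.
Proof. by apply: (addIr (e a)); rewrite -eD !addNr e0. Qed.
Let eMn a n : e (a *+ n) = e a *+ n.
Proof. by elim: n => [|n IH]; rewrite ?mulr0n ?e0 // !mulrS eD IH. Qed.

Lemma eq_eventually0 f g a : f =1 g -> eventually0 f a -> eventually0 g a.
Proof. by move=> fg [n0 h]; exists n0 => n /h; rewrite fg. Qed.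

Lemma eventually0D f g a : eventually0 f a -> eventually0 g a -> eventually0 (fun x => f x + g x) a.
Proof.
move=> [n h] [m k]; exists (maxn n m) => l; rewrite geq_max => /andP[/h -> /k ->].
by rewrite addr0.
Qed.

Lemma eventually0B f g a : eventually0 f a -> eventually0 g a -> eventually0 (fun x => f x - g x) a.
Proof.
move=> [n h] [m k]; exists (maxn n m) => l; rewrite geq_max => /andP[/h -> /k ->].
by rewrite subr0.
Qed.

Lemma eventually0_shift f a d : eventually0 f (a + d) -> eventually0 (fun x => f (x + d)) a.
Proof. by move=> [n0 h]; exists n0 => n /h <-; rewrite addrAC. Qed.

Lemma eventually0_nabla f a d : eventually0 f a -> eventually0 f (a - d) -> eventually0 (nabla d f) a.
Proof. by move=> h1 h2; apply: eventually0B => //; exact: eventually0_shift. Qed.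

(** From a half-space on which f vanishes, each use of nabla_d f = 0 gains a strip of
    width |e d|, whatever the sign of e d. *)
Lemma nabla_half f d c : e d != 0 ->
  (forall a, e a < c -> eventually0 f a) -> (forall a, eventually0 (nabla d f) a) -> forall a, eventually0 f a.
Proof.
move=> d0 fc fd; have H (m : nat) a : e a < c + `|e d| *+ m -> eventually0 f a.
  elim: m a => [|m IH] a; first by rewrite mulr0n addr0; exact: fc.
  rewrite mulrS addrCA => h.
  have [ed|ed] := ltrP 0 (e d).
    apply: (@eq_eventually0 (fun x => nabla d f x + f (x - d))) => [x|].
      by rewrite /nabla subrK.
    apply: eventually0D => //; apply: eventually0_shift; apply: IH.
    by move: h; rewrite eD eN gtr0_norm //; lra.
  have {}ed : e d < 0 by rewrite lt_neqAle d0.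
  apply: (@eq_eventually0 (fun x => f (x + d) - nabla d f (x + d))) => [x|].
    by rewrite /nabla addrK subKr.
  apply: eventually0B; apply: eventually0_shift => //; apply: IH.
  by move: h; rewrite eD ltr0_norm //; lra.
move=> a; have ed : 0 < `|e d| by rewrite normr_gt0.
pose m := Num.truncn ((e a - c) / `|e d|).
apply: (H m.+1); have := truncnS_gt ((e a - c) / `|e d|).
by rewrite ltr_pdivrMr // -/m mulr_natl; lra.
Qed.

Lemma eq_nablas ds f g : f =1 g -> nablas ds f =1 nablas ds g.
Proof. by move=> /funext ->. Qed.

Lemma nablasB ds f g a : nablas ds (fun x => f x - g x) a = nablas ds f a - nablas ds g a.
Proof.
elim: ds f g => [|d ds IH] f g //=; rewrite -IH; apply: eq_nablas => x.
by rewrite /nabla; ring.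
Qed.

Lemma eventually0_nablas ds f c : (forall a, e a < c -> eventually0 f a) ->
  forall a, e a < c - \sum_(d <- ds) `|e d| -> eventually0 (nablas ds f) a.
Proof.
elim: ds f c => [|d ds IH] f c fc a; first by rewrite big_nil subr0; exact: fc.
rewrite big_cons => h /=; apply: (IH _ (c - `|e d|)); last by lra.
move=> b hb; have := ler_norm (- e d); have := normr_ge0 (e d); rewrite normrN => h1 h2.
by apply: eventually0_nabla; apply: fc; rewrite ?eD ?eN; lra.
Qed.

Lemma nablas_half ds f c : (forall d, d \in ds -> e d != 0) ->
  (forall a, e a < c -> eventually0 f a) -> (forall a, eventually0 (nablas ds f) a) -> forall a, eventually0 f a.
Proof.
elim: ds f c => [|d ds IH] f c dsP fc h //.
have d0 : e d != 0 by apply: dsP; rewrite mem_head.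
apply: (nabla_half d0 fc); apply: (IH _ (c - `|e d|)) => //.
  by move=> b bs; apply: dsP; rewrite inE bs orbT.
by move=> a ha; have := @eventually0_nablas [:: d] f c fc a; rewrite big_seq1 => /(_ ha).
Qed.

Lemma poly_ev0 (p : {poly R}) (n0 : nat) : (forall n, (n0 <= n)%N -> p.[n%:R] = 0) -> p = 0.
Proof.
move=> h; apply/eqP; apply: contraT => p0.
pose rs := [seq (i%:R : R) | i <- iota n0 (size p)].
have := @max_poly_roots _ p rs p0; rewrite size_map size_iota ltnn; apply.
  by apply/allP => x /mapP[i]; rewrite mem_iota => /andP[h1 _] ->; apply/rootP; exact: h.
by rewrite map_inj_uniq ?iota_uniq //; exact: (@mulrIn _ 1 (oner_neq0 _)).
Qed.

Lemma poly_on_rays_ev0 f a b n0 : poly_on_rays f -> (forall n, (n0 <= n)%N -> f (a + b *+ n) = 0) -> f a = 0.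
Proof.
move=> fp h; have [p pE] := fp a b.
have p0 : p = 0 by apply: (@poly_ev0 _ n0) => n /h; rewrite pE.
by have := pE 0%N; rewrite mulr0n addr0 p0 horner0.
Qed.

Lemma poly_on_rays_eventually0 f a : poly_on_rays f -> eventually0 f a -> f a = 0.
Proof. by move=> fp [n0]; exact: poly_on_rays_ev0. Qed.

Lemma poly_on_rays_half f c (g : G) : poly_on_rays f -> 0 < e g -> (forall a, c < e a -> f a = 0) -> forall a, f a = 0.
Proof.
move=> fp g0 fc a; pose n0 := (Num.truncn (`|c - e a| / e g)).+1.
apply: (@poly_on_rays_ev0 _ _ g n0) => // n hn; apply: fc.
have := truncnS_gt (`|c - e a| / e g).
rewrite ltr_pdivrMr // -/n0 => h; have := ler_norm (c - e a) => h'.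
have : n0%:R * e g <= n%:R * e g by rewrite ler_pM2r // ler_nat.
by rewrite eD eMn -mulr_natl; lra.
Qed.

Lemma poly_on_raysB f g : poly_on_rays f -> poly_on_rays g -> poly_on_rays (fun x => f x - g x).
Proof.
move=> fp gp a b; have [p pE] := fp a b; have [q qE] := gp a b.
by exists (p - q) => n; rewrite pE qE !hornerE.
Qed.

Lemma poly_on_rays_nabla d f : poly_on_rays f -> poly_on_rays (nabla d f).
Proof.
move=> fp; apply: poly_on_raysB => // a b; have [p pE] := fp (a - d) b.
by exists p => n; rewrite addrAC pE.
Qed.

Lemma poly_on_rays_nablas ds f : poly_on_rays f -> poly_on_rays (nablas ds f).
Proof. by elim: ds f => [|d ds IH] f fp //=; apply/IH/poly_on_rays_nabla. Qed.

Lemma poly_on_rays_opp_half f c (g : G) : poly_on_rays f -> 0 < e g -> (forall a, e a < c -> f a = 0) -> forall a, f a = 0.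
Proof.
move=> fp g0 fc a; pose n0 := (Num.truncn (`|c - e a| / e g)).+1.
apply: (@poly_on_rays_ev0 _ _ (- g) n0) => // n hn; apply: fc.
have := truncnS_gt (`|c - e a| / e g).
rewrite ltr_pdivrMr // -/n0 => h; have := ler_norm (- (c - e a)); rewrite normrN => h'.
have : n0%:R * e g <= n%:R * e g by rewrite ler_pM2r // ler_nat.
by rewrite eD eMn eN mulNrn -mulr_natl; lra.
Qed.

(** f - A - k2 is a germ vanishing on the negative side and killed by the nablas.  That
    the nablas kill k2 is seen deep in the negative side, where f - A is k2, and k2 is
    polynomial. *)
Theorem wall_jump (ds : seq G) f A k1 k2 Q (g : G) :
  poly_on_rays k1 -> poly_on_rays k2 -> poly_on_rays Q -> 0 < e g ->
  (forall d, d \in ds -> e d != 0) ->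
  (forall a, 0 < e a -> eventually0 (fun x => f x - k1 x) a) ->
  (forall a, e a < 0 -> eventually0 (fun x => f x - k2 x) a) ->
  (forall a, e a < 0 -> A a = 0) -> (forall a, 0 < e a -> A a = Q a) ->
  (forall a, eventually0 (nablas ds (fun x => f x - A x)) a) ->
  forall a, k1 a - k2 a = Q a.
Proof.
move=> p1 p2 pQ g0 dsP f1 f2 A0 AQ fA.
have ewn a n : e (a + w *+ n) = e a by rewrite eD eMn ew mul0rn addr0.
pose D x := (f x - A x) - k2 x.
have D0 a : e a < 0 -> eventually0 D a.
  move=> a0; have [n0 h] := f2 _ a0; exists n0 => n /h.
  by rewrite /D A0 ?ewn // subr0.
have nk2 : forall a, nablas ds k2 a = 0.
  apply: (@poly_on_rays_opp_half _ (0 - \sum_(d <- ds) `|e d|) g) => //.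
    exact: poly_on_rays_nablas.
  move=> a ha; apply: poly_on_rays_eventually0; first exact: poly_on_rays_nablas.
  apply: (@eq_eventually0 (fun x => nablas ds (fun x => f x - A x) x - nablas ds D x)).
    by move=> x; rewrite /D (nablasB ds (fun x => f x - A x) k2) subKr.
  by apply: eventually0B => //; exact: eventually0_nablas ha.
have Dz : forall a, eventually0 D a.
  apply: (@nablas_half ds D 0) => // a.
  apply: (eq_eventually0 _ (fA a)) => x; by rewrite /D (nablasB ds (fun x => f x - A x) k2) nk2 subr0.
suff H : forall a, (k1 a - k2 a) - Q a = 0.
  by move=> a; apply/eqP; rewrite -subr_eq0 H.
have pp : poly_on_rays (fun a => k1 a - k2 a - Q a).
  by apply: poly_on_raysB => //; exact: poly_on_raysB.
apply: (poly_on_rays_half (c := 0) pp g0) => a a0; apply: (poly_on_rays_eventually0 pp).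
have [n h1] := Dz a; have [m h2] := f1 a a0.
exists (maxn n m) => l; rewrite geq_max => /andP[/h1 + /h2].
by rewrite /D AQ ?ewn //; lra.
Qed.

End Germ.

(** * Residues of polynomials in a function with a simple pole *)

Section Formal.
Context {R : realType}.
Implicit Types (P Q : {poly R}) (c d : nat -> R).

(** Congruence of formal power series modulo X^N, on polynomial representatives. *)
Definition eqm (N : nat) P Q := forall i, (i < N)%N -> P`_i = Q`_i.

Lemma eqm_refl N P : eqm N P P. Proof. by []. Qed.
Lemma eqm_sym N P Q : eqm N P Q -> eqm N Q P. Proof. by move=> h i /h. Qed.
Lemma eqm_trans N P Q S : eqm N P Q -> eqm N Q S -> eqm N P S.
Proof. by move=> h1 h2 i iN; rewrite h1 ?h2. Qed.
Lemma eqmD N P P' Q Q' : eqm N P P' -> eqm N Q Q' -> eqm N (P + Q) (P' + Q').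
Proof. by move=> h1 h2 i iN; rewrite !coefD h1 ?h2. Qed.
Lemma eqmN N P P' : eqm N P P' -> eqm N (- P) (- P').
Proof. by move=> h1 i iN; rewrite !coefN h1. Qed.
Lemma eqmB N P P' Q Q' : eqm N P P' -> eqm N Q Q' -> eqm N (P - Q) (P' - Q').
Proof. by move=> h1 h2; exact/eqmD/eqmN. Qed.
Lemma eqmM N P P' Q Q' : eqm N P P' -> eqm N Q Q' -> eqm N (P * Q) (P' * Q').
Proof.
move=> h1 h2 i iN; rewrite !coefM; apply: eq_bigr => j _.
by rewrite h1 ?h2 //; have := ltn_ord j; lia.
Qed.
Lemma eqmX N P P' n : eqm N P P' -> eqm N (P ^+ n) (P' ^+ n).
Proof. by move=> h; elim: n => [|n IH] //; rewrite !exprS; exact: eqmM. Qed.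
Lemma eqm_deriv N P P' : eqm N.+1 P P' -> eqm N P^`() P'^`().
Proof. by move=> h i iN; rewrite !coef_deriv h. Qed.
Lemma eqm_mulX N P P' : eqm N P P' -> eqm N.+1 ('X * P) ('X * P').
Proof. by move=> h [|i] iN; rewrite !coefXM //=; exact: h. Qed.
Lemma eqm_le N M P Q : (M <= N)%N -> eqm N P Q -> eqm M P Q.
Proof. by move=> MN h i iM; apply: h; exact: leq_trans MN. Qed.

Definition tr (N : nat) c : {poly R} := \poly_(i < N) c i.

Lemma eqm_tr N M c : (M <= N)%N -> eqm M (tr N c) (tr M c).
Proof. by move=> MN i iM; rewrite !coef_poly iM (leq_trans iM MN). Qed.

(** The coefficient of degree k of the n-th power of the series c. *)
Definition cpow c n k : R := (tr k.+1 c ^+ n)`_k.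

Lemma cpowE c n k N : (k < N)%N -> cpow c n k = (tr N c ^+ n)`_k.
Proof. by move=> kN; apply/esym/(eqmX n (eqm_tr (N := N) c _)). Qed.

Definition conv c d n := \sum_(i < n.+1) c i * d (n - i)%N.

Lemma convE c d n N M : (n < N)%N -> (n < M)%N -> conv c d n = (tr N c * tr M d)`_n.
Proof.
move=> nN nM; rewrite coefM; apply: eq_bigr => i _; rewrite !coef_poly.
have := ltn_ord i; rewrite ltnS => h.
by rewrite (leq_ltn_trans h nN) (leq_ltn_trans (leq_subr _ _) nM).
Qed.

Lemma cpow0 c k : cpow c 0 k = (k == 0)%N%:R.
Proof. by rewrite /cpow expr0 coef1. Qed.

Lemma cpowS c n : cpow c n.+1 =1 conv c (cpow c n).
Proof.
move=> k; rewrite /cpow exprS coefM; apply: eq_bigr => i _.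
rewrite coef_poly (ltn_ord i) -/(cpow _ _ _) -cpowE //.
by have := ltn_ord i; lia.
Qed.

Definition expseq (j : R) n := j ^+ n / n`!%:R.

(** The residue at 0 of exp(j z) (c(z) / z)^n, as a polynomial in j. *)
Definition pole_coef c n : {poly R} := \poly_(i < n) (cpow c n (n.-1 - i)%N / i`!%:R).

Lemma pole_coefE c n j N : (n < N)%N ->
  (pole_coef c n.+1).[j] = (tr N c ^+ n.+1 * tr N (expseq j))`_n.
Proof.
move=> nN; rewrite horner_poly mulrC coefM; apply: eq_bigr => i _ /=.
have iN : (i < N)%N by have := ltn_ord i; lia.
rewrite coef_poly iN.
rewrite -cpowE; last by have := ltn_ord i; lia.
by rewrite /expseq mulrAC [RHS]mulrC mulrA.
Qed.

Lemma pole_coefE_conv c n j : (pole_coef c n.+1).[j] = conv (cpow c n.+1) (expseq j) n.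
Proof.
rewrite (@pole_coefE _ _ _ n.+1) // coefM; apply: eq_bigr => i _; rewrite coef_poly ltnS leq_subr.
by rewrite (@cpowE _ _ _ n.+1).
Qed.

Lemma pole_coef0 c : pole_coef c 0 = 0.
Proof. by apply/polyP => i; rewrite coef_poly coef0. Qed.

Definition res_poly c P : {poly R} := \sum_(n < size P) P`_n *: pole_coef c n.

Lemma res_polyE c P N : (size P <= N)%N -> res_poly c P = \sum_(n < N) P`_n *: pole_coef c n.
Proof.
move=> h; rewrite /res_poly -(big_mkord xpredT (fun n => P`_n *: pole_coef c n)).
rewrite -(big_mkord xpredT (fun n => P`_n *: pole_coef c n)) [RHS](@big_cat_nat _ _ _ (size P)) //=.
rewrite [X in _ = _ + X]big_nat_cond [X in _ = _ + X]big1 ?addr0 // => i /andP[/andP[hi _] _].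
by rewrite nth_default // scale0r.
Qed.

Lemma res_poly_is_linear c : linear (res_poly c).
Proof.
move=> k P Q; pose N := maxn (size (k *: P + Q)) (maxn (size P) (size Q)).
rewrite !(@res_polyE c _ N) ?/N ?leq_max ?leqnn ?orbT //.
rewrite scaler_sumr -big_split /=; apply: eq_bigr => i _.
by rewrite coefD coefZ scalerDl scalerA.
Qed.
HB.instance Definition _ c := GRing.isLinear.Build R {poly R} {poly R} _ (res_poly c) (res_poly_is_linear c).

Lemma res_polyXn c n : res_poly c 'X^n = pole_coef c n.
Proof.
rewrite (@res_polyE c _ n.+1) ?size_polyXn // big_ord_recr /= coefXn eqxx scale1r.
by rewrite big1 ?add0r // => i _; rewrite coefXn ltn_eqF // scale0r.
Qed.

(** The residue at 0 of exp(j z) P(F z) where F z = c(z) / z, by linearity in P.  Constants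
    have no residue, and the dependence on j is polynomial. *)
Definition res c (j : R) P := (res_poly c P).[j].

Lemma resB c j P Q : res c j (P - Q) = res c j P - res c j Q.
Proof. by rewrite /res linearB !hornerE. Qed.
Lemma resZ c j k P : res c j (k *: P) = k * res c j P.
Proof. by rewrite /res linearZ !hornerE. Qed.
Lemma res_sum c j I (r : seq I) (Pr : pred I) (F : I -> {poly R}) :
  res c j (\sum_(i <- r | Pr i) F i) = \sum_(i <- r | Pr i) res c j (F i).
Proof. by rewrite /res linear_sum horner_sum. Qed.
Lemma resC c j k : res c j k%:P = 0.
Proof. by rewrite -alg_polyC -(expr0 'X) resZ /res res_polyXn pole_coef0 horner0 mulr0. Qed.

End Formal.

Section Analytic.
Context {R : realType}.
Implicit Types (c d : nat -> R) (f g h : R -> R).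

(** A geometric bound on the coefficients is part of the definition because it makes the
    Cauchy product converge. *)
Definition has_expansion c h :=
  (exists2 M : R, 1 <= M & forall n, `|c n| <= M ^+ n.+1) /\
  \forall z \near (0 : R), series (fun n => c n * z ^+ n) @ \oo --> h z.

Lemma series_tr c z n : series (fun n => c n * z ^+ n) n = (tr n c).[z].
Proof. by rewrite /series /= big_mkord horner_poly. Qed.

Lemma has_expansion_bound2 c d : (exists2 M : R, 1 <= M & forall n, `|c n| <= M ^+ n.+1) ->
  (exists2 M : R, 1 <= M & forall n, `|d n| <= M ^+ n.+1) ->
  exists2 M : R, 1 <= M & forall n, `|c n| <= M ^+ n.+1 /\ `|d n| <= M ^+ n.+1.
Proof.
move=> [M M1 hM] [N N1 hN]; exists (Num.max M N); first by rewrite le_max M1.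
move=> n; have M0 : 0 <= M by lra. have N0 : 0 <= N by lra.
split; [apply: le_trans (hM n) _|apply: le_trans (hN n) _];
  by rewrite lerXn2r // ?nnegrE ?le_max ?M0 ?N0 ?lexx ?orbT.
Qed.

Lemma eq_has_expansion c d f : c =1 d -> has_expansion c f -> has_expansion d f.
Proof. by move=> /funext ->. Qed.

(** The product of the partial sums of order n contains the partial sum of the product;
    the rest is bounded by a geometric sequence for small z. *)
Lemma has_expansion_conv c d f g : has_expansion c f -> has_expansion d g -> has_expansion (conv c d) (fun z => f z * g z).
Proof.
move=> [bc hc] [bd hd]; have [M M1 hM] := has_expansion_bound2 bc bd.
have M0 : 0 <= M by lra. have Mp : 0 < M by lra.
split.
  exists (2 * M ^+ 2); first by have := exprn_ege1 2 M1; lra.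
  move=> n; apply: le_trans (ler_norm_sum _ _ _) _.
  apply: (@le_trans _ _ (\sum_(i < n.+1) M ^+ n.+2)).
    apply: ler_sum => i _; rewrite normrM.
    apply: (@le_trans _ _ (M ^+ i.+1 * M ^+ (n - i).+1)).
      by apply: ler_pM => //; [case: (hM i) | case: (hM (n - i)%N)].
    by rewrite -exprD; apply: ler_weXn2l => //; have := ltn_ord i; lia.
  rewrite sumr_const card_ord exprMn -exprM -[X in X <= _]mulr_natl; apply: ler_pM => //.
  - by rewrite exprn_ge0.
  - by rewrite -natrX ler_nat; apply/ltnW/ltn_expl.
  by apply: ler_weXn2l => //; lia.
near=> z.
have hz : 4 * M * `|z| < 1.
  rewrite -ltr_pdivlMl ?mulr1; last by rewrite mulr_gt0.
  near: z; apply: (@nbhs0_lt R R); rewrite invr_gt0 mulr_gt0 //.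
have hfz : series (fun n => c n * z ^+ n) @ \oo --> f z by near: z.
have hgz : series (fun n => d n * z ^+ n) @ \oo --> g z by near: z.
(* D is the part of the product of the truncations beyond the degree n. *)
pose D n := (tr n c).[z] * (tr n d).[z] - (tr n (conv c d)).[z].
have DB n : `|D n| <= M ^+ 2 * (4 * M * `|z|) ^+ n.
  rewrite /D -hornerM (@horner_coef_wide _ (n + n)); last first.
    apply: leq_trans (size_polyMleq _ _) _; have sc : (size (tr n c) <= n)%N by exact: size_poly.
    have sd : (size (tr n d) <= n)%N by exact: size_poly.
    by move: sc sd; case: (size _) => [|a]; case: (size _) => [|b]; lia.
  rewrite big_split_ord /= horner_poly.
  rewrite (eq_bigr (fun i : 'I_n => conv c d i * z ^+ i)); last first.
    by move=> i _; rewrite (@convE _ _ _ _ n n).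
  rewrite addrAC subrr add0r; apply: le_trans (ler_norm_sum _ _ _) _.
  apply: (@le_trans _ _ (\sum_(i < n) n%:R * (M ^+ 2 * (M * `|z|) ^+ n))).
    apply: ler_sum => i _; rewrite normrM normrX.
    have -> : n%:R * (M ^+ 2 * (M * `|z|) ^+ n) = n%:R * M ^+ n.+2 * `|z| ^+ n.
      by rewrite exprMn -[n.+2]addn2 exprD; ring.
    apply: (@le_trans _ _ (n%:R * M ^+ (n + i).+2 * `|z| ^+ (n + i))).
      apply: ler_wpM2r; first by rewrite exprn_ge0.
      rewrite coefM; apply: le_trans (ler_norm_sum _ _ _) _.
      have -> : n%:R * M ^+ (n + i).+2 = \sum_(j < (n + i).+1 | (j < n)%N) M ^+ (n + i).+2.
        rewrite -(big_ord_widen _ (fun=> M ^+ (n + i).+2)) ?sumr_const ?card_ord ?mulr_natl //.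
        lia.
      rewrite [X in _ <= X]big_mkcond /=; apply: ler_sum => j _.
      rewrite !coef_poly; case: ifPn => jn; last by rewrite mul0r normr0.
      case: ifPn => jn'; last by rewrite mulr0 normr0 exprn_ge0.
      rewrite normrM.
      apply: (@le_trans _ _ (M ^+ j.+1 * M ^+ (n + i - j).+1)).
        by apply: ler_pM => //; [case: (hM j) | case: (hM (n + i - j)%N)].
      by rewrite -exprD; apply: ler_weXn2l => //; have := ltn_ord j; lia.
    rewrite -[(n + i).+2]/(n.+2 + i)%N !exprD mulrACA.
    rewrite [X in _ <= X](_ : _ = n%:R * M ^+ n.+2 * `|z| ^+ n * 1); last by rewrite mulr1.
    rewrite [X in X <= _](_ : _ = n%:R * M ^+ n.+2 * `|z| ^+ n * (M * `|z|) ^+ i); last first.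
      by rewrite exprMn; ring.
    apply: ler_wpM2l.
      by apply: mulr_ge0; [apply: mulr_ge0 => //; exact: exprn_ge0|exact: exprn_ge0].
    apply: exprn_ile1; first by rewrite mulr_ge0.
    have := mulr_ge0 M0 (normr_ge0 z); lra.
  rewrite sumr_const card_ord -[X in X <= _]mulr_natl mulrA -natrM.
  have -> : (4 * M * `|z|) ^+ n = 4 ^+ n * (M * `|z|) ^+ n by rewrite -exprMn mulrA.
  rewrite mulrCA; apply: ler_wpM2l; first by rewrite exprn_ge0.
  apply: ler_wpM2r; first by rewrite exprn_ge0 // mulr_ge0.
  rewrite -natrX ler_nat (_ : 4 = 2 * 2)%N // expnMn; apply: leq_mul; exact/ltnW/ltn_expl.
have D0 : D @ \oo --> (0 : R).
  apply/norm_cvg0P.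
  apply: (@squeeze_cvgr _ _ _ _ (fun=> 0) (fun n => M ^+ 2 * (4 * M * `|z|) ^+ n)).
  - by near=> n; rewrite normr_ge0 DB.
  - exact: cvg_cst.
  rewrite -(mulr0 (M ^+ 2)); apply: cvgMr; apply: cvg_expr.
  by rewrite ger0_norm // !mulr_ge0.
rewrite (_ : series _ = fun n => (tr n c).[z] * (tr n d).[z] - D n); last first.
  by apply/funext => n; rewrite series_tr /D subKr.
rewrite -[f z * g z]subr0; apply: cvgB => //; apply: cvgM.
  by rewrite (_ : (fun n => _) = series (fun n => c n * z ^+ n)) //; apply/funext => n; rewrite series_tr.
by rewrite (_ : (fun n => _) = series (fun n => d n * z ^+ n)) //; apply/funext => n; rewrite series_tr.
Unshelve. all: by end_near. Qed.

End Analytic.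

Section Analytic2.
Context {R : realType}.
Implicit Types (c d : nat -> R) (f g h : R -> R).

Lemma has_expansion_expR (j : R) : has_expansion (expseq j) (fun z => expR (j * z)).
Proof.
split.
  exists (`|j| + 1); first by rewrite lerDr.
  move=> n; rewrite /expseq normrM normrX normfV normr_nat.
  apply: (@le_trans _ _ (`|j| ^+ n)).
    by rewrite ler_piMr ?exprn_ge0 // invf_le1 ?ler1n ?ltr0n fact_gt0.
  apply: (@le_trans _ _ ((`|j| + 1) ^+ n)).
    by apply: lerXn2r; rewrite ?nnegrE ?addr_ge0 // lerDl.
  by apply: ler_weXn2l; rewrite ?lerDr.
near=> z; have := is_cvg_series_exp_coeff (j * z) => cv.
have {}cv : series (exp_coeff (j * z)) @ \oo --> expR (j * z) by exact: cv.
rewrite (_ : (fun n => _) = exp_coeff (j * z)) //; apply/funext => n.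
by rewrite /exp_coeff /expseq /= exprMn mulrAC.
Unshelve. all: by end_near. Qed.

Lemma series_shift c z n :
  series (fun n => (if n is n'.+1 then c n' else 0) * z ^+ n) n.+1 =
  z * series (fun n => c n * z ^+ n) n.
Proof.
rewrite /series /= !big_mkord big_ord_recl mul0r add0r mulr_sumr.
by apply: eq_bigr => i _ /=; rewrite exprS mulrCA.
Qed.

Lemma has_expansion_shift1 c f : has_expansion c f -> has_expansion (fun n => if n is n'.+1 then c n' else 0) (fun z => z * f z).
Proof.
move=> [[M M1 hM] h]; have M0 : 0 <= M by lra.
split.
  exists M => // -[|n]; first by rewrite normr0 exprn_ge0.
  by apply: le_trans (hM n) _; exact: ler_weXn2l.
near=> z; rewrite -cvg_shiftS /=.
under eq_fun do rewrite series_shift.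
by apply: cvgMr; near: z.
Unshelve. all: by end_near. Qed.

Definition shiftn m c n : R := if (n < m)%N then 0 else c (n - m)%N.

Lemma has_expansion_shift m c f : has_expansion c f -> has_expansion (shiftn m c) (fun z => z ^+ m * f z).
Proof.
elim: m => [|m IH] h.
  apply: (@eq_has_expansion _ c) => [n|]; first by rewrite /shiftn ltn0 subn0.
  by rewrite (_ : (fun z => _) = f) //; apply/funext => z; rewrite expr0 mul1r.
have := has_expansion_shift1 (IH h); rewrite (_ : (fun z => z * _) = fun z => z ^+ m.+1 * f z).
  apply: eq_has_expansion => -[|n]; first by rewrite /shiftn.
  by rewrite /shiftn ltnS subSS.
by apply/funext => z; rewrite exprS mulrA.
Qed.

Lemma has_expansion1 : has_expansion (fun n => (n == 0)%N%:R) (fun=> 1 : R).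
Proof.
split.
  by exists 1 => // n; rewrite expr1n; case: eqP => _; rewrite ?normr1 ?normr0.
near=> z; rewrite -cvg_shiftS /=.
rewrite (_ : (fun n => _) = cst 1); first exact: cvg_cst.
apply/funext => n; rewrite /series /= big_mkord big_ord_recl /= expr0 mulr1.
by rewrite big1 ?addr0 // => i _; rewrite mul0r.
Unshelve. all: by end_near. Qed.

Lemma has_expansion_cpow c f n : has_expansion c f -> has_expansion (cpow c n) (fun z => f z ^+ n).
Proof.
move=> h; elim: n => [|n IH].
  apply: (@eq_has_expansion _ (fun n => (n == 0)%N%:R)) => [k|]; first by rewrite cpow0.
  exact: has_expansion1.
apply: (@eq_has_expansion _ (conv c (cpow c n))) => [k|]; first by rewrite cpowS.
rewrite (_ : (fun z => _) = fun z => f z * f z ^+ n); first exact: has_expansion_conv.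
by apply/funext => z; rewrite exprS.
Qed.

Lemma has_expansion_lin k c d f g : has_expansion c f -> has_expansion d g ->
  has_expansion (fun n => k * c n + d n) (fun z => k * f z + g z).
Proof.
move=> [bc hc] [bd hd]; have [M M1 hM] := has_expansion_bound2 bc bd.
have M0 : 0 <= M by lra.
split.
  have k1 : 1 <= `|k| + 1 by rewrite lerDr.
  exists ((`|k| + 1) * M); first by apply: mulr_ege1.
  move=> n; apply: le_trans (ler_normD _ _) _; rewrite normrM exprMn.
  apply: (@le_trans _ _ ((`|k| + 1) * M ^+ n.+1)).
    rewrite mulrDl mul1r; apply: lerD; last by case: (hM n).
    by apply: ler_wpM2l => //; case: (hM n).
  apply: ler_wpM2r; first by rewrite exprn_ge0.
  by apply: ler_eXnr.
near=> z.
have hfz : series (fun n => c n * z ^+ n) @ \oo --> f z by near: z.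
have hgz : series (fun n => d n * z ^+ n) @ \oo --> g z by near: z.
rewrite (_ : series _ = fun n => k * series (fun n => c n * z ^+ n) n + series (fun n => d n * z ^+ n) n).
  by apply: cvgD => //; exact: cvgMr.
apply/funext => n; rewrite /series /= mulr_sumr -big_split /=.
by apply: eq_bigr => i _; rewrite mulrDl mulrA.
Unshelve. all: by end_near. Qed.

Lemma has_expansion0 : has_expansion (fun=> 0) (fun=> 0 : R).
Proof.
split; first by exists 1 => // n; rewrite normr0 expr1n.
near=> z; rewrite (_ : series _ = cst 0); first exact: cvg_cst.
by apply/funext => n; rewrite /series /= big1 // => i _; rewrite mul0r.
Unshelve. all: by end_near. Qed.

Lemma has_expansion_sum n (k : nat -> R) (c : nat -> nat -> R) (f : nat -> R -> R) :
  (forall i, (i < n)%N -> has_expansion (c i) (f i)) ->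
  has_expansion (fun m => \sum_(i < n) k i * c i m) (fun z => \sum_(i < n) k i * f i z).
Proof.
elim: n => [|n IH] h.
  apply: (@eq_has_expansion _ (fun=> 0)) => [m|]; first by rewrite big_ord0.
  by rewrite (_ : (fun z => _) = fun=> 0); [exact: has_expansion0|apply/funext => z; rewrite big_ord0].
have := has_expansion_lin (k n) (h n (ltnSn n)) (IH (fun i hi => h i (leqW hi))).
rewrite (_ : (fun z => k n * _ + _) = fun z => \sum_(i < n.+1) k i * f i z).
  by apply: eq_has_expansion => m; rewrite big_ord_recr /= addrC.
by apply/funext => z; rewrite big_ord_recr /= addrC.
Qed.

(** The Laurent expansion of a power of F is read off from the Taylor expansion of the same
    power of B. *)
Lemma has_residue_res b (B F : R -> R) (j : R) (g : {poly R}) (u : R -> R) :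
  has_expansion b B -> (\forall z \near 0^', F z = B z / z) ->
  (\forall z \near 0^', u z = expR (j * z) * g.[F z]) ->
  has_residue0 u (res b j g).
Proof.
move=> hB hF hu; pose N := size g.
(* The term of degree i of g has a pole of order i; it is brought to the common
   order N.+1, so that the residue is the coefficient of index N. *)
pose c i m := shiftn (N.+1 - i) (conv (cpow b i) (expseq j)) m.
have H : has_expansion (fun m => \sum_(i < N) g`_i * c i m)
   (fun z => \sum_(i < N) g`_i * (z ^+ (N.+1 - i) * (B z ^+ i * expR (j * z)))).
  apply: (@has_expansion_sum N (fun i => g`_i) c
    (fun i z => z ^+ (N.+1 - i) * (B z ^+ i * expR (j * z)))) => i _.
  exact: has_expansion_shift (has_expansion_conv (has_expansion_cpow i hB) (has_expansion_expR j)).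
exists N, (fun m => \sum_(i < N) g`_i * c i m); split; last first.
  rewrite /res /res_poly horner_sum; apply: eq_bigr => i _; rewrite hornerZ; congr (_ * _).
  have iN : (i < N)%N by [].
  rewrite /c /shiftn; case: i iN => -[|i] /= hi iN.
    by rewrite subn0 ltnSn pole_coef0 horner0.
  rewrite pole_coefE_conv ifN; last by rewrite -leqNgt; lia.
  by congr conv; lia.
have [_ H2] := H; near=> z.
have z0 : z != 0 by near: z; exact: nbhs_dnbhs_neq.
have -> : u z = z ^- N.+1 * \sum_(i < N) g`_i * (z ^+ (N.+1 - i) * (B z ^+ i * expR (j * z))).
  rewrite (near hu z) // horner_coef (near hF z) // !mulr_sumr; apply: eq_bigr => i _.
  rewrite expr_div_n -(subnKC (_ : i <= N.+1)%N) ?exprD; last by have := ltn_ord i; rewrite -/N; lia.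
  rewrite subnKC; last by have := ltn_ord i; rewrite -/N; lia.
  have zi : z ^+ i != 0 by rewrite expf_neq0.
  have zi' : z ^+ (N.+1 - i) != 0 by rewrite expf_neq0.
  by field; rewrite zi zi'.
rewrite (_ : series _ = fun n => z ^- N.+1 * series (fun m => (\sum_(i < N) g`_i * c i m) * z ^+ m) n).
  by apply: cvgMr; near: z; exact: nbhs_dnbhs H2.
apply/funext => n; rewrite /series /= mulr_sumr; apply: eq_bigr => k _.
by rewrite expfzDr // mulrA mulrC -exprnN.
Unshelve. all: by end_near. Qed.

End Analytic2.

(** * The residues for 1 / (1 - exp(- z)) and for 1 / z *)

Section Todd.
Context {R : realType}.

(** The coefficients of (1 - exp(- z)) / z. *)
Definition aser (n : nat) : R := (-1) ^+ n / n.+1`!%:R.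

Lemma aser0 : aser 0 = 1.
Proof. by rewrite /aser expr0 mul1r (_ : 1`! = 1)%N // invr1. Qed.

(** The coefficients of the reciprocal series z / (1 - exp(- z)), each one computed
    from all the previous ones. *)
Fixpoint todds (n : nat) : seq R :=
  if n is n'.+1 then
    rcons (todds n') (if n' is n''.+1 then - \sum_(i < n') aser i.+1 * (todds n')`_(n'' - i) else 1)
  else [::].

Definition todd n : R := (todds n.+1)`_n.

Lemma size_todds n : size (todds n) = n.
Proof. by elim: n => //= n IH; rewrite size_rcons IH. Qed.

Lemma todds_S n : todds n.+1 =
  rcons (todds n) (if n is m.+1 then - \sum_(i < n) aser i.+1 * (todds n)`_(m - i) else 1).
Proof. by []. Qed.

Lemma nth_todds n i : (i < n)%N -> (todds n)`_i = todd i.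
Proof.
elim: n => // n IH; rewrite ltnS leq_eqVlt => /orP[/eqP -> //|h].
by rewrite todds_S nth_rcons size_todds h IH.
Qed.

Lemma todd0 : todd 0 = 1. Proof. by []. Qed.

Lemma toddS n : todd n.+1 = - \sum_(i < n.+1) aser i.+1 * todd (n - i)%N.
Proof.
rewrite /todd todds_S nth_rcons size_todds ltnn eqxx; congr (- _).
by apply: eq_bigr => i _; rewrite nth_todds // ltnS leq_subr.
Qed.

Lemma conv_todd n : conv aser todd n = (n == 0)%N%:R.
Proof.
rewrite /conv big_ord_recl /= subn0 aser0 mul1r.
case: n => [|n]; first by rewrite big_ord0 addr0.
by rewrite toddS addrC; apply/eqP; rewrite subr_eq0; apply/eqP; apply: eq_bigr.
Qed.

Lemma aser_bound n : `|aser n| <= 1.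
Proof.
rewrite /aser normrM normrX normrN1 expr1n mul1r normfV normr_nat.
by rewrite invf_le1 ?ler1n ?ltr0n fact_gt0.
Qed.

Lemma todd_bound n : `|todd n| <= 2 ^+ n.
Proof.
have [m] := ubnP n; elim: m n => // m IH [|n] hn; first by rewrite todd0 normr1.
rewrite toddS normrN; apply: le_trans (ler_norm_sum _ _ _) _.
apply: (@le_trans _ _ (\sum_(i < n.+1) 2 ^+ (n - i))).
  apply: ler_sum => i _; rewrite normrM -[X in _ <= X]mul1r; apply: ler_pM => //.
    exact: aser_bound.
  by apply: IH; lia.
rewrite (reindex_inj rev_ord_inj) /=.
rewrite (eq_bigr (fun i : 'I_n.+1 => 2 ^+ i)); last first.
  by move=> i _; congr (_ ^+ _); have := ltn_ord i; lia.
have := @subrX1 R 2 n.+1; rewrite (_ : 2 - 1 = 1 :> R); last by lra.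
by rewrite mul1r => <-; lra.
Qed.

Definition Aser (z : R) : R := if z == 0 then 1 else (1 - expR (- z)) / z.

Lemma has_expansion_aser : has_expansion aser Aser.
Proof.
split.
  by exists 1 => // n; rewrite expr1n; exact: aser_bound.
near=> z; rewrite /Aser; case: eqP => [->|/eqP z0].
  rewrite -cvg_shiftS /= (_ : (fun n => _) = cst 1); first exact: cvg_cst.
  apply/funext => n; rewrite /series /= big_mkord big_ord_recl /= expr0 mulr1.
  rewrite big1 ?addr0 => [|i _]; last by rewrite expr0n mulr0.
  exact: aser0.
have cv : series (exp_coeff (- z)) @ \oo --> expR (- z) by exact: is_cvg_series_exp_coeff.
move: cv; rewrite -cvg_shiftS /= => cv.
rewrite (_ : series _ = fun n => (1 - series (exp_coeff (- z)) n.+1) * z^-1).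
  by apply: cvgMl; apply: cvgB => //; exact: cvg_cst.
apply/funext => n; rewrite /series /= !big_mkord big_ord_recl /exp_coeff /= expr0 fact0 invr1 mulr1.
rewrite opprD addrA subrr add0r -sumrN mulr_suml; apply: eq_bigr => i _.
rewrite /aser /bump /= add1n (exprNn z) !exprS. field.
by rewrite z0 pnatr_eq0 -lt0n fact_gt0.
Unshelve. all: by end_near. Qed.

Lemma has_expansion_todd : exists2 B : R -> R, has_expansion todd B &
  \forall z \near 0^', (1 - expR (- z))^-1 = B z / z.
Proof.
(* The coefficients grow at most like 2^n, so the sum of the series exists near 0;
   it is the inverse of (1 - exp(- z)) / z by the product formula. *)
pose B (z : R) := lim (series (fun n => todd n * z ^+ n) @ \oo).
have hB : has_expansion todd B.
  split.
    exists 2; first by lra.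
    by move=> n; apply: le_trans (todd_bound n) _; apply: ler_weXn2l => //; lra.
  near=> z.
  have hz : 2 * `|z| < 1.
    rewrite -ltr_pdivlMl ?mulr1 //; near: z; apply: (@nbhs0_lt R R); rewrite invr_gt0 //.
  apply: normed_cvg.
  apply: (@series_le_cvg _ _ (geometric 1 (2 * `|z|))).
  - by move=> n /=.
  - by move=> n /=; rewrite mul1r exprn_ge0 // mulr_ge0.
  - move=> n /=; rewrite mul1r normrM normrX exprMn; apply: ler_wpM2r; first by rewrite exprn_ge0.
    exact: todd_bound.
  by apply: is_cvg_geometric_series; rewrite ger0_norm // mulr_ge0.
exists B => //.
have [_ H] := has_expansion_conv has_expansion_aser hB.
have [_ H1] := @has_expansion1 R.
near=> z.
have z0 : z != 0 by near: z; exact: nbhs_dnbhs_neq.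
have AB : Aser z * B z = 1.
  have h1 : series (fun n => (n == 0)%N%:R * z ^+ n) @ \oo --> (1 : R).
    by near: z; exact: nbhs_dnbhs H1.
  have h2 : series (fun n => conv aser todd n * z ^+ n) @ \oo --> Aser z * B z.
    by near: z; exact: nbhs_dnbhs H.
  apply: (@cvg_unique _ _ (series (fun n => (n == 0)%N%:R * z ^+ n) @ \oo)) => //.
  by move: h2; under eq_fun do rewrite conv_todd.
move: AB; rewrite /Aser (negPf z0) => AB.
have e0 : 1 - expR (- z) != 0.
  by apply/eqP => e0; move: AB; rewrite e0 !mul0r => /eqP; rewrite eq_sym oner_eq0.
apply: (mulfI e0); by rewrite divff // -[LHS]AB mulrA mulrAC.
Unshelve. all: by end_near. Qed.

Local Notation X := ('X : {poly R}).

Lemma tr_aser_todd N : eqm N (tr N aser * tr N todd) 1.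
Proof. by move=> i iN; rewrite -convE // conv_todd coef1. Qed.

Lemma tr_exp1 N : eqm N (tr N (expseq (- 1))) (1 - X * tr N aser).
Proof.
move=> i iN; rewrite coefB coefXM coef1 coef_poly iN /expseq.
case: i iN => [|i] iN /=; first by rewrite expr0 fact0 invr1 mulr1 subr0.
by rewrite coef_poly (ltnW iN) sub0r /aser exprS mulN1r mulNr.
Qed.

Lemma tr_expD N (j k : R) : eqm N (tr N (expseq (j + k))) (tr N (expseq j) * tr N (expseq k)).
Proof.
move=> n nN; rewrite -convE // coef_poly nN /expseq /conv addrC exprDn mulr_suml.
apply: eq_bigr => i _; have iN : (i <= n)%N by rewrite -ltnS.
rewrite -mulr_natl.
have -> : 'C(n, i)%:R = n`!%:R / (i`!%:R * (n - i)`!%:R) :> R.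
  by rewrite -(bin_fact iN) !natrM mulfK // -natrM pnatr_eq0 -lt0n muln_gt0 !fact_gt0.
have h1 : n`!%:R != 0 :> R by rewrite pnatr_eq0 -lt0n fact_gt0.
have h2 : i`!%:R != 0 :> R by rewrite pnatr_eq0 -lt0n fact_gt0.
have h3 : (n - i)`!%:R != 0 :> R by rewrite pnatr_eq0 -lt0n fact_gt0.
by field; rewrite h1 h2 h3.
Qed.

Lemma todd_exp N : eqm N (tr N todd * tr N (expseq (- 1))) (tr N todd - X * 1).
Proof.
apply: (eqm_trans (eqmM (@eqm_refl _ N _) (@tr_exp1 N))).
rewrite mulrBr !mulr1; apply: eqmB => //.
rewrite -[Y in eqm N _ Y]mulr1 mulrCA [tr N todd * _]mulrC.
by apply: (@eqm_le _ N.+1) => //; apply: eqm_mulX; exact: tr_aser_todd.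
Qed.

Lemma pole_coef_todd_rec n (j : R) :
  (pole_coef todd n.+1).[j - 1] = (pole_coef todd n.+1).[j] - (pole_coef todd n).[j].
Proof.
rewrite !(@pole_coefE _ todd n _ n.+1) //.
set T := tr n.+1 todd; set Ej := tr n.+1 (expseq j).
have E : eqm n.+1 (T ^+ n.+1 * tr n.+1 (expseq (j - 1))) (T ^+ n.+1 * Ej - X * (T ^+ n * Ej)).
  apply: (eqm_trans (eqmM (@eqm_refl _ _ _) (@tr_expD n.+1 j (-1)))).
  have -> : T ^+ n.+1 * (Ej * tr n.+1 (expseq (-1))) = (T ^+ n * Ej) * (T * tr n.+1 (expseq (-1))).
    by rewrite exprS; ring.
  apply: (eqm_trans (eqmM (@eqm_refl _ _ _) (@todd_exp n.+1))).
  by rewrite mulr1 exprS; have -> : T ^+ n * Ej * (T - X) = T * T ^+ n * Ej - X * (T ^+ n * Ej) by ring.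
rewrite E // coefB coefXM; congr (_ - _); rewrite /T /Ej {E T Ej}; case: n => [|n] /=.
  by rewrite pole_coef0 horner0.
rewrite (@pole_coefE _ todd n _ n.+1) //.
by apply: (@eqmM _ n.+1) => //; [apply: eqmX|]; apply: eqm_tr.
Qed.

(** With F z = 1 / (1 - exp(- z)), one has (F z - 1) = exp(- z) F z. *)
Lemma res_todd_rec (j : R) (g : {poly R}) : res todd j (('X - 1) * g) = res todd (j - 1) ('X * g).
Proof.
rewrite -[g]coefK poly_def !mulr_sumr !res_sum; apply: eq_bigr => i _.
rewrite -!scalerAr !resZ; congr (_ * _); rewrite mulrBl mul1r resB -exprS /res !res_polyXn.
by rewrite pole_coef_todd_rec.
Qed.

(** The Riccati equation F' = F - F^2 in terms of B = z F. *)
Lemma todd_ode N : eqm N (X * (tr N todd)^`()) (tr N todd + X * tr N todd - tr N todd ^+ 2).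
Proof.
set B := tr N todd; set A := tr N aser.
have AB : eqm N (A * B) 1 := @tr_aser_todd N.
have h1 : eqm N (X * A^`()) (1 - A - X * A).
  move=> i iN; rewrite !coefB !coefXM coef1 coef_deriv !coef_poly iN.
  case: i iN => [|i] iN /=; first by rewrite aser0 subrr subr0.
  rewrite iN (ltnW iN) /aser sub0r (factS i.+1) natrM exprS.
  have h2 : i.+2%:R != 0 :> R by rewrite pnatr_eq0.
  have h4 : i.+1`!%:R != 0 :> R by rewrite pnatr_eq0 -lt0n fact_gt0.
  have e2 : i.+1%:R = i.+2%:R - 1 :> R by rewrite -[i.+2%:R]natr1 addrK.
  rewrite -[X in X = _]mulr_natr e2; move: h2 h4; move: (i.+2%:R : R) (i.+1`!%:R : R) => y f h2 h4.
  by field; rewrite h2 h4.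
have h2 : eqm N (X * (A^`() * B + A * B^`())) 0.
  case: N @B @A AB {h1} => [|N] B A AB //.
  rewrite -derivM (_ : 0 = X * 1^`()); last by rewrite -polyC1 derivC mulr0.
  by apply: eqm_mulX; apply: eqm_deriv.
have h3 : eqm N (X * B^`()) (- (1 - A - X * A) * B ^+ 2).
  have e1 : eqm N (X * B^`()) (A * B * (X * B^`())).
    by rewrite -[X in eqm N X]mul1r; apply: eqmM => //; exact: eqm_sym.
  apply: (eqm_trans e1).
  have -> : A * B * (X * B^`()) = (X * (A^`() * B + A * B^`())) * B - (X * A^`()) * B ^+ 2 by ring.
  rewrite mulNr -[X in eqm N _ X]sub0r; apply: eqmB; last exact: eqmM.
  by rewrite -[0](mul0r B); apply: eqmM.
apply: (eqm_trans h3).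
have -> : - (1 - A - X * A) * B ^+ 2 = (A * B) * B + X * (A * B) * B - B ^+ 2 by ring.
apply: eqmB => //; apply: eqmD.
  by rewrite -[X in eqm N _ X]mul1r; apply: eqmM.
by rewrite -[X in eqm N _ (X * _)]mulr1; apply: eqmM => //; apply: eqmM.
Qed.

(** All the powers of F = 1 / (1 - exp(- z)) have residue 1, for F^(n+2) differs from
    F^(n+1) by the derivative of a power of F, which has no residue. *)
Lemma cpow_todd n : cpow todd n.+1 n = 1.
Proof.
elim: n => [|n IH]; first by rewrite /cpow expr1 coef_poly.
have -> : cpow todd n.+2 n.+1 = cpow todd n.+1 n; last exact: IH.
rewrite (@cpowE _ _ _ _ n.+2) // (@cpowE _ _ n.+1 n n.+2) //; set B := tr _ _.
have E : eqm n.+2 (B ^+ n.+2) (B ^+ n.+1 + X * B ^+ n.+1 - X * B^`() * B ^+ n).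
  have -> : B ^+ n.+2 = (B + X * B - (B + X * B - B ^+ 2)) * B ^+ n by rewrite !exprS; ring.
  have -> : B ^+ n.+1 + X * B ^+ n.+1 - X * B^`() * B ^+ n = (B + X * B - X * B^`()) * B ^+ n.
    by rewrite !exprS; ring.
  apply: eqmM => //; apply: eqmB => //; exact/eqm_sym/todd_ode.
rewrite E // coefB coefD -[X * B^`() * _]mulrA !coefXM /=.
(* The coefficients of degree n of B^(n+1) ' and of B^n B' are proportional, so
   that the last two terms of E cancel. *)
have : (B ^+ n.+1)^`()`_n = (B^`() * B ^+ n)`_n *+ n.+1 by rewrite deriv_exp /= coefMn.
rewrite coef_deriv => /eqP; rewrite -subr_eq0 -mulrnBl mulrn_eq0 /= subr_eq0 => /eqP ->.
by rewrite addrAC subrr add0r.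
Qed.

Lemma res_todd0 (g : {poly R}) : res todd 0 g = g.[1] - g.[0].
Proof.
rewrite -[g]coefK poly_def !res_sum !horner_sum -sumrB; apply: eq_bigr => i _.
rewrite resZ !hornerZ -mulrBr; congr (_ * _); rewrite /res res_polyXn !hornerXn expr1n expr0n.
case: (i : nat) => [|n] /=; first by rewrite pole_coef0 horner0 subrr.
rewrite subr0 (@pole_coefE _ _ _ _ n.+1) // coefM big_ord_recr /= subnn big1 ?add0r => [|j _].
  by rewrite -cpowE // cpow_todd coef_poly /= /expseq expr0 fact0 invr1 !mulr1.
rewrite [X in _ * X]coef_poly; case: ifP => _; last by rewrite mulr0.
rewrite /expseq expr0n; have -> : ((n - j)%N == 0)%N = false by have := ltn_ord j; lia.
by rewrite mul0r mulr0.
Qed.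

End Todd.

Section One.
Context {R : realType}.

(** The series with sum 1, for F z = 1 / z. *)
Definition oneser (n : nat) : R := (n == 0)%N%:R.

Lemma tr_oneser N : eqm N (tr N oneser) 1.
Proof. by move=> i iN; rewrite coef_poly iN coef1. Qed.

Lemma cpow_oneser n k : cpow oneser n k = (k == 0)%N%:R.
Proof. by rewrite /cpow (eqmX n (@tr_oneser k.+1)) // expr1n coef1. Qed.

Lemma pole_coef_oneser n : pole_coef oneser n.+1 = (n`!%:R)^-1 *: 'X^n :> {poly R}.
Proof.
apply/polyP => i; rewrite coef_poly coefZ coefXn cpow_oneser /=.
case: (ltngtP i n) => [h|h|->]; rewrite ?mulr0 ?mulr1.
- by rewrite ltnS ltnW // (_ : (n - i == 0)%N = false) ?mul0r //; lia.
- by rewrite ltnS leqNgt h.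
by rewrite ltnSn subnn mul1r.
Qed.

(** The derivative of exp(j z) with respect to j is the multiplication by z, which
    removes a factor F z = 1 / z. *)
Lemma res_poly_oneser_deriv (g : {poly R}) : (res_poly oneser ('X * g))^`() = res_poly oneser g.
Proof.
rewrite -[g]coefK poly_def mulr_sumr (linear_sum (res_poly oneser)) [RHS]linear_sum (linear_sum (@deriv R)) /=; apply: eq_bigr => i _.
rewrite -scalerAr !linearZ /=; congr (_ *: _); rewrite -exprS !res_polyXn.
case: (i : nat) => [|n].
  by rewrite pole_coef_oneser pole_coef0 expr0 derivZ -polyC1 derivC scaler0.
rewrite !pole_coef_oneser derivZ derivXn /= -scalerMnr scalerMnl -mulr_natr; congr (_ *: _).
have h1 : n.+1%:R != 0 :> R by rewrite pnatr_eq0.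
have h2 : n`!%:R != 0 :> R by rewrite pnatr_eq0 -lt0n fact_gt0.
rewrite factS natrM; move: h1 h2; move: (n.+1%:R : R) (n`!%:R : R) => y f h1 h2.
by field; rewrite h1 h2.
Qed.

Lemma res_oneser0 (g : {poly R}) : res oneser 0 g = g`_1.
Proof.
rewrite -[in LHS](coefK g) poly_def res_sum.
rewrite (eq_bigr (fun i : 'I_(size g) => g`_i * (i == 1 :> nat)%:R)); last first.
  move=> i _; rewrite resZ; congr (_ * _); rewrite /res res_polyXn.
  case: (i : nat) => [|n]; first by rewrite pole_coef0 horner0.
  rewrite pole_coef_oneser hornerZ hornerXn expr0n eqSS; case: n => [|n]; last by rewrite mulr0.
  by rewrite fact0 invr1 mulr1.
have [h|h] := ltnP 1 (size g).
  rewrite (bigD1 (Ordinal h)) //= mulr1 big1 ?addr0 // => i.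
  by rewrite -(inj_eq val_inj) /= => /negPf ->; rewrite mulr0.
rewrite nth_default // big1 // => i _; have := ltn_ord i.
by case: (i : nat) => [|[|n]] hi; rewrite ?mulr0 //; move: h hi; lia.
Qed.

End One.

(** * Differential operators acting on polynomials in solutions of a Riccati equation *)

Import (canonicals) mpoly.

Section Alg.
Context {R : realType}.
Variables (r p : nat) (phi : 'I_p -> 'rV[int]_r) (kk : bool).
Local Notation M := (mpoly.mpoly p R).
Local Notation Pol := (mpoly.mpoly r R).

(** The right hand side of the equation F' = F - F^2 of F z = 1 / (1 - exp(- z)), when kk is
    true, and of the equation F' = - F^2 of F z = 1 / z, when kk is false. *)
Definition riccati (A : comNzRingType) (y : A) : A := kk%:R * y - y * y.

Definition Yvar (k : 'I_p) : M := mpoly.mpolyX R (mpoly.mnm1 k).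

(** The derivation of the polynomials in the y_k = F <phi_k, x + z E> which corresponds
    to the i-th partial derivative in x. *)
Definition Delta (i : 'I_r) (H : M) : M :=
  \sum_k ((phi k 0 i)%:~R : R) *: (riccati (Yvar k) * mpoly.mderiv k H).

Lemma Delta_is_linear i : linear (Delta i).
Proof.
move=> c H K; rewrite /Delta scaler_sumr -big_split /=; apply: eq_bigr => k _.
by rewrite mpoly.mderivD mpoly.mderivZ mulrDr scalerDr -scalerAr !scalerA mulrC.
Qed.
HB.instance Definition _ i := GRing.isLinear.Build R M M _ (Delta i) (Delta_is_linear i).

Lemma DeltaM i H K : Delta i (H * K) = Delta i H * K + H * Delta i K.
Proof.
rewrite /Delta mulr_suml mulr_sumr -big_split /=; apply: eq_bigr => k _.
rewrite mpoly.mderivM mulrDr scalerDr -scalerAl -scalerAr; congr (_ *: _ + _ *: _).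
  by rewrite mulrA.
by rewrite mulrCA.
Qed.

Lemma mderivY (k l : 'I_p) : mpoly.mderiv k (Yvar l) = (l == k)%:R.
Proof.
rewrite /Yvar mpoly.mderivX mpoly.mnm1E; case: eqP => [->|_]; last by rewrite scale0r.
rewrite scale1r (_ : mpoly.mnm_sub _ _ = mpoly.mnm0) ?mpoly.mpolyX0 //.
by apply/mpoly.mnmP => i; rewrite mpoly.mnmBE mpoly.mnm0E subnn.
Qed.

Lemma Delta_Y i k : Delta i (Yvar k) = ((phi k 0 i)%:~R : R) *: riccati (Yvar k).
Proof.
rewrite /Delta (bigD1 k) //= mderivY eqxx mulr1 big1 ?addr0 // => l lk.
by rewrite mderivY eq_sym (negPf lk) mulr0 scaler0.
Qed.

Lemma Delta1 i : Delta i 1 = 0.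
Proof. by apply: (addrI (Delta i 1)); rewrite addr0 -{3}[1]mulr1 DeltaM mulr1 mul1r. Qed.

(** The partial derivative of exp <a, x> H(y), divided by exp <a, x>. *)
Definition Dcoord (a : 'rV[R]_r) (i : 'I_r) (H : M) : M := a 0 i *: H + Delta i H.

Definition Dmonom (a : 'rV[R]_r) (m : mpoly.multinom r) (H : M) : M :=
  foldr (fun (i : 'I_r) g => iter (mpoly.fun_of_multinom m i) (Dcoord a i) g) H (enum 'I_r).

(** The operator P(d/dx) in the same terms. *)
Definition Dpoly (a : 'rV[R]_r) (P : Pol) (H : M) : M :=
  \sum_(m <- mpoly.msupp P) mpoly.mcoeff m P *: Dmonom a m H.

Lemma Dcoord_is_linear a i : linear (Dcoord a i).
Proof.
by move=> c H K; rewrite /Dcoord (linearP (Delta i)) !scalerDr !scalerA mulrC addrACA.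
Qed.
HB.instance Definition _ a i := GRing.isLinear.Build R M M _ (Dcoord a i) (Dcoord_is_linear a i).

Lemma Dmonom_ind2 (T T' : Type) (D1 : 'I_r -> T -> T) (D2 : 'I_r -> T' -> T') (Rel : T -> T' -> Prop)
  (m : mpoly.multinom r) H K :
  (forall i H K, Rel H K -> Rel (D1 i H) (D2 i K)) -> Rel H K ->
  Rel (foldr (fun (i : 'I_r) g => iter (mpoly.fun_of_multinom m i) (D1 i) g) H (enum 'I_r))
      (foldr (fun (i : 'I_r) g => iter (mpoly.fun_of_multinom m i) (D2 i) g) K (enum 'I_r)).
Proof.
move=> h h0; elim: (enum 'I_r) => //= i s IH.
by elim: (mpoly.fun_of_multinom m i) => //= n IHn; apply: h.
Qed.

Lemma Dmonom_linear a m c H K : Dmonom a m (c *: H + K) = c *: Dmonom a m H + Dmonom a m K.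
Proof.
rewrite /Dmonom; elim: (enum 'I_r) => //= i s ->.
move: (foldr _ H s) (foldr _ K s) => A B.
by elim: (mpoly.fun_of_multinom m i) => //= n ->; rewrite (linearP (Dcoord a i)).
Qed.
HB.instance Definition _ a m := GRing.isLinear.Build R M M _ (Dmonom a m) (Dmonom_linear a m).

Lemma Dpoly_linear a P c H K : Dpoly a P (c *: H + K) = c *: Dpoly a P H + Dpoly a P K.
Proof.
rewrite /Dpoly scaler_sumr -big_split /=; apply: eq_bigr => m _.
by rewrite (linearP (Dmonom a m)) scalerDr !scalerA mulrC.
Qed.
HB.instance Definition _ a P := GRing.isLinear.Build R M M _ (Dpoly a P) (Dpoly_linear a P).

Variable lam : 'I_p -> {poly R}.
Definition ev (H : M) : {poly R} := mpoly.mmap (@polyC R) lam H.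

Lemma ev_is_linear : linear ev.
Proof. by move=> c H K; rewrite /ev mpoly.mmapD mpoly.mmapZ mul_polyC. Qed.
HB.instance Definition _ := GRing.isLinear.Build R M {poly R} _ ev ev_is_linear.

Lemma evM H K : ev (H * K) = ev H * ev K.
Proof. by rewrite /ev rmorphM. Qed.
Lemma ev1 : ev 1 = 1.
Proof. by rewrite /ev rmorph1. Qed.
Lemma evY k : ev (Yvar k) = lam k.
Proof. by rewrite /ev mpoly.mmapX mpoly.mmap1U. Qed.

Lemma ev_riccati k : ev (riccati (Yvar k)) = riccati (lam k).
Proof.
rewrite /riccati linearB /= evM evY evM evY; congr (_ * _ - _).
by case: kk; rewrite ?ev1 ?linear0.
Qed.

(** Satisfied by the values needed: c^-1 *: 'X when kk is false, 'X and 1 - 'X when kk is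
    true. *)
Definition lam_ok := forall k, exists c : R, riccati (lam k) = c *: riccati 'X.

Lemma ev_Dcoord_mod a i H : lam_ok -> exists w, ev (Dcoord a i H) = a 0 i *: ev H + riccati 'X * w.
Proof.
move=> ok; rewrite /Dcoord linearD linearZ /=.
suff [w ->] : exists w, ev (Delta i H) = riccati 'X * w by exists w.
have /choice[c cE] := ok.
exists (\sum_k ((phi k 0 i)%:~R * c k) *: ev (mpoly.mderiv k H)).
rewrite /Delta linear_sum mulr_sumr; apply: eq_bigr => k _ /=.
by rewrite linearZ /= evM ev_riccati cE -scalerAl -scalerAr scalerA.
Qed.

Lemma ev_Dmonom_mod a m H : lam_ok ->
  exists w, ev (Dmonom a m H) = (\prod_i a 0 i ^+ mpoly.fun_of_multinom m i) *: ev H + riccati 'X * w.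
Proof.
move=> ok; rewrite -big_enum /Dmonom /=; elim: (enum 'I_r) => [|i s [w IH]] /=.
  by exists 0; rewrite big_nil scale1r mulr0 addr0.
rewrite big_cons; move: (foldr _ H s) (\prod_(j <- s) _) IH => A c IH.
elim: (mpoly.fun_of_multinom m i) => [|n [w' IHn]] /=.
  by exists w; rewrite expr0 mul1r.
have [w2 ->] := ev_Dcoord_mod a i (iter n (Dcoord a i) A) ok.
exists (a 0 i *: w' + w2); by rewrite IHn exprS scalerDr scalerA mulrA mulrDr -scalerAr addrA.
Qed.

(** All the derivations have values in the ideal generated by riccati 'X, modulo which only
    the multiplications by the coordinates of a remain. *)
Lemma ev_Dpoly_mod a P H : lam_ok -> exists w, ev (Dpoly a P H) = polyval P a *: ev H + riccati 'X * w.
Proof.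
move=> ok; have /choice[w wE] := fun m => ev_Dmonom_mod a m H ok.
exists (\sum_(m <- mpoly.msupp P) mpoly.mcoeff m P *: w m).
rewrite /Dpoly linear_sum /polyval mpoly.mevalE scaler_suml mulr_sumr -big_split /=.
apply: eq_bigr => m _; rewrite linearZ /= wE scalerDr scalerA.
by rewrite -scalerAr.
Qed.

(** The operators commute with the multiplication by exp <phi_k, x>, which is Y_k / (Y_k - 1)
    and changes a into a + phi_k.  The relation between H1 and H2 says that they
    differ by this factor, and it is stated without denominators. *)
Lemma Dpoly_shift (k : 'I_p) a P H1 H2 : kk ->
  Yvar k * H2 = (Yvar k - 1) * H1 ->
  Yvar k * Dpoly a P H2 = (Yvar k - 1) * Dpoly (a - map_mx intr (phi k)) P H1.
Proof.
move=> hk H12; rewrite /Dpoly !mulr_sumr; apply: eq_bigr => m _.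
rewrite -!scalerAr; congr (_ *: _); rewrite /Dmonom.
pose Rel (K2 K1 : M) := Yvar k * K2 = (Yvar k - 1) * K1.
apply: (@Dmonom_ind2 _ _ (Dcoord a) (Dcoord (a - map_mx intr (phi k))) Rel m H2 H1) => // i K2 K1 h.
rewrite /Rel in h *.
set c : R := (phi k 0 i)%:~R.
have h1 : Yvar k * (K1 - K2) = K1 by rewrite mulrBr h mulrBl mul1r subKr.
have D1 : Delta i (Yvar k) = c *: (Yvar k * (1 - Yvar k)).
  by rewrite Delta_Y /riccati hk mul1r mulrBr mulr1.
have h2 : Delta i (Yvar k * K2) = Delta i ((Yvar k - 1) * K1) by rewrite h.
move: h2; rewrite !DeltaM linearB /= Delta1 subr0 D1 => h2.
move: h1 h2 h; rewrite /Dcoord !mxE -/c scalerBl -!mpoly.mul_mpolyC.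
move: (Yvar k) (Delta i K1) (Delta i K2) (mpoly.mpolyC p c) (mpoly.mpolyC p (a 0 i)) => Y D1' D2' C A h1 h2 h.
have {}h2 : Y * D2' = (Y - 1) * D1' + C * ((1 - Y) * K1).
  transitivity (C * (Y * (1 - Y)) * K1 + (Y - 1) * D1' - C * (Y * (1 - Y)) * K2).
    by rewrite -h2; ring.
  by rewrite -[in RHS]h1; ring.
transitivity (A * (Y * K2) + Y * D2'); first by ring.
by rewrite h2 h; ring.
Qed.

(** A family in t which is a polynomial in t with coefficients in the ring. *)
Definition polyfam (K : R -> M) := exists (N : nat) (s : nat -> M),
  (forall n, (N <= n)%N -> s n = 0) /\ forall t, K t = \sum_(n < N) t ^+ n *: s n.

Definition Dfam (a b : 'rV[R]_r) i (s : nat -> M) n : M :=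
  Dcoord a i (s n) + (if n is n'.+1 then b 0 i *: s n' else 0).

Lemma Dfam_vanish a b i s N : (forall n, (N <= n)%N -> s n = 0) ->
  forall n, (N.+1 <= n)%N -> Dfam a b i s n = 0.
Proof.
move=> s0 [|n] hn //; rewrite /Dfam !s0 ?linear0 ?scaler0 ?addr0 //.
exact: ltnW.
Qed.

Lemma Dfam_sum a b i s N t : (forall n, (N <= n)%N -> s n = 0) ->
  Dcoord (a + t *: b) i (\sum_(n < N) t ^+ n *: s n) =
  \sum_(n < N.+1) t ^+ n *: Dfam a b i s n.
Proof.
move=> s0; set S := \sum_(n < N) _.
have -> : Dcoord (a + t *: b) i S = Dcoord a i S + (t * b 0 i) *: S.
  by rewrite /Dcoord !mxE scalerDl addrAC.
rewrite (linear_sum (Dcoord a i)) /Dfam; under [RHS]eq_bigr do rewrite scalerDr.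
rewrite [RHS]big_split /=; congr (_ + _).
  rewrite big_ord_recr /= s0 // (linear0 (Dcoord a i)) scaler0 addr0.
  by apply: eq_bigr => n _; rewrite linearZ.
rewrite big_ord_recl scaler0 add0r scaler_sumr; apply: eq_bigr => n _ /=.
by rewrite !scalerA exprS mulrAC.
Qed.

Lemma sum_pad N N' (s : nat -> M) t : (N <= N')%N -> (forall n, (N <= n)%N -> s n = 0) ->
  \sum_(n < N) t ^+ n *: s n = \sum_(n < N') t ^+ n *: s n.
Proof.
move=> h s0; rewrite -!(big_mkord xpredT (fun n => t ^+ n *: s n)).
rewrite [RHS](@big_cat_nat _ _ _ N) //= [X in _ = _ + X]big_nat_cond.
rewrite [X in _ = _ + X]big1 ?addr0 // => i /andP[/andP[hi _] _].
by rewrite s0 // scaler0.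
Qed.

Lemma polyfam_cst H : polyfam (fun=> H).
Proof.
exists 1%N, (fun n => if n is 0 then H else 0); split; first by case.
by move=> t; rewrite big_ord1 expr0 scale1r.
Qed.

Lemma polyfam_Dcoord a b i K : polyfam K -> polyfam (fun t => Dcoord (a + t *: b) i (K t)).
Proof.
move=> [N [s [s0 sE]]]; exists N.+1, (Dfam a b i s); split; first exact: Dfam_vanish.
by move=> t; rewrite sE Dfam_sum.
Qed.

Lemma polyfam_lin c K L : polyfam K -> polyfam L -> polyfam (fun t => c *: K t + L t).
Proof.
move=> [N [s [s0 sE]]] [N' [s' [s0' sE']]].
exists (maxn N N'), (fun n => c *: s n + s' n); split.
  by move=> n; rewrite geq_max => /andP[h1 h2]; rewrite s0 // s0' // scaler0 addr0.
move=> t; rewrite sE sE' (sum_pad _ (leq_maxl N N')) // (sum_pad _ (leq_maxr N N')) //.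
rewrite scaler_sumr -big_split /=; apply: eq_bigr => n _.
by rewrite scalerDr !scalerA mulrC.
Qed.

Lemma polyfam_Dpoly a b P H : polyfam (fun t => Dpoly (a + t *: b) P H).
Proof.
rewrite /Dpoly; elim: (mpoly.msupp P) => [|m ms IH].
  rewrite (_ : (fun t => _) = fun=> 0); first exact: polyfam_cst.
  by apply/funext => t; rewrite big_nil.
rewrite (_ : (fun t => _) = fun t => mpoly.mcoeff m P *: Dmonom (a + t *: b) m H +
   \sum_(m <- ms) mpoly.mcoeff m P *: Dmonom (a + t *: b) m H); last first.
  by apply/funext => t; rewrite big_cons.
apply: polyfam_lin IH; rewrite /Dmonom.
elim: (enum 'I_r) => [|i s IH] /=; first exact: polyfam_cst.
by elim: (mpoly.fun_of_multinom m i) => [|n IHn] //=; exact: polyfam_Dcoord.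
Qed.

Lemma res_family ser j j' N (s : nat -> M) t :
  res ser (j + t * j') (ev (\sum_(n < N) t ^+ n *: s n)) =
  (\sum_(n < N) 'X^n * (res_poly ser (ev (s n)) \Po (j%:P + j' *: 'X))).[t].
Proof.
rewrite linear_sum res_sum horner_sum; apply: eq_bigr => n _ /=.
by rewrite linearZ /= resZ /res !hornerE horner_comp !hornerE [t * j']mulrC.
Qed.

Lemma polyfam_res ser j j' K : polyfam K ->
  exists q : {poly R}, forall t, res ser (j + t * j') (ev (K t)) = q.[t].
Proof.
move=> [N [s [_ sE]]]; eexists => t; rewrite sE res_family; reflexivity.
Qed.

Variable k0 : 'I_p.
Let Y := Yvar k0.

(** K' is the image of K under Theta = d/dt + 1 / Y_k0, which is the derivative in t of
    families multiplied by exp <t phi_k0, x>.  The denominator is cleared in the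
    comparison of coefficients. *)
Definition thetapair (K K' : R -> M) := exists (N : nat) (s s' : nat -> M),
  [/\ forall n, (N <= n)%N -> s n = 0 /\ s' n = 0,
      forall t, K t = \sum_(n < N) t ^+ n *: s n,
      forall t, K' t = \sum_(n < N) t ^+ n *: s' n &
      forall n, Y * s' n = (Y * s n.+1) *+ n.+1 + s n].

Lemma thetapair_cst H : thetapair (fun=> Y * H) (fun=> H).
Proof.
exists 1%N, (fun n => if n is 0 then Y * H else 0), (fun n => if n is 0 then H else 0); split.
- by case.
- by move=> t; rewrite big_ord1 expr0 scale1r.
- by move=> t; rewrite big_ord1 expr0 scale1r.
by case=> [|n]; rewrite mulr0 mul0rn add0r.
Qed.

Lemma thetapair_lin c K L K' L' : thetapair K K' -> thetapair L L' ->
  thetapair (fun t => c *: K t + L t) (fun t => c *: K' t + L' t).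
Proof.
move=> [N [s [s' [s0 sE sE' sR]]]] [N2 [v [v' [v0 vE vE' vR]]]].
exists (maxn N N2), (fun n => c *: s n + v n), (fun n => c *: s' n + v' n); split.
- move=> n; rewrite geq_max => /andP[/s0[-> ->] /v0[-> ->]].
  by rewrite scaler0 addr0.
- move=> t; rewrite sE vE (sum_pad _ (leq_maxl N N2)); last by move=> n /s0[].
  rewrite (sum_pad _ (leq_maxr N N2)); last by move=> n /v0[].
  rewrite scaler_sumr -big_split /=; apply: eq_bigr => n _.
  by rewrite scalerDr !scalerA mulrC.
- move=> t; rewrite sE' vE' (sum_pad _ (leq_maxl N N2)); last by move=> n /s0[].
  rewrite (sum_pad _ (leq_maxr N N2)); last by move=> n /v0[].
  rewrite scaler_sumr -big_split /=; apply: eq_bigr => n _.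
  by rewrite scalerDr !scalerA mulrC.
move=> n; rewrite !mulrDr mulrnDl -!scalerAr sR vR scalerDr scalerMnr.
by rewrite addrACA.
Qed.

(** Theta commutes with the partial derivatives, because it comes from a derivative with
    respect to another variable. *)
Lemma thetapair_Dcoord a i K K' : ~~ kk -> thetapair K K' ->
  thetapair (fun t => Dcoord (a + t *: map_mx intr (phi k0)) i (K t))
            (fun t => Dcoord (a + t *: map_mx intr (phi k0)) i (K' t)).
Proof.
move=> hk [N [s [s' [s0 sE sE' sR]]]].
set b : 'rV[R]_r := map_mx intr (phi k0).
have z1 n : (N <= n)%N -> s n = 0 by move=> /s0[].
have z2 n : (N <= n)%N -> s' n = 0 by move=> /s0[].
exists N.+1, (Dfam a b i s), (Dfam a b i s'); split.
- by move=> n hn; rewrite !(Dfam_vanish _ _ _ (N := N)).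
- by move=> t; rewrite sE Dfam_sum.
- by move=> t; rewrite sE' Dfam_sum.
move=> n; pose c : R := (phi k0 0 i)%:~R.
have bi : b 0 i = c by rewrite mxE.
have D1 : Delta i Y = - (c *: (Y * Y)).
  by rewrite Delta_Y /riccati (negPf hk) mul0r sub0r scalerN.
have h : Delta i (Y * s' n) = Delta i ((Y * s n.+1) *+ n.+1 + s n) by rewrite sR.
have sR' m : Y * s' m = m.+1%:R * (Y * s m.+1) + s m by rewrite sR mulr_natl.
move: h; rewrite linearD linearMn /= !DeltaM D1 -[X in _ = X + _ -> _]mulr_natl => h.
have hn := sR' n.
have hn1 : (if n is n'.+1 then Y * s' n' = n%:R * (Y * s n) + s n' else True).
  by case: n {h hn} => // n'.
rewrite -[X in _ = X + _]mulr_natl.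
move: h hn hn1; rewrite /Dfam /Dcoord bi -!mpoly.mul_mpolyC.
set C := mpoly.mpolyC p c; set A := mpoly.mpolyC p (a 0 i).
set D' := Delta i (s' n); set DS := Delta i (s n.+1); set D0 := Delta i (s n).
move=> h hn.
have {}h : Y * D' = n.+1%:R * (Y * DS) + D0 + C * Y * s n.
  have -> : C * Y * s n = C * Y * (Y * s' n - n.+1%:R * (Y * s n.+1)).
    by rewrite hn addrAC subrr add0r.
  transitivity ((n.+1%:R * (- (C * (Y * Y)) * s n.+1 + Y * DS) + D0) + C * (Y * Y) * s' n).
    by rewrite -h; ring.
  by ring.
clearbody D' DS D0; case: n h hn {sR sR'} => [|n] h hn hn1.
  transitivity (A * (Y * s' 0%N) + Y * D'); first by ring.
  by rewrite hn h; ring.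
rewrite -!mpoly.mul_mpolyC.
transitivity (A * (Y * s' n.+1) + Y * D' + C * (Y * s' n)); first by ring.
by rewrite hn h hn1 -[n.+2%:R]natr1; ring.
Qed.

Lemma thetapair_Dpoly a P H : ~~ kk ->
  thetapair (fun t => Dpoly (a + t *: map_mx intr (phi k0)) P (Y * H))
            (fun t => Dpoly (a + t *: map_mx intr (phi k0)) P H).
Proof.
move=> hk; rewrite /Dpoly; elim: (mpoly.msupp P) => [|m ms IH].
  have := @thetapair_cst 0.
  rewrite (_ : (fun=> Y * 0) = fun t => \sum_(m <- [::]) mpoly.mcoeff m P *:
             Dmonom (a + t *: map_mx intr (phi k0)) m (Y * H)).
    rewrite (_ : (fun=> 0) = fun t => \sum_(m <- [::]) mpoly.mcoeff m P *:
             Dmonom (a + t *: map_mx intr (phi k0)) m H) //.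
    by apply/funext => t; rewrite big_nil.
  by apply/funext => t; rewrite big_nil mulr0.
set b := map_mx _ _ in IH *.
rewrite (_ : (fun t => _) = fun t => mpoly.mcoeff m P *: Dmonom (a + t *: b) m (Y * H) +
   \sum_(m <- ms) mpoly.mcoeff m P *: Dmonom (a + t *: b) m (Y * H)); last first.
  by apply/funext => t; rewrite big_cons.
rewrite [X in thetapair _ X](_ : _ = fun t => mpoly.mcoeff m P *: Dmonom (a + t *: b) m H +
   \sum_(m <- ms) mpoly.mcoeff m P *: Dmonom (a + t *: b) m H); last first.
  by apply/funext => t; rewrite big_cons.
apply: thetapair_lin IH; rewrite /Dmonom.
elim: (enum 'I_r) => [|i s IH] /=; first exact: thetapair_cst.
by elim: (mpoly.fun_of_multinom m i) => [|n IHn] //=; exact: thetapair_Dcoord.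
Qed.

(** Taking residues turns Theta into d/dt, since the evaluation of 1 / Y_k0 is e0 / 'X and
    since res oneser turns the division by 'X into a derivative in j. *)
Lemma thetapair_res (e0 j : R) K K' : e0 != 0 -> lam k0 = e0^-1 *: 'X -> thetapair K K' ->
  exists q : {poly R},
    (forall t, res oneser (j + t * e0) (ev (K t)) = q.[t]) /\
    (forall t, res oneser (j + t * e0) (ev (K' t)) = q^`().[t]).
Proof.
move=> e00 lamE [N [s [s' [s0 sE sE' sR]]]].
pose L : {poly R} := j%:P + e0 *: 'X.
pose A n := res_poly oneser (ev (s n)) \Po L.
pose A' n := res_poly oneser (ev (s' n)) \Po L.
exists (\sum_(n < N) 'X^n * A n); split=> t; first by rewrite sE res_family.
rewrite sE' res_family; congr (_.[t]).
have AR n : (A n)^`() = A' n - (A n.+1) *+ n.+1.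
  pose h := e0^-1 *: (ev (s' n) - ev (s n.+1) *+ n.+1).
  have hE : ev (s n) = 'X * h.
    have := congr1 ev (sR n); rewrite linearD linearMn /= !evM evY lamE => E.
    have {E} -> : ev (s n) = e0^-1 *: 'X * ev (s' n) - (e0^-1 *: 'X * ev (s n.+1)) *+ n.+1.
      by rewrite E addrAC subrr add0r.
    by rewrite /h -!scalerAl -scalerAr mulrBr scalerBr mulrnAr scalerMnr.
  rewrite /A hE deriv_comp res_poly_oneser_deriv /h linearZ /= comp_polyZ.
  rewrite /L derivD derivC add0r derivZ derivX -scalerAr mulr1 scalerA divff // scale1r.
  by rewrite linearB linearMn /= comp_polyB raddfMn.
rewrite linear_sum /=; under [RHS]eq_bigr do rewrite derivM derivXn AR mulrBr.
rewrite big_split /= [X in _ = X + _](_ : _ = \sum_(n < N) 'X^(n.-1) *+ n * A n) //.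
pose u n : {poly R} := 'X^(n.-1) * A n *+ n.
have uE : \sum_(n < N) ('X^n * A' n - 'X^n * (A n.+1 *+ n.+1)) =
    \sum_(n < N) 'X^n * A' n - \sum_(n < N) u n.+1.
  by rewrite -sumrB; apply: eq_bigr => n _; rewrite /u /= mulrnAr.
rewrite uE addrCA -[LHS]addr0; congr (_ + _).
have -> : \sum_(n < N) 'X^(n.-1) *+ n * A n = \sum_(n < N) u n.
  by apply: eq_bigr => n _; rewrite /u mulrnAl.
have : \sum_(n < N) (u n.+1 - u n) = u N - u 0%N.
  by rewrite -(big_mkord xpredT (fun n => u n.+1 - u n)) telescope_sumr.
rewrite /u mulr0n subr0 /A (s0 N (leqnn N)).1 !linear0 ?comp_poly0 mulr0 mul0rn -/u sumrB => E.
by apply/eqP; rewrite eq_sym subr_eq0 eq_sym -subr_eq0 E.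
Qed.

End Alg.

Section Deriv.
Context {R : realType}.

Lemma derive_line r (f : 'cV[R]_r -> R) (g : R -> R) (x v : 'cV[R]_r) d :
  (\forall t \near (0 : R), f (x + t *: v) = g t) -> is_derive (0 : R) 1 g d -> 'D_v f x = d.
Proof.
move=> fg [gd gE]; rewrite /derive; apply: cvg_lim => //.
have h1 : h^-1 *: ((g \o shift 0) (h *: 1) - g 0) @[h --> (0 : R)^'] --> d by rewrite -gE; exact: gd.
apply: cvg_trans h1; apply: near_eq_cvg; near=> h => /=.
have f0 : f x = g 0 by have := nbhs_singleton fg; rewrite scale0r addr0.
rewrite f0 addr0 [h *: 1]mulr1; congr (_ *: (_ - _)).
by rewrite [h *: v + x]addrC; apply/esym; near: h; exact: nbhs_dnbhs fg.
Unshelve. all: by end_near. Qed.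

Variable p : nat.
Local Notation M := (mpoly.mpoly p R).

Lemma is_derive_meval (Y : R -> 'I_p -> R) (dY : 'I_p -> R) (t0 : R) (H : M) :
  (forall k, is_derive t0 1 (fun t => Y t k) (dY k)) ->
  is_derive t0 1 (fun t => mpoly.meval (Y t) H)
    (\sum_k mpoly.meval (Y t0) (mpoly.mderiv k H) * dY k).
Proof.
move=> hY; pose Pr (H : M) := is_derive t0 1 (fun t => mpoly.meval (Y t) H)
    (\sum_k mpoly.meval (Y t0) (mpoly.mderiv k H) * dY k).
have Dpoly c H1 H2 : Pr H1 -> Pr H2 -> Pr (c *: H1 + H2).
  rewrite /Pr => h1 h2.
  have -> : (fun t => mpoly.meval (Y t) (c *: H1 + H2)) =
      (c *: (fun t => mpoly.meval (Y t) H1)) + (fun t => mpoly.meval (Y t) H2).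
    by apply/funext => t; rewrite mpoly.mevalD mpoly.mevalZ.
  apply: is_derive_eq; rewrite scaler_sumr -big_split /=; apply: eq_bigr => k _.
  by rewrite mpoly.mderivD mpoly.mderivZ mpoly.mevalD mpoly.mevalZ mulrDl -mulrA.
have PM H1 H2 : Pr H1 -> Pr H2 -> Pr (H1 * H2).
  rewrite /Pr => h1 h2.
  have -> : (fun t => mpoly.meval (Y t) (H1 * H2)) =
      (fun t => mpoly.meval (Y t) H1) * (fun t => mpoly.meval (Y t) H2).
    by apply/funext => t; rewrite mpoly.mevalM.
  apply: is_derive_eq; rewrite !scaler_sumr -big_split /=; apply: eq_bigr => k _.
  rewrite mpoly.mderivM mpoly.mevalD !mpoly.mevalM /= /GRing.scale /=; ring.
have P1 : Pr 1.
  rewrite /Pr (_ : (fun t => _) = cst 1); last first.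
    by apply/funext => t; rewrite mpoly.meval1.
  apply: is_derive_eq; rewrite big1 // => k _.
  by rewrite -mpoly.mpolyC1 mpoly.mderivC mpoly.meval0 mul0r.
have P0 : Pr 0.
  rewrite /Pr (_ : (fun t => _) = cst 0); last first.
    by apply/funext => t; rewrite mpoly.meval0.
  apply: is_derive_eq; rewrite big1 // => k _.
  by rewrite mpoly.mderiv0 mpoly.meval0 mul0r.
have PY l : Pr (Yvar l).
  rewrite /Pr (_ : (fun t => _) = fun t => Y t l); last first.
    by apply/funext => t; rewrite /Yvar mpoly.mevalXU.
  rewrite (bigD1 l) //= big1 ?addr0 => [|k kl].
    by rewrite mderivY eqxx mpoly.meval1 mul1r.
  by rewrite mderivY eq_sym (negPf kl) mpoly.meval0 mul0r.
elim/mpoly.mpolyind: H => // c m H _ _ IH; apply: Dpoly IH.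
rewrite mpoly.mpolyXE_id; apply: (big_ind Pr) => // l _.
by elim: (mpoly.fun_of_multinom m l) => [|n IHn]; rewrite ?expr0 // exprS; apply: PM => //; exact: PY.
Qed.

Variables (r : nat) (phi : 'I_p -> 'rV[int]_r) (kk : bool) (E : 'cV[R]_r) (a : 'rV[R]_r).
Variables (F : R -> R).
Hypothesis dF : forall s : R, s != 0 -> is_derive s (1 : R) F (riccati kk (F s)).
Implicit Type z : R.

Definition yval (z : R) (x : 'cV[R]_r) k : R := F (pairing (map_mx intr (phi k)) (x + z *: E)).

(** The functions of x among which the differentiations take place. *)
Definition fH (z : R) (H : M) (x : 'cV[R]_r) : R :=
  expR (pairing a (x + z *: E)) * mpoly.meval (yval z x) H.

Definition off_poles (z : R) : set 'cV[R]_r :=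
  [set x | forall k, pairing (map_mx intr (phi k)) (x + z *: E) != 0].

Lemma pairing_line (b : 'rV[R]_r) (x w : 'cV[R]_r) i t :
  pairing b (x + t *: delta_mx i 0 + w) = pairing b (x + w) + t * b 0 i.
Proof.
rewrite /pairing addrAC mulmxDr [LHS]mxE; congr (_ + _).
by rewrite -scalemxAr [LHS]mxE -colE [X in _ * X = _]mxE.
Qed.

Lemma off_poles_line z x i : off_poles z x -> \forall t \near (0 : R), off_poles z (x + t *: delta_mx i 0).
Proof.
move=> xU.
suff H : forall s : seq 'I_p, \forall t \near (0 : R), forall k, k \in s ->
    pairing (map_mx intr (phi k)) (x + t *: delta_mx i 0 + z *: E) != 0.
  by apply: filterS (H (enum 'I_p)) => t ht k; apply: ht; rewrite mem_enum.
elim=> [|k s IH]; first by near=> t.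
have hk : \forall t \near (0 : R), pairing (map_mx intr (phi k)) (x + z *: E) +
     t * (map_mx intr (phi k) : 'rV[R]_r) 0 i != 0.
  have c : continuous (fun t : R => pairing (map_mx intr (phi k)) (x + z *: E) +
     t * (map_mx intr (phi k) : 'rV[R]_r) 0 i).
    by move=> t; apply: cvgD; [exact: cvg_cst|apply: cvgMl; exact: cvg_id].
  apply: (c 0 [set u | u != 0]); apply: open_nbhs_nbhs; split; first exact: open_neq.
  by rewrite /= mul0r addr0.
near=> t => l; rewrite inE => /orP[/eqP ->|ls].
  by rewrite pairing_line; near: t.
by move: l ls; near: t.
Unshelve. all: by end_near. Qed.

(** The hypothesis on g is local only: the quotients of the theorem agree with fH outside of
    the poles, and the partial derivatives are taken at points off the poles. *)
Lemma derive_fH z H x i (g : 'cV[R]_r -> R) : off_poles z x -> (forall x, off_poles z x -> g x = fH z H x) ->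
  'D_(delta_mx i 0) g x = fH z (Dcoord phi kk a i H) x.
Proof.
move=> xU gH; set d := fH _ _ _.
pose gl t := expR (pairing a (x + z *: E) + t * a 0 i) *
   mpoly.meval (yval z (x + t *: delta_mx i 0)) H.
apply: (@derive_line _ g gl).
  apply: filterS (off_poles_line i xU) => t tU; rewrite gH // /fH /gl.
  by rewrite pairing_line.
pose c k := (phi k 0 i)%:~R : R.
have hY k : is_derive (0 : R) 1 (fun t => yval z (x + t *: delta_mx i 0) k)
    (riccati kk (yval z x k) * c k).
  rewrite /yval (_ : (fun t => _) = F \o (fun t => pairing (map_mx intr (phi k)) (x + z *: E) + t * c k)); last first.
    by apply/funext => t; rewrite /= pairing_line mxE.
  have hl : is_derive (0 : R) 1 (fun t => pairing (map_mx intr (phi k)) (x + z *: E) + t * c k) (c k).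
    have -> : (fun t => pairing (map_mx intr (phi k)) (x + z *: E) + t * c k) =
       cst (pairing (map_mx intr (phi k)) (x + z *: E)) + c k *: id.
      by apply/funext => t; rewrite /= mulrC.
    by apply: is_derive_eq; rewrite add0r [_ *: _]mulr1.
  have hF : is_derive (pairing (map_mx intr (phi k)) (x + z *: E) + 0 * c k) 1 F
      (riccati kk (F (pairing (map_mx intr (phi k)) (x + z *: E)))).
    by rewrite mul0r addr0; exact: dF (xU k).
  exact: (@is_derive1_comp _ F (fun t => pairing (map_mx intr (phi k)) (x + z *: E) + t * c k) 0 _ _ hF hl).
have hm := is_derive_meval H hY.
have hE : is_derive (0 : R) 1 (fun t => expR (pairing a (x + z *: E) + t * a 0 i))
    (expR (pairing a (x + z *: E)) * a 0 i).
  have hl : is_derive (0 : R) 1 (fun t => pairing a (x + z *: E) + t * a 0 i) (a 0 i).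
    have -> : (fun t => pairing a (x + z *: E) + t * a 0 i) =
       cst (pairing a (x + z *: E)) + a 0 i *: id.
      by apply/funext => t; rewrite /= mulrC.
    by apply: is_derive_eq; rewrite add0r [_ *: _]mulr1.
  have hX : is_derive (pairing a (x + z *: E) + 0 * a 0 i) 1 expR
      (expR (pairing a (x + z *: E))).
    by rewrite mul0r addr0; exact: is_derive_expR.
  exact: (@is_derive1_comp _ expR (fun t => pairing a (x + z *: E) + t * a 0 i) 0 _ _ hX hl).
have -> : gl = (fun t => expR (pairing a (x + z *: E) + t * a 0 i)) *
   (fun t => mpoly.meval (yval z (x + t *: delta_mx i 0)) H) by [].
apply: is_derive_eq; rewrite mul0r addr0 scale0r addr0 /d /fH /Dcoord mpoly.mevalD mpoly.mevalZ.
rewrite mulrDr addrC; congr (_ + _); first by rewrite /GRing.scale /=; ring.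
rewrite [LHS]/GRing.scale /=; congr (_ * _).
rewrite /Delta raddf_sum; apply: eq_bigr => k _ /=.
rewrite mpoly.mevalZ mpoly.mevalM -/(c k).
rewrite [X in _ = _ * (X * _)](_ : _ = riccati kk (yval z x k)); first by ring.
rewrite /riccati mpoly.mevalB !mpoly.mevalM /Yvar mpoly.mevalXU; congr (_ * _ - _).
by case: kk; rewrite ?mpoly.meval1 ?mpoly.meval0.
Qed.

Lemma partials_eq z H x (m : mpoly.multinom r) (g : 'cV[R]_r -> R) : off_poles z x ->
  (forall x, off_poles z x -> g x = fH z H x) ->
  partials m g x = fH z (Dmonom phi kk a m H) x.
Proof.
move=> xU gH; pose Rel (g : 'cV[R]_r -> R) K := forall x, off_poles z x -> g x = fH z K x.
apply: (Dmonom_ind2 (D1 := fun i g x => 'D_(delta_mx i 0) g x) (D2 := Dcoord phi kk a)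
  (Rel := Rel) m _ (gH : Rel g H)) xU => i g' K h y yU.
exact: derive_fH.
Qed.

Variable lam : 'I_p -> {poly R}.

Lemma meval_ev (y : 'I_p -> R) (s : R) H : (forall k, y k = (lam k).[s]) ->
  mpoly.meval y H = (ev lam H).[s].
Proof.
move=> yE; elim/mpoly.mpolyind: H => [|c m H _ _ IH].
  by rewrite mpoly.meval0 linear0 horner0.
rewrite mpoly.mevalD mpoly.mevalZ linearP hornerD hornerZ IH; congr (_ * _ + _).
rewrite mpoly.mevalX /= /ev mpoly.mmapX /mpoly.mmap1 horner_prod; apply: eq_bigr => k _.
by rewrite horner_exp yE.
Qed.

(** At x = 0 the values of the y_k are polynomials in the single number s, which will be
    F z. *)
Lemma diffop_eq z H (P : mpoly.mpoly r R) (g : 'cV[R]_r -> R) (s : R) :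
  (forall k, pairing (map_mx intr (phi k)) (z *: E) != 0) ->
  (forall k, F (pairing (map_mx intr (phi k)) (z *: E)) = (lam k).[s]) ->
  (forall x, off_poles z x -> g x = fH z H x) ->
  diffop P g 0 = expR (pairing a E * z) * (ev lam (Dpoly phi kk a P H)).[s].
Proof.
move=> z0 ys gH.
have U0 : off_poles z 0 by move=> k; rewrite add0r.
rewrite /diffop /Dpoly linear_sum horner_sum mulr_sumr; apply: eq_bigr => m _ /=.
rewrite (partials_eq _ U0 gH) /fH add0r linearZ /= hornerZ mulrCA; congr (_ * (_ * _)).
  by congr expR; rewrite /pairing -scalemxAr mxE mulrC.
by apply: meval_ev => k; rewrite /yval add0r.
Qed.

End Deriv.

(** * Chambers near a generic point of the wall *)

Section Local.
Context {R : realType}.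
Variable r : nat.
Implicit Types (x y v : 'rV[R]_r) (l : 'cV[R]_r).
Local Notation intrmx := (map_mx (intr : int -> R)).

Definition small (e : R) x := forall i, `|x 0 i| < e.

Lemma open_small (O : set 'rV[R]_r) x : open O -> O x ->
  exists2 e : R, 0 < e & forall y, small e y -> O (x + y).
Proof.
move=> oO Ox; have /nbhs_ballP[e /= e0 h] : nbhs x O by apply: open_nbhs_nbhs.
exists e => // y ys; apply: h; split => // i j.
by rewrite /ball /= !ord1 !mxE opprD addrA subrr sub0r normrN.
Qed.

Lemma small_open (A : set 'rV[R]_r) :
  (forall x, A x -> exists2 e : R, 0 < e & forall y, small e y -> A (x + y)) -> open A.
Proof.
move=> h; rewrite openE => x /h[e e0 he]; apply/nbhs_ballP; exists e => //= y [_ xy].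
rewrite -[y](subrK x) addrC; apply: he => i.
by have := xy 0 i; rewrite /ball /= distrC !mxE.
Qed.

Lemma closure_small (A : set 'rV[R]_r) x e : closure A x -> 0 < e ->
  exists2 y, small e y & A (x + y).
Proof.
move=> cA e0; have /cA[z [Az [_ zB]]] : nbhs x (ball x e) by exact: nbhsx_ballx.
exists (z - x); last by rewrite addrC subrK.
by move=> i; have := zB 0 i; rewrite /ball /= distrC !mxE.
Qed.

Lemma smallS e e' x : e <= e' -> small e x -> small e' x.
Proof. by move=> h hx i; exact: lt_le_trans (hx i) h. Qed.

Lemma small_pairing l : exists2 C : R, 0 < C & forall e x, 0 < e -> small e x -> `|pairing x l| < C * e.
Proof.
exists (1 + \sum_i `|l i 0|); first by rewrite ltr_pwDl // sumr_ge0.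
move=> e x e0 hx; rewrite /pairing mxE mulrDl mul1r.
rewrite ltr_pwDl //; apply: le_trans (ler_norm_sum _ _ _) _.
rewrite mulr_suml; apply: ler_sum => i _; rewrite normrM mulrC; apply: ler_wpM2l => //.
exact: ltW.
Qed.

Lemma open_form l : open [set x : 'rV[R]_r | pairing x l != 0].
Proof.
apply: small_open => x /= xl; have [C C0 hC] := small_pairing l.
have e0 : 0 < `|pairing x l| / C by rewrite divr_gt0 ?normr_gt0.
exists (`|pairing x l| / C) => // y /(hC _ _ e0); rewrite mulrC (divfK (lt0r_neq0 C0)) => h.
rewrite pairingD addr_eq0; apply/negP => /eqP xy.
by move: h; rewrite xy normrN ltxx.
Qed.

Lemma segment_component (S : set 'rV[R]_r) x y :
  (forall t : R, 0 <= t <= 1 -> S (x + t *: (y - x))) -> connected_component S x y.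
Proof.
move=> h; pose f (t : R) := x + t *: (y - x).
exists (f @` `[0, 1]%classic); last by exists 1; rewrite /= ?in_itv /= ?ler01 ?lexx // /f scale1r addrC subrK.
split.
- by exists 0; rewrite /= ?in_itv /= ?ler01 ?lexx // /f scale0r addr0.
- by move=> _ [t + <-]; rewrite /= in_itv /=; exact: h.
apply: connected_continuous_connected; first exact: segment_connected.
apply: continuous_subspaceT => t; apply: cvgD; first exact: cvg_cst.
by apply: cvgZr_tmp; exact: cvg_id.
Qed.

Lemma component_of (S : set 'rV[R]_r) a p x :
  connected_component S a p -> connected_component S p x -> connected_component S a x.
Proof. exact: connected_component_trans. Qed.

(** Rational points are dense in a rational subspace, and the zeros of finitely many nonzero
    forms do not fill an open set: the forms are dealt with one by one, the open set
    being shrunk each time. *)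
Lemma generic_point (nu : seq 'rV[int]_r) (ls : seq 'cV[R]_r) (O : set 'rV[R]_r) :
  open O -> O `&` Rspan R nu !=set0 ->
  (forall l, l \in ls -> exists2 v, Rspan R nu v & pairing v l != 0) ->
  exists (w : 'rV[int]_r) (d : nat), [/\ Rspan R nu (intrmx w), O (d.+1%:R^-1 *: intrmx w) &
    forall l, l \in ls -> pairing (intrmx w) l != 0].
Proof.
elim: ls O => [|l ls IH] O oO [p [Op Wp]] hls.
  have [e e0 he] := open_small oO Op.
  have [b pE] := submxP Wp.
  pose C := 1 + \sum_i \sum_j `|(rseqmx R nu) i j|.
  have C0 : 0 < C by rewrite ltr_pwDl // sumr_ge0 // => i _; rewrite sumr_ge0.
  pose d := Num.truncn (C / e).
  have dP : C < d.+1%:R * e by rewrite -ltr_pdivrMr //; exact: truncnS_gt.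
  pose m : 'rV[int]_(size nu) := \row_i Num.floor (d.+1%:R * b 0 i).
  exists (m *m seqmx nu), d; split => //.
    by rewrite /Rspan /= map_mxM submxMl.
  have -> : d.+1%:R^-1 *: intrmx (m *m seqmx nu) = p + (d.+1%:R^-1 *: intrmx m - b) *m rseqmx R nu.
    by rewrite pE mulmxBl addrCA subrr addr0 map_mxM -scalemxAl.
  apply: he => j; rewrite mxE; apply: le_lt_trans (ler_norm_sum _ _ _) _.
  have d0 : 0 < d.+1%:R :> R by [].
  apply: (@le_lt_trans _ _ (d.+1%:R^-1 * C)); last by rewrite ltr_pdivrMl.
  apply: (@le_trans _ _ (\sum_i d.+1%:R^-1 * `|(rseqmx R nu) i j|)).
    apply: ler_sum => i _; rewrite normrM; apply: ler_wpM2r => //.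
    rewrite !mxE; set f : R := (Num.floor _)%:~R.
    have -> : d.+1%:R^-1 * f - b 0 i = d.+1%:R^-1 * (f - d.+1%:R * b 0 i).
      by rewrite mulrBr (mulKf (lt0r_neq0 d0)).
    rewrite normrM gtr0_norm ?invr_gt0 //.
    rewrite ler_piMr ?invr_ge0 ?(ltW d0) //.
    have /andP[h1 h2] := floor_itv (d.+1%:R * b 0 i).
    move: h1 h2; rewrite intrD -/f => h1 h2.
    by rewrite ler_norml; apply/andP; split; lra.
  rewrite -mulr_sumr; apply: ler_wpM2l; first by rewrite invr_ge0 ltW.
  apply: (@le_trans _ _ (\sum_i \sum_j `|(rseqmx R nu) i j|)); last by rewrite /C lerDr.
  apply: ler_sum => i _; rewrite (bigD1 j) //= lerDl; exact: sumr_ge0.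
have [v Wv vl] := hls l (mem_head _ _).
have oO' : open (O `&` [set x | pairing x l != 0]).
  by apply: openI => //; exact: open_form.
have meet : (O `&` [set x | pairing x l != 0]) `&` Rspan R nu !=set0.
  have [pl|pl] := eqVneq (pairing p l) 0; last by exists p.
  have [e e0 he] := open_small oO Op.
  pose N := 1 + \sum_i `|v 0 i|.
  have N0 : 0 < N by rewrite ltr_pwDl // sumr_ge0.
  exists (p + (e / N) *: v); split; [split|].
  - apply: he => i; rewrite mxE normrM gtr0_norm ?divr_gt0 // mulrAC ltr_pdivrMr //.
    rewrite ltr_pM2l // /N (bigD1 i) //= addrCA.
    by rewrite ltrDl ltr_pwDl // sumr_ge0.
  - by rewrite /= pairingD pairingZ pl add0r mulf_neq0 // lt0r_neq0 // divr_gt0.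
  by rewrite /Rspan /= addmx_sub // scalemx_sub.
have [|w [d [h1 [h2 h2'] h3]]] := IH _ oO' meet.
  by move=> l' hl'; apply: hls; rewrite inE hl' orbT.
exists w, d; split => // l'; rewrite inE => /orP[/eqP ->|]; last exact: h3.
by move: h2'; rewrite /= pairingZ mulf_eq0 negb_or => /andP[].
Qed.

Lemma sep_form (mu : seq 'rV[int]_r) x : ~ Rspan R mu x ->
  exists l : 'cV[R]_r, (forall y, Rspan R mu y -> pairing y l = 0) /\ pairing x l != 0.
Proof.
rewrite /Rspan /= => /negP; rewrite submxE => h.
have /existsP[i xi] : [exists i, (x *m cokermx (rseqmx R mu)) 0 i != 0].
  apply: contraR h; rewrite negb_exists => /forallP h; apply/eqP/rowP => i.
  by have := h i; rewrite negbK => /eqP ->; rewrite mxE.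
exists (col i (cokermx (rseqmx R mu))); split.
  move=> y; rewrite submxE => /eqP h'.
  by rewrite /pairing colE mulmxA h' mul0mx mxE.
by rewrite /pairing colE mulmxA -colE mxE.
Qed.

Lemma cone_span (mu : seq 'rV[int]_r) x : cone R mu x -> Rspan R mu x.
Proof. by move=> [t [_ <-]]; rewrite /Rspan /= submxMl. Qed.

Lemma rank_size (mu : seq 'rV[int]_r) : (\rank (rseqmx R mu) <= size mu)%N.
Proof. exact: rank_leq_row. Qed.

Lemma subseq_enum (s Phi : seq 'rV[int]_r) : subseq s Phi ->
  s \in [seq mask (val m) Phi | m <- enum {: (size Phi).-tuple bool}].
Proof.
move=> /subseqP[m sm ->]; apply/mapP.
have h : size m == size Phi by rewrite sm.
by exists (Tuple h); rewrite ?mem_enum.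
Qed.

Variables (Phi : seq 'rV[int]_r) (E : 'cV[int]_r) (c1 c2 c12 : set 'rV[R]_r).
Let Phi0 := [seq phi <- Phi | pairing phi E == 0].
Local Notation ER := (intrmx E : 'cV[R]_r).
Hypothesis Phi_full : Rspan R Phi = setT.

(** The vectors which generate the wall are among those of Phi0. *)
Lemma wall_Phi0 : wall Phi (hyperplane R E) -> exists nu : seq 'rV[int]_r,
  [/\ subseq nu Phi0, (size nu).+1 = r, row_free (rseqmx R nu), hyperplane R E = Rspan R nu &
    Rspan R Phi0 = hyperplane R E].
Proof.
move=> [nu [h1 h2 h3 h4]].
have nuW phi : phi \in nu -> pairing phi E == 0.
  move=> hphi; have : hyperplane R E (intrmx phi).
    rewrite h4 /Rspan /=; have /(nthP 0)[i hi <-] := hphi.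
    have -> : intrmx nu`_i = row (Ordinal hi) (rseqmx R nu).
      by apply/rowP => j; rewrite !mxE.
    exact: row_sub.
  by rewrite /hyperplane /= pairing_int => /eqP; rewrite intr_eq0.
have sub0 : subseq nu Phi0.
  by rewrite /Phi0 subseq_filter h1 andbT; apply/allP.
exists nu; split => //.
apply/seteqP; split => x; rewrite /Rspan /=.
  move=> /submxP[t ->]; rewrite /hyperplane /= /pairing -mulmxA.
  suff -> : rseqmx R Phi0 *m ER = 0 by rewrite mulmx0 mxE.
  apply/colP => i; rewrite [RHS]mxE.
  have : Phi0`_i \in Phi0 by exact: mem_nth.
  rewrite mem_filter => /andP[/eqP h _].
  have := pairing_int Phi0`_i E; rewrite h => h'.
  by rewrite -[RHS](mulr0z (1 : R)) -[RHS]/(0%:~R) -h' /pairing !mxE; apply: eq_bigr => j _; rewrite !mxE.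
rewrite h4 /Rspan /= => /submx_trans; apply; apply/row_subP => i.
have : nu`_i \in Phi0 by apply: (mem_subseq sub0); exact: mem_nth.
move=> /(nthP 0)[j hj Ej].
have -> : row i (rseqmx R nu) = row (Ordinal hj) (rseqmx R Phi0).
  by apply/rowP => k; rewrite !mxE Ej.
exact: row_sub.
Qed.

End Local.

Section LocalCone.
Context {R : realType}.
Variable r : nat.
Implicit Types (x y v : 'rV[R]_r) (l : 'cV[R]_r).
Local Notation intrmx := (map_mx (intr : int -> R)).
Variables (Phi : seq 'rV[int]_r) (E : 'cV[int]_r) (c1 c2 c12 : set 'rV[R]_r).
Local Notation Phi0 := [seq phi <- Phi | pairing phi E == 0].
Local Notation ER := (intrmx E : 'cV[R]_r).

Hypothesis Phi_full : Rspan R Phi = setT.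
Hypothesis W_wall : wall Phi (hyperplane R E).

Let nuP := wall_Phi0 W_wall.

Lemma W_rank : \rank (rseqmx R Phi0) = r.-1 /\ (0 < r)%N.
Proof.
have [nu [h1 h2 h3 h4 h5]] := nuP; split; last by move: h2; clear; lia.
have e : (rseqmx R Phi0 :=: rseqmx R nu)%MS.
  apply/eqmxP/andP; split; apply/row_subP => i.
    have : Rspan R Phi0 (row i (rseqmx R Phi0)) by exact: row_sub.
    by rewrite h5 h4.
  have : Rspan R nu (row i (rseqmx R nu)) by exact: row_sub.
  by rewrite -h4 -h5.
by rewrite e (eqP h3); move: h2; clear; lia.
Qed.

Lemma subW_in (mu : seq 'rV[int]_r) : (size mu < r)%N ->
  hyperplane R E `<=` Rspan R mu -> forall x, Rspan R mu x -> hyperplane R E x.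
Proof.
have [nu [h1 h2 h3 h4 h5]] := nuP; rewrite h4 => smu sub x.
have le : (rseqmx R nu <= rseqmx R mu)%MS.
  by apply/row_subP => i; apply: sub; exact: row_sub.
have : (rseqmx R mu <= rseqmx R nu)%MS.
  rewrite -(mxrank_leqif_sup le) eqn_leq mxrankS //= (eqP h3).
  by apply: leq_trans (rank_size _) _; move: smu h2; clear; lia.
by move=> h; rewrite /Rspan /= => /submx_trans; apply.
Qed.

(** A form which vanishes on the span of mu, but not on the wall.  A point where it does not
    vanish is outside of the cone of mu. *)
Definition badform (mu : seq 'rV[int]_r) l :=
  (forall y, Rspan R mu y -> pairing y l = 0) /\
  exists2 v, hyperplane R E v & pairing v l != 0.

(** A subset of fewer than r vectors whose cone contains a point off the wall cannot span the
    wall. *)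
Lemma bad_big (mu : seq 'rV[int]_r) : (size mu < r)%N ->
  (exists2 x, cone R mu x & ~ hyperplane R E x) -> exists l, badform mu l.
Proof.
move=> smu [x cx Wx].
have [v [Wv nv]] : exists v, hyperplane R E v /\ ~ Rspan R mu v.
  apply: contrapT => h; apply: Wx; apply: (subW_in smu); last exact: cone_span.
  by move=> v Wv; apply: contrapT => nv; apply: h; exists v.
by have [l [h1 h2]] := sep_form nv; exists l; split => //; exists v.
Qed.

Lemma bad_small (mu : seq 'rV[int]_r) : (size mu < r.-1)%N -> exists l, badform mu l.
Proof.
move=> smu; have [nu [h1 h2 h3 h4 h5]] := nuP.
have [v [Wv nv]] : exists v, hyperplane R E v /\ ~ Rspan R mu v.
  apply: contrapT => h.
  have le : (rseqmx R nu <= rseqmx R mu)%MS.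
    apply/row_subP => i; apply: contrapT => nv; apply: h.
    by exists (row i (rseqmx R nu)); split => //; rewrite h4; exact: row_sub.
  have := mxrankS le; rewrite (eqP h3) leqNgt => /negP; apply.
  by apply: leq_ltn_trans (rank_size _) _; move: smu h2; clear; lia.
by have [l [? ?]] := sep_form nv; exists l; split => //; exists v.
Qed.

(** The direction w is chosen in the open part of the wall where the closures meet, off the
    zeros of one bad form for each subset of Phi.  The points T w + b with b small compared
    with T and of a given sign of <b, E> form a convex set; it avoids the singular cones,
    because a cone meeting it would have a bad form.  So it lies in one chamber, and the
    closures tell which. *)
Lemma local_cone : 
  chamber Phi c1 -> chamber Phi c2 -> adjacent_chambers Phi E c1 c2 ->
  chamber Phi0 c12 -> closure c1 `&` closure c2 `&` hyperplane R E `<=` closure c12 ->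
  exists (w : 'rV[int]_r) (eps : R), [/\ 0 < eps, pairing w E = 0 &
    forall (T : R) b, 0 < T -> small (T * eps) b ->
      [/\ 0 < pairing b ER -> c1 (T *: intrmx w + b),
          pairing b ER < 0 -> c2 (T *: intrmx w + b) &
          pairing b ER = 0 -> c12 (T *: intrmx w + b)]].
Proof.
move=> [a1 _ c1E] [a2 _ c2E] [c12ne c1pos _ [Q [oO [p [Op Wp]] Ocl]]] [a12 _ c12E] clsub.
have [nu [h1 h2 h3 h4 h5]] := nuP.
pose ms := [seq mask (val m) Phi | m <- enum {: (size Phi).-tuple bool}].
pose lf (mu : seq 'rV[int]_r) : 'cV[R]_r := xget 0 (badform mu).
pose ls := [seq lf mu | mu <- ms & `[< exists l, badform mu l >]].
have lfP mu : (exists l, badform mu l) -> badform mu (lf mu) by exact: xgetPex.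
have lsP l : l \in ls -> exists2 v, Rspan R nu v & pairing v l != 0.
  move=> /mapP[mu]; rewrite mem_filter => /andP[/asboolP /lfP[_ [v Wv vl]] _ ->].
  by exists v => //; rewrite -h4.
have Omeet : Q `&` Rspan R nu !=set0 by exists p; split => //; rewrite -h4.
have [w [d [Ww Ow wl]]] := generic_point oO Omeet lsP.
have inls mu : subseq mu Phi -> (exists l, badform mu l) -> lf mu \in ls.
  move=> smu hl; apply/mapP; exists mu => //; rewrite mem_filter subseq_enum // andbT.
  exact/asboolP.
have wE : pairing (intrmx w) ER = 0 by move: Ww; rewrite -h4.
(* e is the radius of a ball around w / D which misses the zeros of the forms. *)
pose D : R := d.+1%:R.
have D0 : 0 < D by [].
have [e e0 he] : exists2 e : R, 0 < e & forall b l, l \in ls -> small e b ->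
    pairing (D^-1 *: intrmx w + b) l != 0.
  elim: ls wl {lsP inls} => [|l ls' IH] wl; first by exists 1.
  have [e e0 he] : exists2 e : R, 0 < e & forall b l, l \in ls' -> small e b ->
      pairing (D^-1 *: intrmx w + b) l != 0.
    by apply: IH => l' hl'; apply: wl; rewrite inE hl' orbT.
  have Ol : [set x : 'rV[R]_r | pairing x l != 0] (D^-1 *: intrmx w).
    by rewrite /= pairingZ; apply: mulf_neq0; [rewrite invr_eq0 lt0r_neq0|apply: wl; rewrite mem_head].
  have [e' e0' he'] := open_small (@open_form _ _ l) Ol.
  exists (Num.min e e'); first by rewrite lt_min e0.
  move=> b l'; rewrite inE => /orP[/eqP ->|hl'] bs.
    by apply: he'; apply: smallS bs; rewrite ge_min lexx orbT.
  by apply: he => //; apply: smallS bs; rewrite ge_min lexx.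
pose C (T : R) b := T *: intrmx w + b.
have CD (T : R) b : C T b = (T * D) *: (D^-1 *: intrmx w + (T * D)^-1 *: b) \/ ~ 0 < T.
  have [T0|T0] := ltP 0 T; [left|by right].
  have TD : T * D != 0 by rewrite lt0r_neq0 // mulr_gt0.
  by rewrite /C scalerDr !scalerA mulfV // scale1r mulfK // lt0r_neq0.
have nz (T : R) b l : 0 < T -> small (T * (D * e)) b -> l \in ls -> pairing (C T b) l != 0.
  move=> T0 bs hl; have [->|//] := CD T b.
  have TD : 0 < T * D by rewrite mulr_gt0.
  rewrite pairingZ; apply: mulf_neq0; first exact: lt0r_neq0; apply: he => // i.
  by rewrite mxE normrM gtr0_norm ?invr_gt0 // ltr_pdivrMl // -mulrA.
have CE (T : R) b : pairing (C T b) ER = pairing b ER.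
  by rewrite /C pairingD pairingZ wE mulr0 add0r.
have out (T : R) b : 0 < T -> small (T * (D * e)) b -> pairing b ER != 0 ->
    (Rspan R Phi `\` cone_sing R Phi) (C T b).
  move=> T0 bs bE; split; first by rewrite Phi_full.
  move=> [mu [smu rmu cmu]].
  have rr : (size mu < r)%N by have h := rank_full Phi_full; move: rmu h; clear; lia.
  have bad : exists l, badform mu l.
    apply: bad_big => //; exists (C T b) => //; rewrite /hyperplane /= CE.
    by move=> b0; rewrite b0 eqxx in bE.
  have [z _] := lfP _ bad; have := nz T b _ T0 bs (inls _ smu bad).
  by rewrite (z _ (cone_span cmu)) eqxx.
have out0 (T : R) b : 0 < T -> small (T * (D * e)) b -> pairing b ER = 0 ->
    (Rspan R Phi0 `\` cone_sing R Phi0) (C T b).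
  move=> T0 bs bE; split; first by rewrite h5 /hyperplane /= CE.
  move=> [mu [smu rmu cmu]].
  have bad : exists l, badform mu l by apply: bad_small; have [h _] := W_rank; move: rmu h; clear; lia.
  have smu' : subseq mu Phi by apply: subseq_trans smu (filter_subseq _ _).
  have [z _] := lfP _ bad; have := nz T b _ T0 bs (inls _ smu' bad).
  by rewrite (z _ (cone_span cmu)) eqxx.
pose eps := D * e.
have eps0 : 0 < eps by rewrite mulr_gt0.
have conv T b T' b' (t : R) : 0 <= t <= 1 -> 0 < T -> 0 < T' -> small (T * eps) b -> small (T' * eps) b' ->
   [/\ 0 < T + t * (T' - T), small ((T + t * (T' - T)) * eps) (b + t *: (b' - b)) &
    C T b + t *: (C T' b' - C T b) = C (T + t * (T' - T)) (b + t *: (b' - b))].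
  move=> /andP[t0 t1] T0 T0' bs bs'; have TT : 0 < T + t * (T' - T).
    have -> : T + t * (T' - T) = (1 - t) * T + t * T' by ring.
    have [->|tt] := eqVneq t 0; first by rewrite subr0 mul1r mul0r addr0.
    have {tt} tt : 0 < t by rewrite lt_neqAle eq_sym tt.
    by rewrite ltr_wpDl ?mulr_gt0 // mulr_ge0 ?subr_ge0 // ltW.
  split => //; last first.
    by apply/rowP => i; rewrite /C !mxE; ring.
  move=> i; rewrite !mxE.
  have -> : b 0 i + t * (b' 0 i - b 0 i) = (1 - t) * b 0 i + t * b' 0 i by ring.
  have := bs i; have := bs' i; rewrite !ltr_norml => /andP[q1 q2] /andP[q3 q4].
  have [->|tt] := eqVneq t 0; first by apply/andP; split; lra.
  have {}t0 : 0 < t by rewrite lt_neqAle eq_sym tt.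
  by apply/andP; split; nra.
have clW : closure c1 (D^-1 *: intrmx w) /\ closure c2 (D^-1 *: intrmx w).
  by apply: Ocl; split => //; rewrite /hyperplane /= pairingZ wE mulr0.
have cl12 : closure c12 (D^-1 *: intrmx w).
  by apply: clsub; split; [exact: clW|rewrite /hyperplane /= pairingZ wE mulr0].
have De : D^-1 * eps = e by rewrite /eps mulKf // lt0r_neq0.
have Dinv0 : 0 < D^-1 by rewrite invr_gt0.
have [b1 b1s c1b1] := closure_small clW.1 e0.
have [b2 b2s c2b2] := closure_small clW.2 e0.
have [b12 b12s c12b12] := closure_small cl12 e0.
have s1 : small (D^-1 * eps) b1 by rewrite De.
have s2 : small (D^-1 * eps) b2 by rewrite De.
have s12 : small (D^-1 * eps) b12 by rewrite De.
have b1E : 0 < pairing b1 ER by have := c1pos _ c1b1; rewrite -/(C _ _) CE.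
have C1 T b : 0 < T -> small (T * eps) b -> 0 < pairing b ER -> c1 (C T b).
  move=> T0 bs bE; rewrite c1E; apply: (@component_of _ _ _ _ (C D^-1 b1)).
    by rewrite -c1E.
  apply: segment_component => t t01; have [q1 q2 ->] := conv _ _ _ _ t t01 Dinv0 T0 s1 bs.
  apply: out => //; rewrite pairingD pairingZ pairingB.
  case/andP: t01 => t0 t1; rewrite lt0r_neq0 //; nra.
(* If c2 is the exterior, nothing forbids a priori that it meets the positive
   side; but then it would share a point of the cone with c1. *)
have b2E : pairing b2 ER < 0.
  rewrite ltNge le_eqVlt; apply/negP => /orP[/eqP b20|b20].
    have : c1 (C D^-1 b2).
      rewrite c1E; apply: (@component_of _ _ _ _ (C D^-1 b1)); first by rewrite -c1E.
      apply: segment_component => t t01.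
      have [t1|t1] := eqVneq t 1.
        rewrite t1 scale1r addrC subrK.
        by move: c2b2; rewrite c2E => /connected_component_sub.
      have [q1 q2 ->] := conv _ _ _ _ t t01 Dinv0 Dinv0 s1 s2.
      apply: out => //; rewrite pairingD pairingZ pairingB -b20.
      have -> : pairing b1 ER + t * (0 - pairing b1 ER) = (1 - t) * pairing b1 ER by ring.
      by apply: mulf_neq0; [rewrite subr_eq0 eq_sym|exact: lt0r_neq0].
    by move=> /c1pos; rewrite CE -b20 ltxx.
  have h := C1 _ _ Dinv0 s2 b20; apply: c12ne.
  move: h c2b2; rewrite c1E c2E -/(C _ _) => h h'.
  by rewrite (same_connected_component h) (same_connected_component h').
have C2 T b : 0 < T -> small (T * eps) b -> pairing b ER < 0 -> c2 (C T b).
  move=> T0 bs bE; rewrite c2E; apply: (@component_of _ _ _ _ (C D^-1 b2)).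
    by rewrite -c2E.
  apply: segment_component => t t01; have [q1 q2 ->] := conv _ _ _ _ t t01 Dinv0 T0 s2 bs.
  apply: out => //; rewrite pairingD pairingZ pairingB.
  case/andP: t01 => t0 t1; rewrite ltr0_neq0 //; nra.
have b12E : pairing b12 ER = 0.
  move: c12b12; rewrite -/(C _ _) c12E => /connected_component_sub [].
  by rewrite h5 /hyperplane /= CE.
exists w, eps; split => //.
  by move: wE; rewrite pairing_int => /eqP; rewrite intr_eq0 => /eqP.
move=> T b T0 bs; split => bE; [exact: C1|exact: C2|].
rewrite c12E -/(C _ _); apply: (@component_of _ _ _ _ (C D^-1 b12)).
  by rewrite -c12E.
apply: segment_component => t t01; have [q1 q2 ->] := conv _ _ _ _ t t01 Dinv0 T0 s12 bs.
by apply: out0 => //; rewrite pairingD pairingZ pairingB bE b12E subrr mulr0 addr0.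
Qed.

End LocalCone.

(** * Counting lattice points *)

Section Count.
Context {R : realType}.
Variable r : nat.
Local Notation intrmx := (map_mx (intr : int -> R)).
Implicit Types (Phi : seq 'rV[int]_r) (phi : 'rV[int]_r) (a : 'rV[R]_r) (h : 'cV[R]_r).

Definition lattice_points Phi a : set 'rV[int]_(size Phi) := [set t | polytope Phi a (intrmx t)].
Arguments lattice_points Phi a _ : clear implicits.

Lemma lattice_points_finite Phi h a : half_space Phi h -> finite_set (lattice_points Phi a).
Proof.
move=> hP; have pos := half_spaceP hP.
pose C := 1 + \sum_i `|pairing a h| / (rseqmx R Phi *m h) i 0.
pose N := (Num.truncn C).+1.
pose F (f : {ffun 'I_(size Phi) -> 'I_N}) : 'rV[int]_(size Phi) := \row_i (f i : nat)%:Z.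
apply: (@sub_finite_set _ _ (F @` setT)); last exact: (finite_image F (finite_finset)).
move=> t [t0 ta].
have tb i : (`|t 0%R i| < N)%N.
  have ti : (t 0 i)%:~R = (`|t 0%R i|%N)%:R :> R.
    have := t0 i; rewrite mxE ler0z => h0.
    by rewrite -{1}(gez0_abs h0).
  rewrite /N -(ltr_nat R); apply: le_lt_trans (truncnS_gt C).
  rewrite -ti; apply: (@le_trans _ _ (`|pairing a h| / (rseqmx R Phi *m h) i 0)).
    rewrite ler_pdivlMr //; apply: le_trans (ler_norm _).
    have -> : pairing a h = \sum_j intrmx t 0 j * (rseqmx R Phi *m h) j 0.
      by rewrite /pairing -ta -mulmxA mxE.
    rewrite (bigD1 i) //= [intrmx t 0 i]mxE lerDl.
    by apply: sumr_ge0 => j _; apply: mulr_ge0 => //; exact: ltW.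
  rewrite /C (bigD1 i) //= addrCA lerDl addr_ge0 // sumr_ge0 // => j _.
  by rewrite divr_ge0 // ltW.
exists [ffun i => Ordinal (tb i)] => //; apply/rowP => i; rewrite mxE ffunE /= abszE ger0_norm //.
by have := t0 i; rewrite mxE ler0z.
Qed.

Lemma card_fset_image (T U : choiceType) (f : T -> U) (A : set T) : injective f ->
  finite_set A -> #|` fset_set (f @` A)|%fset = #|` fset_set A|%fset.
Proof. by move=> fi fA; rewrite fset_set_image // card_imfset. Qed.

Lemma num_points_perm Phi Psi a h : half_space Phi h -> perm_eq Psi Phi ->
  num_points Psi a = num_points Phi a.
Proof.
move=> hP pe; have [f [g fK gK] fE] := perm_eq_index pe.
pose F (t : 'rV[int]_(size Phi)) : 'rV[int]_(size Psi) := \row_i t 0 (f i).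
have FI : injective F.
  move=> s t /rowP st; apply/rowP => i; have := st (g i).
  by rewrite !mxE gK.
rewrite /num_points -[RHS](card_fset_image FI (lattice_points_finite a hP)).
congr (#|` fset_set _|)%fset.
have E t : intrmx (F t) *m rseqmx R Psi = intrmx t *m rseqmx R Phi.
  apply/rowP => j; rewrite !mxE (reindex f) /=; last by exists g => i _; rewrite ?fK ?gK.
  by apply: eq_bigr => i _; rewrite !mxE fE.
apply/seteqP; split=> t /=.
  move=> [t0 ta]; exists (\row_i t 0 (g i)); last by apply/rowP => i; rewrite !mxE fK.
  split; first by move=> i; have := t0 (g i); rewrite !mxE.
  rewrite -E -ta; congr (intrmx _ *m _); apply/rowP => i; by rewrite !mxE fK.
move=> [s [s0 sa] <-]; split; last by rewrite -sa E.
by move=> i; have := s0 (f i); rewrite !mxE.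
Qed.

Lemma num_points_out Phi a : ~ cone R Phi a -> num_points Phi a = 0%N.
Proof.
move=> h; rewrite /num_points (_ : [set t | _] = set0) ?fset_set0 ?cardfs0 //.
by apply/seteqP; split => // t ht; case: h; exists (intrmx t).
Qed.

(** A point of the polytope either has first coordinate 0, or comes from a point of the
    polytope of a - phi by adding 1 to this coordinate. *)
Lemma num_points_cons phi Phi h a : half_space (phi :: Phi) h ->
  num_points (phi :: Phi) a =
    (num_points Phi a + num_points (phi :: Phi) (a - intrmx phi))%N.
Proof.
move=> hP; have hP0 : half_space Phi h by move=> psi i; apply: hP; rewrite inE i orbT.
pose F0 (t : 'rV[int]_(size Phi)) : 'rV[int]_(size (phi :: Phi)) :=
  (row_mx 0 t : 'rV[int]_(1 + size Phi)).
pose e0 : 'rV[int]_(size (phi :: Phi)) := (row_mx 1 0 : 'rV[int]_(1 + size Phi)).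
pose F1 (t : 'rV[int]_(size (phi :: Phi))) := t + e0.
have F0I : injective F0 by move=> s t /(@eq_row_mx _ 1 1 (size Phi))[].
have F1I : injective F1 by move=> s t /addIr.
have f0 := lattice_points_finite a hP0; have f1 := lattice_points_finite (a - intrmx phi) hP.
rewrite /num_points -(card_fset_image F0I f0) -(card_fset_image F1I f1).
have mulE (c : 'rV[R]_1) u : (row_mx c u : 'rV[R]_(1 + size Phi)) *m
    (rseqmx R (phi :: Phi) : 'M[R]_(1 + size Phi, r)) = c *m intrmx phi + u *m rseqmx R Phi.
  exact: mulmx_rseqmx_cons.
have e0E : intrmx e0 *m rseqmx R (phi :: Phi) = intrmx phi.
  have -> : intrmx e0 = (row_mx 1 0 : 'rV[R]_(1 + size Phi)).
    by rewrite /e0 (@map_row_mx _ _ _ 1 1 (size Phi)) map_mx1 map_mx0.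
  by rewrite [LHS]mulE mul1mx mul0mx addr0.
have F0E t : intrmx (F0 t) *m rseqmx R (phi :: Phi) = intrmx t *m rseqmx R Phi.
  have -> : intrmx (F0 t) = (row_mx 0 (intrmx t) : 'rV[R]_(1 + size Phi)).
    by rewrite /F0 (@map_row_mx _ _ _ 1 1 (size Phi)) map_mx0.
  by rewrite [LHS]mulE mul0mx add0r.
rewrite -cardfsUI -fset_setU; [|exact: finite_image..].
rewrite -fset_setI; [|exact: finite_image..].
have r0 (c : 'rV[int]_1) (u : 'rV[int]_(size Phi)) :
    ((row_mx c u : 'rV[int]_(1 + size Phi)) : 'rV[int]_(size Phi).+1) 0 ord0 = c 0 0.
  have -> : ord0 = lshift (size Phi) (0 : 'I_1) by apply/val_inj.
  by apply: etrans (row_mxEl _ _ _ _) _.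
have rS (c : 'rV[int]_1) (u : 'rV[int]_(size Phi)) i :
    ((row_mx c u : 'rV[int]_(1 + size Phi)) : 'rV[int]_(size Phi).+1) 0 (lift ord0 i) = u 0 i.
  have -> : lift ord0 i = rshift 1 i by apply/val_inj.
  by apply: etrans (row_mxEr _ _ _ _) _.
have F00 t : F0 t 0 ord0 = 0 by apply: etrans (r0 _ _) _; rewrite mxE.
have e00 : e0 0 ord0 = 1 by apply: etrans (r0 _ _) _; rewrite mxE.
have e0S i : e0 0 (lift ord0 i) = 0 by apply: etrans (rS _ _ _) _; rewrite mxE.
have F0S t i : F0 t 0 (lift ord0 i) = t 0 i by exact: (rS _ _ _).
clearbody e0 F0.
rewrite [X in _ = (_ + #|` fset_set X|)%N](_ : _ = set0); last first.
  apply/seteqP; split => // t [[s [s0 _] <-] [u [u0 _]]] /rowP/(_ ord0).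
  rewrite /F1 mxE F00 e00 => E; have := u0 ord0; rewrite mxE ler0z => h'.
  by move: h'; rewrite (_ : u 0 ord0 = -1) //; apply/eqP; rewrite -addr_eq0 E.
rewrite fset_set0 cardfs0 addn0; congr (#|` fset_set _|)%fset.
apply/seteqP; split=> t /=.
  move=> [t0 ta].
  have [tz|tz] := eqVneq (t 0 ord0) 0.
    left; exists (\row_i t 0 (lift ord0 i)).
      split; first by move=> i; have := t0 (lift ord0 i); rewrite !mxE.
      rewrite -F0E -ta; congr (intrmx _ *m _); apply/rowP => i.
      by case: (unliftP ord0 i) => [j ->|->]; rewrite ?F0S ?F00 ?mxE.
    apply/rowP => i.
    by case: (unliftP ord0 i) => [j ->|->]; rewrite ?F0S ?F00 ?mxE.
  right; exists (t - e0); last by rewrite /F1 subrK.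
  split; last by rewrite map_mxB mulmxBl ta e0E.
  move=> i; have := t0 i; rewrite !mxE !ler0z.
  case: (unliftP ord0 i) => [j ->|->]; first by rewrite e0S oppr0 addr0.
  rewrite e00 => h0; rewrite subr_ge0 -gtz0_ge1 lt_neqAle eq_sym tz; exact: h0.
move=> [[s [s0 sa] <-]|[s [s0 sa] <-]].
  split; last by rewrite F0E.
  move=> i; rewrite mxE; case: (unliftP ord0 i) => [j ->|->]; last by rewrite F00.
  by rewrite F0S; have := s0 j; rewrite mxE.
split; last by rewrite /F1 map_mxD mulmxDl sa e0E subrK.
move=> i; have := s0 i; rewrite !mxE !ler0z.
case: (unliftP ord0 i) => [j ->|->]; first by rewrite e0S addr0.
by rewrite e00 => /addr_ge0; apply.
Qed.

Lemma num_poly_chamber Phi c k (a : 'rV[int]_r) : is_num_poly Phi c k ->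
  c (intrmx a) -> k (intrmx a) = (num_points Phi (intrmx a))%:R.
Proof.
move=> [_ k0 kE] ca; have [e|ne] := pselect (c = exterior R Phi); last first.
  by apply: kE => //; exact: subset_closure.
by move: ca; rewrite e => -[sa na]; rewrite (k0 e) // num_points_out.
Qed.

End Count.

(** * Polynomial functions and unimodularity *)

Section Lines.
Context {R : realType}.
Variable r : nat.
Local Notation intrmx := (map_mx (intr : int -> R)).

Definition poly_on_lines (F : 'rV[R]_r -> R) :=
  forall a b, exists q : {poly R}, forall t, F (a + t *: b) = q.[t].

Lemma poly_on_lines_polyval (P : mpoly.mpoly r R) : poly_on_lines (polyval P).
Proof.
move=> a b; exists (ev (fun i => (a 0 i)%:P + b 0 i *: 'X) P) => t.
by rewrite /polyval; apply: meval_ev => i; rewrite !mxE !hornerE mulrC.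
Qed.

Lemma poly_on_linesB F G : poly_on_lines F -> poly_on_lines G -> poly_on_lines (fun a => F a - G a).
Proof.
move=> hF hG a b; have [p pE] := hF a b; have [q qE] := hG a b.
by exists (p - q) => t; rewrite pE qE !hornerE.
Qed.

Lemma poly_on_lines_poly (F G : 'rV[R]_r -> R) : F =1 G -> poly_on_lines F -> poly_on_lines G.
Proof. by move=> /funext ->. Qed.

(** The coordinates are freed one at a time from the condition of being integral. *)
Lemma poly_on_lines_int0 F : poly_on_lines F -> (forall x : 'rV[int]_r, F (intrmx x) = 0) -> forall a, F a = 0.
Proof.
move=> hF F0.
suff H m (a : 'rV[R]_r) : (forall i : 'I_r, (m <= i)%N -> exists z : int, a 0 i = z%:~R) -> F a = 0.
  by move=> a; apply: (H r) => i; rewrite leqNgt ltn_ord.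
elim: m a => [|m IH] a ha.
  have /choice[z zE] : forall i, exists z : int, a 0 i = z%:~R by move=> i; exact: ha.
  have -> : a = intrmx (\row_i z i) by apply/rowP => i; rewrite !mxE.
  exact: F0.
have [rm|mr] := leqP r m.
  by apply: IH => i mi; have := leq_ltn_trans mi (ltn_ord i); rewrite ltnNge rm.
pose i0 := Ordinal mr; pose d : 'rV[R]_r := delta_mx 0 i0; pose a' := a - a 0 i0 *: d.
have a'i i : a' 0 i = if i == i0 then 0 else a 0 i.
  rewrite /a' /d !mxE eqxx /=; case: eqP => [->|_]; first by rewrite mulr1 subrr.
  by rewrite mulr0 subr0.
have aE : a' + a 0 i0 *: d = a by rewrite subrK.
have dE i : d 0 i = (i == i0)%:R by rewrite mxE.
clearbody a' d; have [q qE] := hF a' d.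
(* Along the coordinate m, q vanishes at the naturals by induction. *)
have q0 : q = 0.
  apply/eqP; apply: contraT => qn.
  pose rs := [seq (i%:R : R) | i <- iota 0 (size q)].
  have := @max_poly_roots _ q rs qn; rewrite size_map size_iota ltnn; apply.
    apply/allP => x /mapP[n _ ->]; apply/rootP; rewrite -qE; apply: IH => i mi.
    rewrite 2!mxE dE a'i; have [_|ni] := eqVneq i i0.
      by exists n%:Z; rewrite mulr1 add0r.
    rewrite mulr0 addr0; apply: ha; rewrite ltn_neqAle mi andbT.
    by apply: contra_neq ni => h; apply/val_inj.
  by rewrite map_inj_uniq ?iota_uniq //; exact: (@mulrIn _ 1 (oner_neq0 _)).
by have := qE (a 0 i0); rewrite aE q0 horner0.
Qed.

Variables (Phi : seq 'rV[int]_r) (E : 'cV[int]_r).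

Lemma Rspan_in (nu : seq 'rV[int]_r) phi : phi \in nu -> Rspan R nu (intrmx phi).
Proof.
move=> /(nthP 0)[i hi <-]; rewrite /Rspan /=.
have -> : intrmx nu`_i = row (Ordinal hi) (rseqmx R nu).
  by apply/rowP => j; rewrite !mxE.
exact: row_sub.
Qed.

Lemma Rspan_le (nu mu : seq 'rV[int]_r) : {subset nu <= mu} ->
  (rseqmx R nu <= rseqmx R mu)%MS.
Proof.
move=> h; apply/row_subP => i.
have -> : row i (rseqmx R nu) = intrmx nu`_i by apply/rowP => j; rewrite !mxE.
by apply: Rspan_in; apply: h; exact: mem_nth.
Qed.

Lemma Zspan_Rspan : Zspan Phi = setT -> Rspan R Phi = setT.
Proof.
move=> full; apply/seteqP; split => // x _; rewrite /Rspan /=.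
apply: submx_trans (submx1 x) _; apply/row_subP => i.
have [u uE] : Zspan Phi (delta_mx 0 i) by rewrite full.
have -> : row i 1%:M = intrmx u *m rseqmx R Phi; last exact: submxMl.
by rewrite -map_mxM -uE rowE mulmx1 map_delta_mx.
Qed.

(** Together with generators of the wall, phi is a basis of the space, hence a Z-basis of
    the lattice: all the values of E on the lattice are multiples of its value at phi. *)
Lemma unimodular_pm1 phi : Zspan Phi = setT -> wall Phi (hyperplane R E) ->
  unimodular R Phi -> (exists g, pairing g E = 1) ->
  phi \in Phi -> pairing phi E != 0 -> pairing phi E = 1 \/ pairing phi E = -1.
Proof.
move=> full /wall_Phi0[nu [h1 h2 h3 h4 h5]] uni [g gE] hphi phiE.
have nuE psi : psi \in nu -> pairing psi E = 0.
  by move=> /(mem_subseq h1); rewrite mem_filter => /andP[/eqP].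
have phinu : phi \notin nu by apply/negP => /nuE h; rewrite h eqxx in phiE.
have [mu smu pmu] : exists2 mu, subseq mu Phi & perm_eq (phi :: nu) mu.
  apply/count_subseqP => x /=; have [<-|nx] := eqVneq phi x.
    by rewrite (count_memPn phinu) addn0 -has_count has_pred1.
  rewrite add0n; apply: leq_trans (leq_count_subseq _ h1) _.
  exact: leq_count_subseq _ (filter_subseq _ _).
have nulemu : (rseqmx R nu <= rseqmx R mu)%MS.
  by apply: Rspan_le => x hx; rewrite -(perm_mem pmu) inE hx orbT.
have rmu : \rank (rseqmx R mu) = r.
  suff lt : (size nu < \rank (rseqmx R mu))%N.
    by have := rank_leq_col (rseqmx R mu); move: lt h2; clear; lia.
  rewrite -(eqP h3) ltnNge; apply: contra phiE => le.
  have : (rseqmx R mu <= rseqmx R nu)%MS by rewrite -(mxrank_leqif_sup nulemu) eqn_leq le mxrankS.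
  move=> /(submx_trans (_ : (intrmx phi <= rseqmx R mu)%MS)) h.
  have : Rspan R nu (intrmx phi).
    by apply: h; apply: Rspan_in; rewrite -(perm_mem pmu) mem_head.
  by rewrite -h4 /hyperplane /= pairing_int => /eqP; rewrite intr_eq0.
have smu' : size mu = r by rewrite -(perm_size pmu) /=.
have mufull : Rspan R mu = setT.
  apply/seteqP; split => // x _; rewrite /Rspan /=.
  by apply: submx_full; rewrite /row_full rmu.
have := uni mu smu; rewrite mufull (Zspan_Rspan full) full => /(_ _ (erefl _)).
have -> : row_free (rseqmx R mu) by apply/eqP; rewrite rmu smu'.
move=> /(_ isT) Zb.
have [u [uE _]] := (Zb g).1 I.
have : (pairing phi E %| pairing g E)%Z.
  rewrite uE /pairing -mulmxA mxE; apply: rpred_sum => i _.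
  apply: dvdz_mull; have : mu`_i \in phi :: nu by rewrite (perm_mem pmu) mem_nth.
  have -> : (seqmx mu *m E) i 0 = pairing mu`_i E.
    by rewrite /pairing !mxE; apply: eq_bigr => j _; rewrite !mxE.
  by rewrite inE => /orP[/eqP ->|/nuE ->].
by rewrite gE dvdz1; clear; lia.
Qed.

End Lines.

(** * The model of the jump for numbers of points *)

Lemma Dpoly1 (R : realType) (r p : nat) (phi : 'I_p -> 'rV[int]_r) kk (a : 'rV[R]_r) P :
  exists c : R, Dpoly phi kk a P 1 = c *: 1.
Proof.
have D1 i : Dcoord phi kk a i 1 = a 0 i *: 1 by rewrite /Dcoord Delta1 addr0.
have Dm1 m : exists c : R, Dmonom phi kk a m 1 = c *: 1.
  rewrite /Dmonom; elim: (enum _) => /= [|i s [c cE]]; first by exists 1; rewrite scale1r.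
  elim: (mpoly.fun_of_multinom m i) => [|n [c' cE']] /=; first by exists c.
  by exists (c' * a 0 i); rewrite cE' linearZ /= D1 scalerA.
have /choice[c cE] := Dm1; exists (\sum_(m <- mpoly.msupp P) mpoly.mcoeff m P * c m).
by rewrite scaler_suml; apply: eq_bigr => m _; rewrite cE scalerA.
Qed.

Section Discrete.
Context {R : realType}.
Variables (r : nat) (E : 'cV[int]_r) (S : seq 'rV[int]_r) (P : mpoly.mpoly r R).
Local Notation intrmx := (map_mx (intr : int -> R)).
Local Notation ER := (intrmx E : 'cV[R]_r).
Local Notation p := (size S).
Let phi (k : 'I_p) : 'rV[int]_r := S`_k.

Hypothesis Epm : forall k, pairing (phi k) E = 1 \/ pairing (phi k) E = -1.

(** The value F (e z) for e = 1 and e = - 1, as a polynomial in F z: F (- z) = 1 - F z. *)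
Definition num_lam (k : 'I_p) : {poly R} := if pairing (phi k) E == 1 then 'X else 1 - 'X.

Definition tail_prod (d : nat) : mpoly.mpoly p R := \prod_(k < p | (d <= k)%N) Yvar k.

Lemma tail_prodS (k : 'I_p) : tail_prod k = Yvar k * tail_prod k.+1.
Proof.
rewrite /tail_prod (bigD1 k) //=; congr (_ * _); apply: eq_bigl => l.
by rewrite ltn_neqAle andbC eq_sym.
Qed.

Lemma tail_prod_size : tail_prod p = 1.
Proof. by rewrite /tail_prod big1 // => k; rewrite leqNgt ltn_ord. Qed.

Definition num_res (d : nat) (a : 'rV[R]_r) : R :=
  res todd (pairing a ER) (ev num_lam (Dpoly phi true a P (tail_prod d))).

Lemma num_res_on_lines d : poly_on_lines (num_res d).
Proof.
move=> a b; have [q qE] := polyfam_res num_lam todd (pairing a ER) (pairing b ER)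
  (polyfam_Dpoly phi true a b P (tail_prod d)).
by exists q => t; rewrite -qE /num_res pairingD pairingZ.
Qed.

(** Dpoly_shift with H1 = Y_k H and H2 = (Y_k - 1) H, followed by num_lam; the two signs of
    <phi_k, E> use res_todd_rec in the two directions. *)
Lemma num_res_rec (k : 'I_p) a : num_res k a - num_res k (a - intrmx (phi k)) = num_res k.+1 a.
Proof.
rewrite /num_res pairingB pairing_int.
have := @Dpoly_shift R r p phi true k a P (Yvar k * tail_prod k.+1) ((Yvar k - 1) * tail_prod k.+1) isT
  (mulrCA _ _ _).
rewrite -tail_prodS mulrBl mul1r -tail_prodS linearB /=.
set G1 := Dpoly phi true a P (tail_prod k); set G2 := Dpoly _ _ _ _ _; set G3 := Dpoly _ _ _ _ _.
move=> /(congr1 (ev num_lam)); rewrite !evM !linearB /= ev1 evY.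
have X0 : 'X != 0 :> {poly R} by rewrite -size_poly_eq0 size_polyX.
set g1 := ev num_lam G1; set g2 := ev num_lam G2; set g3 := ev num_lam G3.
rewrite /num_lam; case: (Epm k) => -> /=; rewrite ?eqxx => h.
  have h3 : g3 = 'X * (g3 - (g1 - g2)).
    by rewrite mulrBr h; ring.
  have h1 : g1 - g2 = ('X - 1) * (g3 - (g1 - g2)).
    apply: (mulfI X0); rewrite h mulrCA; congr (_ * _); exact: h3.
  rewrite {1}h3 -res_todd_rec -h1 resB; ring.
have h1 : g1 - g2 = 'X * (g1 - g2 - g3).
  have : (1 - 'X) * (g1 - g2) = - 'X * g3 by rewrite h; ring.
  by move=> h'; rewrite [in RHS]mulrBr -[X in _ = _ - X]opprK -mulNr -h'; ring.
have h3 : g3 = ('X - 1) * (g1 - g2 - g3).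
  have h4 : 'X * g3 = ('X - 1) * (g1 - g2).
    by apply: oppr_inj; rewrite -mulNr -[RHS]mulNr opprB h; ring.
  by apply: (mulfI X0); rewrite h4 [in LHS]h1; ring.
rewrite [in LHS]h3 mulrN1z opprK res_todd_rec addrK -h1 resB; ring.
Qed.

Lemma num_lam_ok : lam_ok true num_lam.
Proof.
move=> k; exists 1; rewrite scale1r /riccati /num_lam; have -> : true%:R = 1 :> {poly R} by [].
by case: ifP => _ //; ring.
Qed.

(** Without denominators there is no pole. *)
Lemma num_res_size a : num_res p a = 0.
Proof.
have [c cE] := Dpoly1 phi true a P.
rewrite /num_res tail_prod_size cE linearZ /= ev1 resZ -polyC1 resC mulr0 //.
Qed.

Definition tail_at1 d : R := (ev num_lam (tail_prod d)).[1].
Definition tail_at0 d : R := (ev num_lam (tail_prod d)).[0].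

Lemma tail_at1S (k : 'I_p) : tail_at1 k = (pairing (phi k) E == 1)%:R * tail_at1 k.+1.
Proof.
rewrite /tail_at1 tail_prodS evM evY hornerM [num_lam k]/num_lam; case: eqP => _ /=; by rewrite !hornerE ?subrr ?mul0r.
Qed.

Lemma tail_at0S (k : 'I_p) : tail_at0 k = (pairing (phi k) E != 1)%:R * tail_at0 k.+1.
Proof.
rewrite /tail_at0 tail_prodS evM evY hornerM [num_lam k]/num_lam; case: eqP => _ /=; by rewrite !hornerE ?subr0 ?mul0r ?mul1r.
Qed.

(** On the wall j = 0, and all but the value at a of P is killed because riccati 'X vanishes
    at 0 and at 1. *)
Lemma num_res_wall d a : pairing a ER = 0 -> num_res d a = polyval P a * (tail_at1 d - tail_at0 d).
Proof.
move=> a0.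
rewrite /num_res a0 res_todd0; have [w ->] := ev_Dpoly_mod phi a P (tail_prod d) num_lam_ok.
rewrite /tail_at1 /tail_at0 /riccati; have -> : true%:R = 1 :> {poly R} by [].
by rewrite !hornerE; ring.
Qed.

(** On the wall itself, the coefficient of P is 1 or 0 according as all the remaining vectors
    are on the positive side or not; the recursion leaves no other choice. *)
Definition num_model (d : nat) (x : 'rV[int]_r) : R :=
  if 0 < pairing x E then num_res d (intrmx x)
  else if pairing x E == 0 then tail_at1 d * polyval P (intrmx x) else 0.

(** Only the steps which start or end on the wall are not instances of num_res_rec; there
    num_res_wall gives the missing values. *)
Lemma nabla_num_model (k : 'I_p) x : nabla (phi k) (num_model k) x = num_model k.+1 x.
Proof.
rewrite /nabla /num_model pairingB map_mxB -(num_res_rec k).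
have W y : pairing y E = 0 -> num_res k (intrmx y) = polyval P (intrmx y) * (tail_at1 k - tail_at0 k).
  by move=> h; apply: num_res_wall; rewrite pairing_int h.
have z1k := tail_at1S k; have z0k := tail_at0S k.
have Wk : pairing x E = 0 -> num_res k (intrmx x) - num_res k (intrmx x - intrmx (phi k)) =
     polyval P (intrmx x) * (tail_at1 k.+1 - tail_at0 k.+1).
  by move=> h; rewrite num_res_rec; apply: num_res_wall; rewrite pairing_int h.
have := W x; have := W (x - phi k); rewrite map_mxB pairingB.
case: (Epm k) z1k z0k => -> /=; rewrite ?eqxx ?mul1r ?mul0r => z1k z0k.
  move=> W1 W0; case: (ltrgtP (pairing x E) 0) => [h|h|h].
  - rewrite ifF; last by apply/negbTE; lia.
    by rewrite ifF ?subrr //; apply/negbTE; lia.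
  - case: (ltrP 0 (pairing x E - 1)) => h' //.
    have e : pairing x E - 1 = 0 by lia.
    by rewrite e eqxx W1 // z0k subr0; ring.
  - by rewrite h /= subr0 z1k.
move=> W1 W0; rewrite opprK; case: (ltrgtP (pairing x E) 0) => [h|h|h].
- rewrite ifF; last by apply/negbTE; lia.
  by case: ifP => _; rewrite ?z1k ?mul0r subrr.
- by rewrite ifT //; lia.
rewrite h add0r ltr01 z1k mul0r sub0r.
have := Wk h; rewrite W0 // z1k z0k => E0.
have : num_res k (intrmx x - intrmx (phi k)) = - (tail_at1 k.+1 * polyval P (intrmx x)).
  apply: oppr_inj; apply: (addrI (polyval P (intrmx x) * (0 - tail_at0 k.+1))).
  by rewrite E0; ring.
by move=> ->; rewrite opprK.
Qed.

Lemma nablas_num_model x : nablas S (num_model 0) x = num_model p x.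
Proof.
suff H m d : (d + m)%N = p -> nablas (drop d S) (num_model d) x = num_model p x.
  by rewrite -(H p 0%N) ?drop0.
elim: m d => [|m IH] d dm; first by rewrite addn0 in dm; rewrite dm drop_size.
have dp : (d < p)%N by lia.
rewrite (drop_nth 0) //= -(IH d.+1); last by lia.
by apply: eq_nablas => y; exact: (nabla_num_model (Ordinal dp)).
Qed.

End Discrete.

(** * The jump of the number of points *)

Section NumJump.
Context {R : realType}.
Local Notation intrmx := (map_mx (intr : int -> R)).

Lemma eventually_small r (b : 'rV[R]_r) (eps : R) : 0 < eps ->
  exists n0 : nat, forall n : nat, (n0 <= n)%N -> 0 < n%:R :> R /\ small (n%:R * eps) b.
Proof.
move=> e0; pose C := (1 + \sum_i `|b 0 i|) / eps.
exists (Num.truncn C).+1 => n hn.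
have Cn : C < n%:R by apply: lt_le_trans (truncnS_gt C) _; rewrite ler_nat.
have C0 : 0 < C by rewrite divr_gt0 // ltr_pwDl // sumr_ge0.
split; first exact: lt_trans Cn.
move: Cn; rewrite ltr_pdivrMr // => h i; apply: le_lt_trans h.
by rewrite (bigD1 i) //= addrCA lerDl addr_ge0 // sumr_ge0.
Qed.

Lemma intrmx_line r (a w : 'rV[int]_r) n :
  intrmx (a + w *+ n) = n%:R *: intrmx w + intrmx a :> 'rV[R]_r.
Proof. by rewrite map_mxD raddfMn /= -scaler_nat addrC. Qed.

Lemma nablas_num r (S T : seq 'rV[int]_r) (h : 'cV[R]_r) : half_space (S ++ T) h ->
  forall x, nablas S (fun x => (num_points (S ++ T) (intrmx x : 'rV[R]_r))%:R : R) x =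
    (num_points T (intrmx x : 'rV[R]_r))%:R.
Proof.
elim: S => [|phi S IH] //= hP x.
rewrite -IH; last by move=> psi hpsi; apply: hP; rewrite inE hpsi orbT.
apply: eq_nablas => y; rewrite /nabla map_mxB (num_points_cons _ hP) natrD.
by rewrite addrK.
Qed.

Lemma primitive_one r (E : 'cV[int]_r) : (0 < r)%N -> primitive E ->
  exists g : 'rV[int]_r, pairing g E = 1.
Proof.
case: r E => [|n] E //= _ /primitive_complete[M _ ME]; exists (row 0 M).
by rewrite /pairing rowE -mulmxA ME -rowE !mxE !eqxx.
Qed.

Section Main.
Variables (r : nat) (Phi : seq 'rV[int]_r) (E : 'cV[int]_r) (c1 c2 c12 : set 'rV[R]_r).
Local Notation ER := (intrmx E : 'cV[R]_r).
Local Notation Phi0 := [seq phi <- Phi | pairing phi E == 0].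
Let S := [seq phi <- Phi | pairing phi E != 0].
Hypotheses (Phi_gen : Zspan Phi = setT) (E_prim : primitive E)
    (W_wall : wall Phi (hyperplane R E)).

Lemma perm_walls : perm_eq Phi (S ++ Phi0).
Proof.
have <- : [seq phi <- Phi | predC (fun phi => pairing phi E != 0) phi] = Phi0.
  by apply: eq_filter => phi /=; rewrite negbK.
by rewrite perm_sym perm_filterC.
Qed.

Variables (h : 'cV[R]_r) (Phi_half : half_space Phi h).
Hypotheses (c1_chamber : chamber Phi c1) (c2_chamber : chamber Phi c2)
    (c1_c2_adj : adjacent_chambers Phi E c1 c2) (c12_chamber : chamber Phi0 c12)
    (c12_closure : closure c1 `&` closure c2 `&` hyperplane R E `<=` closure c12).

Lemma num_jump (k1 k2 k12 : 'rV[R]_r -> R) (K12 : mpoly.mpoly r R) :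
  unimodular R Phi ->
  is_num_poly Phi c1 k1 -> is_num_poly Phi c2 k2 -> is_num_poly Phi0 c12 k12 ->
  (forall a, hyperplane R E a -> polyval K12 a = k12 a) ->
  forall a, k1 a - k2 a = num_res E S K12 0 a.
Proof.
move=> uni hk1 hk2 hk12 K12E.
have full := @Zspan_Rspan R _ _ Phi_gen.
have [w [eps [eps0 wE cone]]] := local_cone full W_wall c1_chamber c2_chamber c1_c2_adj c12_chamber c12_closure.
have [nu [_ _ _ _ spanW]] := wall_Phi0 W_wall.
have [_ r0] := W_rank W_wall; have [g gE] := primitive_one r0 E_prim.
have Epm (k : 'I_(size S)) : pairing S`_k E = 1 \/ pairing S`_k E = -1.
  have := mem_nth 0 (ltn_ord k); rewrite mem_filter => /andP[kE kPhi].
  exact: unimodular_pm1 Phi_gen W_wall uni (primitive_one r0 E_prim) kPhi kE.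
have lines (k : 'rV[R]_r -> R) c : is_num_poly Phi c k -> poly_on_lines k.
  move=> [[P PE] _ _]; apply: (poly_on_lines_poly _ (poly_on_lines_polyval P)) => a.
  by rewrite PE ?full.
have polyl (F : 'rV[R]_r -> R) : poly_on_lines F -> poly_on_rays (fun x => F (intrmx x)).
  move=> hF a b; have [q qE] := hF (intrmx a) (intrmx b); exists q => n.
  by rewrite -qE intrmx_line addrC.
have l1 := lines _ _ hk1; have l2 := lines _ _ hk2.
have lQ := num_res_on_lines E S K12 0.
suff J (x : 'rV[int]_r) : k1 (intrmx x) - k2 (intrmx x) = num_res E S K12 0 (intrmx x).
  have := @poly_on_lines_int0 R r (fun a => k1 a - k2 a - num_res E S K12 0 a).
  move=> J'; move=> a; apply/eqP; rewrite -subr_eq0; apply/eqP; apply: J' => [|x].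
    by do 2! apply: poly_on_linesB => //.
  by rewrite J subrr.
pose e (x : 'rV[int]_r) : R := (pairing x E)%:~R.
pose f (x : 'rV[int]_r) : R := (num_points Phi (intrmx x : 'rV[R]_r))%:R.
have near_c c k y : is_num_poly Phi c k ->
    (forall T : R, 0 < T -> small (T * eps) (intrmx y : 'rV[R]_r) -> c (T *: intrmx w + intrmx y)) ->
    eventually0 w (fun x => f x - k (intrmx x)) y.
  move=> hk hc; have [n0 hn0] := eventually_small (intrmx y) eps0.
  exists n0 => n /hn0[n1 n2]; rewrite /f (num_poly_chamber hk) ?subrr //.
  by rewrite intrmx_line; exact: hc.
apply: (@wall_jump R _ w e _ _ S f (num_model E S K12 0) (fun x => k1 (intrmx x)) (fun x => k2 (intrmx x))
  (fun x => num_res E S K12 0 (intrmx x)) g) => //; try exact: polyl.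
- by move=> a b; rewrite /e pairingD intrD.
- by rewrite /e wE.
- by rewrite /e gE.
- by move=> d; rewrite mem_filter /e intr_eq0 => /andP[].
- move=> a a0; apply: (near_c c1 k1) => // T T0 bs.
  by have [q _ _] := cone T _ T0 bs; apply: q; rewrite pairing_int.
- move=> a a0; apply: (near_c c2 k2) => // T T0 bs.
  by have [_ q _] := cone T _ T0 bs; apply: q; rewrite pairing_int.
- by move=> a; rewrite /e /num_model ltrz0 => a0; rewrite ltNge ltW //= lt_eqF.
- by move=> a; rewrite /e /num_model ltr0z => ->.
move=> a; have hP : half_space (S ++ Phi0) h.
  by move=> psi; rewrite -(perm_mem perm_walls); exact: Phi_half.
apply: (@eq_eventually0 _ _ _ (fun x => (num_points Phi0 (intrmx x : 'rV[R]_r))%:R - num_model E S K12 (size S) x)).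
  move=> y; rewrite nablasB (nablas_num_model _ Epm) -(nablas_num hP); congr (_ - _).
  by apply: eq_nablas => u; rewrite /f (num_points_perm _ hP perm_walls).
have aw n : pairing (a + w *+ n) E = pairing a E.
  by rewrite pairingD; elim: n => [|n IH]; rewrite ?mulr0n ?pairing0 ?addr0 // mulrS pairingD wE add0r.
rewrite /num_model; have [a0|a0] := eqVneq (pairing a E) 0; last first.
  exists 0%N => n _; rewrite aw num_res_size (negPf a0) if_same subr0.
  rewrite num_points_out // => /cone_span; rewrite spanW /hyperplane /= pairing_int aw => /eqP.
  by rewrite intr_eq0 (negPf a0).
have [n0 hn0] := eventually_small (intrmx a) eps0.
exists n0 => n /hn0[n1 n2]; rewrite aw a0 ltxx eqxx.
have Wx : pairing (intrmx a : 'rV[R]_r) ER = 0 by rewrite pairing_int a0.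
have [_ _ /(_ Wx) cn] := cone _ _ n1 n2.
rewrite K12E; last by rewrite /hyperplane /= pairing_int aw a0.
rewrite (num_poly_chamber hk12); last by rewrite intrmx_line.
by rewrite /tail_at1 tail_prod_size ev1 hornerE mul1r subrr.
Qed.

End Main.
End NumJump.

Section Residue.
Context {R : realType}.
Local Notation intrmx := (map_mx (intr : int -> R)).

Lemma diffop_residue r (Phi : seq 'rV[int]_r) (E : 'cV[int]_r) (P : mpoly.mpoly r R) (kk : bool)
    (ser : nat -> R) (B F : R -> R) (lam : 'I_(size [seq phi <- Phi | pairing phi E != 0]) -> {poly R})
    (a : 'rV[R]_r) :
  let S := [seq phi <- Phi | pairing phi E != 0] in
  has_expansion ser B -> (\forall z \near 0^', F z = B z / z) ->
  (forall s : R, s != 0 -> is_derive s (1 : R) F (riccati kk (F s))) ->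
  (forall (k : 'I_(size S)) z, z != 0 -> F ((pairing S`_k E)%:~R * z) = (lam k).[F z]) ->
  has_residue0 (fun z => diffop P (fun x =>
      expR (pairing a (x + z *: intrmx E)) *
      \prod_(phi <- Phi | pairing phi E != 0) F (pairing (intrmx phi) (x + z *: intrmx E))) 0)
    (res ser (pairing a (intrmx E))
      (ev lam (Dpoly (fun k : 'I_(size S) => S`_k) kk a P (\prod_(k < size S) Yvar k)))).
Proof.
move=> S hB hF dF lamE; apply: (has_residue_res hB hF).
near=> z.
have z0 : z != 0 by near: z; exact: nbhs_dnbhs_neq.
have pE (k : 'I_(size S)) : pairing (intrmx S`_k) (z *: intrmx E) = (pairing S`_k E)%:~R * z.
  by rewrite -pairing_int /pairing -scalemxAr mxE mulrC.
rewrite (@diffop_eq R _ r (fun k : 'I_(size S) => S`_k) kk (intrmx E) a F dF lam z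
  (\prod_(k < size S) Yvar k) P _ (F z)) //.
- move=> k; rewrite pE mulf_neq0 // intr_eq0.
  by have := mem_nth 0 (ltn_ord k); rewrite mem_filter => /andP[].
- by move=> k; rewrite pE lamE.
move=> x _; rewrite /fH; congr (_ * _).
rewrite rmorph_prod -big_filter -/S (big_nth 0) big_mkord.
by apply: eq_bigr => k _; rewrite /Yvar /= mpoly.mevalXU.
Unshelve. all: by end_near. Qed.

Lemma is_derive_todd (s : R) : s != 0 ->
  is_derive s (1 : R) (fun z => (1 - expR (- z))^-1) (riccati true (1 - expR (- s))^-1).
Proof.
move=> s0; have d0 : 1 - expR (- s) != 0.
  by rewrite subr_eq0 eq_sym -expR0 (inj_eq (@expR_inj R)) oppr_eq0.
have dexp : is_derive s (1 : R) (fun z => expR (- z)) (- expR (- s)).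
  have dN : is_derive s (1 : R) (-%R : R -> R) (-1).
    by have := is_deriveN (is_derive_id s (1 : R)).
  have := @is_derive1_comp R expR -%R s (expR (- s)) (- 1) (is_derive_expR (- s)) dN.
  by rewrite mulrN1.
have d1 : is_derive s (1 : R) (fun z => 1 - expR (- z)) (expR (- s)).
  have := is_deriveB (is_derive_cst (1 : R) s (1 : R)) dexp.
  by rewrite sub0r opprK.
have := @is_deriveV R (fun z => 1 - expR (- z)) s _ 1 d0 d1.
suff -> : - (1 - expR (- s)) ^- 2 *: expR (- s) = riccati true (1 - expR (- s))^-1 by [].
rewrite /riccati /GRing.scale /= -[X in _ * X = _](subKr 1) mul1r.
by move: (1 - expR (- s)) d0 => y y0; field.
Qed.

Lemma num_residue r (Phi : seq 'rV[int]_r) (E : 'cV[int]_r) (P : mpoly.mpoly r R) (a : 'rV[R]_r) :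
  let S := [seq phi <- Phi | pairing phi E != 0] in
  (forall k : 'I_(size S), pairing S`_k E = 1 \/ pairing S`_k E = -1) ->
  has_residue0 (fun z => diffop P (fun x =>
      expR (pairing a (x + z *: intrmx E)) /
      \prod_(phi <- Phi | pairing phi E != 0)
         (1 - expR (- pairing (intrmx phi) (x + z *: intrmx E)))) 0)
    (num_res E S P 0 a).
Proof.
move=> S Epm; have [B hB hF] := @has_expansion_todd R.
have := @diffop_residue r Phi E P true _ B _ (@num_lam R r E S) a hB hF is_derive_todd.
rewrite /num_res /tail_prod => /(_ _).
have -> : (fun z => diffop P (fun x =>
      expR (pairing a (x + z *: intrmx E)) *
      \prod_(phi <- Phi | pairing phi E != 0)
         (1 - expR (- pairing (intrmx phi) (x + z *: intrmx E)))^-1) 0) =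
  (fun z => diffop P (fun x =>
      expR (pairing a (x + z *: intrmx E)) /
      \prod_(phi <- Phi | pairing phi E != 0)
         (1 - expR (- pairing (intrmx phi) (x + z *: intrmx E)))) 0).
  apply/funext => z; congr (diffop _ _ _); apply/funext => x; congr (_ * _).
  by rewrite prodfV.
apply=> k z z0; rewrite /num_lam -/S.
case: (Epm k) => -> /=; rewrite ?eqxx ?mul1r ?hornerE // mulN1r opprK.
have [d0 d1] : 1 - expR z != 0 /\ 1 - expR (- z) != 0.
  by split; rewrite subr_eq0 eq_sym -expR0 (inj_eq (@expR_inj R)) ?oppr_eq0.
have e0 := expR_gt0 z.
move: d1; rewrite expRN => d1; field.
by rewrite (lt0r_neq0 e0) d0 /= andbT -[expR z - 1]opprB oppr_eq0.
Qed.

End Residue.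

(** * Integrals of piecewise polynomial functions *)

Section HasIntegral.
Context {R : realType}.
Local Notation mu := (@lebesgue_measure R).
Local Notation RM := (measurableTypeR R).
Implicit Types (D A B : set RM) (v f g : R -> R).

(** Integrability and value in a single statement, so that no integral has to be split
    before it is known to exist. *)
Definition has_integral D v (I : R) :=
  mu.-integrable D (EFin \o v) /\ (\int[mu]_(x in D) (v x)%:E = I%:E)%E.

Lemma has_integral_uniq D v I I' : has_integral D v I -> has_integral D v I' -> I = I'.
Proof. by move=> [_ e] [_ e']; apply: EFin_inj; rewrite -e. Qed.

Lemma has_integralB D f g I I' : measurable D ->
  has_integral D f I -> has_integral D g I' -> has_integral D (fun x => f x - g x) (I - I').
Proof.
move=> mD [f1 f2] [g1 g2]; split.
  by have := integrableB mD f1 g1.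
by under eq_integral do rewrite EFinB; rewrite integralB // f2 g2.
Qed.

Lemma eq_has_integral D f g I : measurable D -> (forall x, D x -> f x = g x) ->
  has_integral D f I -> has_integral D g I.
Proof.
move=> mD fg [h1 h2]; split.
  by apply: eq_integrable h1 => // x; rewrite inE => /fg /= ->.
by rewrite -h2; apply: eq_integral => x; rewrite inE => /fg ->.
Qed.

Lemma has_integral0 D : measurable D -> has_integral D (fun=> 0) 0.
Proof.
move=> mD; split; last by rewrite integral0.
exact: integrable0.
Qed.

Lemma has_integral_set1 a v : has_integral [set a] v 0.
Proof.
split; last by rewrite integral_set1.
apply/integrableP; split; first exact: measurable_fun_set1.
by rewrite integral_set1.
Qed.

Lemma has_integralU A B v I I' : measurable A -> measurable B -> A `&` B = set0 ->
  has_integral A v I -> has_integral B v I' -> has_integral (A `|` B) v (I + I').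
Proof.
move=> mA mB AB [h1 h2] [h3 h4].
have dAB : [disjoint A & B] by apply/eqP.
have m : measurable_fun (A `|` B) (EFin \o v).
  by apply/measurable_funU => //; split; [have /integrableP[] := h1|have /integrableP[] := h3].
have i : mu.-integrable (A `|` B) (EFin \o v).
  apply/integrableP; split => //.
  rewrite ge0_integral_setU //; last exact: measurableT_comp.
  by rewrite lte_add_pinfty //; [have /integrableP[] := h1|have /integrableP[] := h3].
split => //; rewrite EFinD -h2 -h4; apply: integral_setU_EFin => //.
exact/measurable_EFinP.
Qed.

Lemma has_integralS D D' v I : measurable D -> measurable D' -> D' `<=` D ->
  has_integral D v I -> exists I', has_integral D' v I'.
Proof.
move=> mD mD' sub [h1 _]; have i : mu.-integrable D' (EFin \o v) by exact: integrableS h1.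
exists (fine (\int[mu]_(x in D') (v x)%:E)); split => //.
by rewrite fineK //; exact: integrable_fin_num.
Qed.

Lemma has_integral_poly (a b : R) v (P : {poly R}) : a < b ->
  (forall t, a < t < b -> v t = (P^`()).[t]) ->
  has_integral `]a, b[%classic v (P.[b] - P.[a]).
Proof.
move=> ab vP; apply: (@eq_has_integral _ (fun t => (P^`()).[t])) => //.
  by move=> t /=; rewrite in_itv /= => /vP ->.
have cP (Q : {poly R}) : continuous (fun t : R => Q.[t]) by move=> t; exact: continuous_horner.
have i : mu.-integrable `[a, b]%classic (EFin \o (fun t => (P^`()).[t])).
  apply: continuous_compact_integrable; first exact: segment_compact.
  by apply: continuous_subspaceT; exact: cP.
split; first by apply: integrableS i => //; exact: subset_itv_oo_cc.
transitivity (\int[mu]_(x in `[a, b]) ((P^`()).[x])%:E)%E.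
  rewrite integral_itv_bndo_bndc; last first.
    by apply/measurable_EFinP; apply: measurable_funTS; apply: continuous_measurable_fun; exact: cP.
  rewrite integral_itv_obnd_cbnd //.
  by apply/measurable_EFinP; apply: measurable_funTS; apply: continuous_measurable_fun; exact: cP.
rewrite (@continuous_FTC2 _ _ (fun t => P.[t])) ?EFinB //.
- by apply: continuous_subspaceT; exact: cP.
- split; first by move=> x _; exact: derivable_horner.
    by apply: cvg_at_right_filter; exact: cP.
  by apply: cvg_at_left_filter; exact: cP.
by move=> x _; rewrite derivE.
Qed.

Lemma has_integral_cat (a t b : R) v I I' : a < t < b ->
  has_integral `]a, t[%classic v I -> has_integral `]t, b[%classic v I' ->
  has_integral `]a, b[%classic v (I + I').
Proof.
move=> /andP[at_ tb] h1 h2.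
have -> : `]a, b[%classic = `]a, t[%classic `|` ([set t] `|` `]t, b[%classic) :> set R.
  apply/seteqP; split => x /=; rewrite !in_itv /=.
    by move=> /andP[h3 h4]; case: (ltgtP x t) => h; [left|right;right|right;left]; rewrite ?h3 ?h4.
  move=> [/andP[h3 h4]|[->|/andP[h3 h4]]]; rewrite ?at_ ?tb ?h3 ?h4 ?andbT //.
    exact: lt_trans tb.
  exact: lt_trans h3.
apply: has_integralU => //.
- by apply: measurableU.
- apply/seteqP; split => x //=; rewrite !in_itv /= => -[/andP[h3 h4] [h5|/andP[h5 h6]]].
    by rewrite h5 ltxx in h4.
  by have := lt_trans h4 h5; rewrite ltxx.
rewrite -[I']add0r; apply: has_integralU => //; last exact: has_integral_set1.
by apply/seteqP; split => x //= [->]; rewrite in_itv /= ltxx.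
Qed.

(** v is the derivative of P where e0 + t e1 > 0, it is 0 where e0 + t e1 < 0, and P vanishes
    at the point of change; the value of v at this point is immaterial. *)
Lemma has_integral_half (e0 e1 : R) v (P : {poly R}) : e1 != 0 ->
  (forall t, e0 + t * e1 = 0 -> P.[t] = 0) ->
  (forall t, 0 < e0 + t * e1 -> v t = (P^`()).[t]) ->
  (forall t, e0 + t * e1 < 0 -> v t = 0) ->
  has_integral `]0, 1[%classic v
    ((0 < e0 + e1)%R%:R * P.[1] - (0 < e0)%R%:R * P.[0]).
Proof.
move=> e10 P0 vP v0.
pose H (a b : R) := has_integral `]a, b[%classic v
   ((0 < e0 + b * e1)%R%:R * P.[b] - (0 < e0 + a * e1)%R%:R * P.[a]).
suff : H 0 1 by rewrite /H mul0r addr0 mul1r.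
have pos a b : a < b -> 0 <= e0 + a * e1 -> 0 <= e0 + b * e1 -> H a b.
  move=> ab ha hb.
  have Hx x : 0 <= e0 + x * e1 -> (0 < e0 + x * e1)%R%:R * P.[x] = P.[x].
    rewrite le_eqVlt => /orP[/eqP e|->]; last by rewrite mul1r.
    by rewrite P0 ?mulr0.
  rewrite /H !Hx //; apply: has_integral_poly => // t /andP[at_ tb]; apply: vP.
  rewrite lt_neqAle eq_sym; apply/andP; split; last first.
    by case: (ltrgtP e1 0) e10 => // e1s _; nra.
  by apply/eqP => e; case: (ltrgtP e1 0) e10 => // e1s _; nra.
have neg a b : a < b -> e0 + a * e1 <= 0 -> e0 + b * e1 <= 0 -> H a b.
  move=> ab ha hb; rewrite /H !ltNge ha hb /= !mul0r subrr.
  apply: (@eq_has_integral _ (fun=> 0)) => //; last exact: has_integral0.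
  move=> t /=; rewrite in_itv /= => /andP[at_ tb]; rewrite v0 //.
  rewrite lt_neqAle; apply/andP; split; last first.
    by case: (ltrgtP e1 0) e10 => // e1s _; nra.
  by apply/eqP => e; case: (ltrgtP e1 0) e10 => // e1s _; nra.
have cat a t b : a < t < b -> H a t -> H t b -> H a b.
  move=> atb h1 h2; have := has_integral_cat atb h1 h2; rewrite /H.
  by rewrite addrC addrA subrK.
have [p0|n0] := lerP 0 (e0 + 0 * e1); have [p1|n1] := lerP 0 (e0 + 1 * e1).
- exact: pos.
- have [z|nz] := eqVneq (e0 + 0 * e1) 0; first by apply: neg; rewrite ?ltr01 ?z // ltW.
  have {nz}p0 : 0 < e0 + 0 * e1 by rewrite lt_neqAle eq_sym nz.
  pose t := - e0 / e1; have et : e0 + t * e1 = 0 by rewrite /t divfK // subrr.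
  by apply: (@cat _ t); [apply/andP; split; nra|apply: pos; rewrite ?et //; nra|apply: neg; rewrite ?et // ?ltW //; nra].
- have [z|nz] := eqVneq (e0 + 1 * e1) 0; first by apply: neg; rewrite ?ltr01 ?z // ltW.
  have {nz}p1 : 0 < e0 + 1 * e1 by rewrite lt_neqAle eq_sym nz.
  pose t := - e0 / e1; have et : e0 + t * e1 = 0 by rewrite /t divfK // subrr.
  by apply: (@cat _ t); [apply/andP; split; nra|apply: neg; rewrite ?et // ?ltW //; nra|apply: pos; rewrite ?et //; nra].
- by apply: neg; rewrite ?ltr01 // ltW.
Qed.

End HasIntegral.

(** * Volumes and differences *)

Section VolNabla.
Context {R : realType}.
Local Notation mu := (@lebesgue_measure R).
Local Notation RM := (measurableTypeR R).
Local Notation intrmx := (map_mx (intr : int -> R)).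

Lemma vol_ge0 r (Phi : seq 'rV[int]_r) (a : 'rV[R]_r) : 0 <= vol Phi a.
Proof.
rewrite /vol mulr_ge0 // fine_ge0 // lebesgue_rVE iint_ge0 //.
Qed.

Lemma measurable_vol_line r (Phi : seq 'rV[int]_r) (h : 'cV[R]_r) (a p : 'rV[R]_r) :
  Rspan R Phi = setT -> half_space Phi h ->
  measurable_fun [set: RM] (fun x : RM => vol Phi (a - (x : R) *: p)).
Proof.
move=> full hP; have rA := rank_full full.
set A := rseqmx R Phi in rA *.
have fA : row_full A by rewrite /row_full rA.
have inA (y : 'rV[R]_r) : y *m pinvmx A *m A = y by rewrite -mulmxA mulVpmx ?mulmx1.
have H : (r + \rank (kermx A))%N = size Phi by rewrite -{1}rA rank_add_ker.
pose K : 'M[R]_(\rank (kermx A), _) := row_base (kermx A).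
have KA : K *m A = 0 by apply/sub_kermxP; rewrite eq_row_base.
have freeK : row_free K by exact: row_base_free.
rewrite (_ : (fun x => _) = fine \o (fun x : RM =>
    mvol H (pinvmx A) K (a *m pinvmx A - (x : R) *: (p *m pinvmx A)))); last first.
  apply/funext => x /=; apply: (vol_eq1 H) => //; first by rewrite mulVpmx.
  by rewrite mulmxBl -scalemxAl !inA.
apply: measurableT_comp => //; rewrite /mvol.
by apply: emeasurable_funM => //; exact: measurable_leb_line.
Qed.

(** Both volumes are integrals of the same function on half-lines, from 0 and from 1. *)
Lemma vol_nabla r (phi : 'rV[int]_r) Phi (h : 'cV[R]_r) (a : 'rV[R]_r) : Rspan R Phi = setT ->
  half_space (phi :: Phi) h ->
  has_integral `]0, 1[%classic (fun t => vol Phi (a - t *: intrmx phi))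
    (vol (phi :: Phi) a - vol (phi :: Phi) (a - intrmx phi)).
Proof.
move=> full hP; have hP0 : half_space Phi h by move=> psi i; apply: hP; rewrite inE i orbT.
pose g (b : 'rV[R]_r) (x : R) := vol Phi (b - x *: intrmx phi).
have mg b : measurable_fun [set: RM] (g b) by exact: measurable_vol_line hP0.
have g0 b x : 0 <= g b x by exact: vol_ge0.
have I0 b : (\int[mu]_(x in `[0%R, +oo[) (g b x)%:E = (vol (phi :: Phi) b)%:E)%E.
  rewrite (vol_cons_same b full hP) integral_mkcond; apply: eq_integral => x _.
  rewrite patchE indicE; case: (x \in _); rewrite ?mul1e ?mul0e //.
have J D b I : measurable D -> (\int[mu]_(x in D) (g b x)%:E = I%:E)%E -> has_integral D (g b) I.
  move=> mD DI; split => //; apply/integrableP; split.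
    by apply/measurable_EFinP; apply: measurable_funTS.
  under eq_integral do rewrite /= ger0_norm //.
  by rewrite DI ltry.
have h0 := J _ _ _ (measurable_itv _) (I0 a).
have h1 : has_integral `[1%R, +oo[%classic (g a) (vol (phi :: Phi) (a - intrmx phi)).
  apply: J => //; rewrite -I0 [LHS]integral_mkcond [RHS]integral_mkcond.
  rewrite -[LHS](@ge0_integralD_shift _ _ 1).
  - apply: eq_integral => x _; rewrite !patchE.
    have -> : (x + 1 \in `[1, +oo[%classic) = (x \in `[0, +oo[%classic).
      by apply/idP/idP; rewrite !inE /= !in_itv /= !andbT lerDr.
    case: ifP => // _; rewrite /g scalerDl scale1r opprD addrA.
    by rewrite addrAC.
  - apply/(measurable_restrictT _ _).1 => //.
    apply/measurable_EFinP; apply: measurable_funTS; exact: mg.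
  - by move=> x; rewrite patchE; case: ifP => // _; rewrite lee_fin.
have [I hI] : exists I, has_integral `]0, 1[%classic (g a) I.
  apply: has_integralS h0 => // x /=; rewrite !in_itv /= => /andP[/ltW ->] //.
suff -> : vol (phi :: Phi) a - vol (phi :: Phi) (a - intrmx phi) = I by [].
apply/eqP; rewrite subr_eq; apply/eqP; rewrite -[I]add0r -addrA.
have hs := @has_integral_set1 R 0 (g a).
have m1 : measurable (`[1%R, +oo[%classic : set RM) by [].
have u1 : has_integral (`]0, 1[%classic `|` `[1%R, +oo[%classic) (g a) 
   (I + vol (phi :: Phi) (a - intrmx phi)).
  apply: has_integralU => //; apply/seteqP; split => x //=; rewrite !in_itv /= andbT.
  by move=> [/andP[_ h2] h3]; move: h2; rewrite ltNge h3.
apply: (has_integral_uniq h0).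
have -> : `[0%R, +oo[%classic = [set 0%R] `|` (`]0, 1[%classic `|` `[1%R, +oo[%classic) :> set R.
  apply/seteqP; split => x /=; rewrite !in_itv /= !andbT.
    rewrite le_eqVlt => /orP[/eqP <-|x0]; first by left.
    by right; have [|] := ltrP x 1; [left; rewrite x0|right].
  by move=> [->|[/andP[/ltW]|]] // x1; exact: le_trans x1.
apply: has_integralU => //; first exact: measurableU.
apply/seteqP; split => x //=; rewrite !in_itv /= !andbT => -[->].
by rewrite ltxx => -[|]; rewrite ?ler10.
Qed.

End VolNabla.

(** * The model of the jump for volumes *)

Section Continuous.
Context {R : realType}.
Variables (r : nat) (E : 'cV[int]_r) (S : seq 'rV[int]_r) (P : mpoly.mpoly r R).
Local Notation intrmx := (map_mx (intr : int -> R)).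
Local Notation ER := (intrmx E : 'cV[R]_r).
Local Notation p := (size S).
Let phi (k : 'I_p) : 'rV[int]_r := S`_k.
Let e (k : 'I_p) : R := (pairing (phi k) E)%:~R.

Hypothesis E0 : forall k, e k != 0.

Definition vol_lam (k : 'I_p) : {poly R} := ((pairing S`_k E)%:~R)^-1 *: 'X.

Definition vol_res (d : nat) (a : 'rV[R]_r) : R :=
  res oneser (pairing a ER) (ev vol_lam (Dpoly phi false a P (tail_prod S d))).

Lemma vol_res_on_lines d : poly_on_lines (vol_res d).
Proof.
move=> a b; have [q qE] := polyfam_res vol_lam oneser (pairing a ER) (pairing b ER)
  (polyfam_Dpoly phi false a b P (tail_prod S d)).
by exists q => t; rewrite -qE /vol_res pairingD pairingZ.
Qed.

Lemma vol_res_line (k : 'I_p) a : exists q : {poly R},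
  (forall t, vol_res k (a + t *: intrmx (phi k)) = q.[t]) /\
  (forall t, vol_res k.+1 (a + t *: intrmx (phi k)) = q^`().[t]).
Proof.
have [q [q1 q2]] := thetapair_res (lam := vol_lam) (pairing a ER) (E0 k) (erefl _)
  (@thetapair_Dpoly R r p phi false k a P (tail_prod S k.+1) isT).
by exists q; split => t; [rewrite -q1 -tail_prodS|rewrite -q2]; rewrite /vol_res pairingD pairingZ pairing_int.
Qed.

Lemma vol_res_size a : vol_res p a = 0.
Proof.
have [c cE] := Dpoly1 phi false a P.
by rewrite /vol_res tail_prod_size cE linearZ /= ev1 resZ -polyC1 resC mulr0.
Qed.

Definition tail_coef1 d : R := (ev vol_lam (tail_prod S d))`_1.

Lemma tail_coef1S (k : 'I_p) : tail_coef1 k = if k.+1 == p then (e k)^-1 else 0.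
Proof.
rewrite /tail_coef1 tail_prodS evM evY [vol_lam k]/vol_lam -scalerAl coefZ coefXM /=.
case: eqP => [->|/eqP kp]; first by rewrite tail_prod_size ev1 coef1 mulr1.
have k1 : (k.+1 < p)%N by rewrite ltn_neqAle kp ltn_ord.
rewrite (tail_prodS (Ordinal k1)) evM evY [vol_lam _]/vol_lam -scalerAl coefZ coefXM /= mulr0 mulr0 //.
Qed.

(** On the wall j = 0 and the residue is the coefficient of 'X, to which the multiples of
    riccati 'X = - 'X^2 do not contribute. *)
Lemma vol_res_wall d a : pairing a ER = 0 -> vol_res d a = polyval P a * tail_coef1 d.
Proof.
move=> a0.
have lok : lam_ok false vol_lam.
  move=> k; exists ((pairing S`_k E)%:~R ^- 2); rewrite /riccati /vol_lam !mul0r !sub0r.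
  by rewrite -scalerAl -scalerAr scalerA scalerN expr2 invfM.
rewrite /vol_res a0 res_oneser0; have [w ->] := ev_Dpoly_mod phi a P (tail_prod S d) lok.
rewrite coefD coefZ /riccati mul0r sub0r mulNr coefN -mulrA coefXM coefXM /= oppr0 addr0 //.
Qed.

(** By vol_res_size the derivative along the last vector vanishes. *)
Lemma vol_res_last (k : 'I_p) a t : k.+1 = p -> vol_res k (a + t *: intrmx (phi k)) = vol_res k a.
Proof.
move=> kp; have [q [q1 q2]] := vol_res_line k a.
have q0 : q^`() = 0 by apply: (@poly_ev0 _ _ 0) => n _; rewrite -q2 kp vol_res_size.
have qc : q = (q`_0)%:P.
  apply/polyP => -[|i]; rewrite coefC //=.
  have := congr1 (fun u : {poly R} => u`_i) q0; rewrite coef_deriv coef0 => /eqP.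
  by rewrite mulrn_eq0 => /eqP.
by rewrite q1 -[a in RHS]addr0 -(scale0r (intrmx (phi k))) q1 qc !hornerC.
Qed.

(** On the wall the residue vanishes unless a single vector is left.  In this case the side
    to which the wall belongs is chosen so that the difference with the volume is
    constant along that vector. *)
Definition vol_model (d : nat) (a : 'rV[R]_r) : R :=
  if (if (d.+1 == p) && (0 < pairing S`_d E) then 0 <= pairing a ER else 0 < pairing a ER)
  then vol_res d a else 0.

Lemma vol_model_pos d a : 0 < pairing a ER -> vol_model d a = vol_res d a.
Proof. by move=> h; rewrite /vol_model h (ltW h) if_same. Qed.

Lemma vol_model_neg d a : pairing a ER < 0 -> vol_model d a = 0.
Proof. by move=> h; rewrite /vol_model leNgt h [0 < pairing a _]ltNge (ltW h) /= if_same. Qed.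

(** The derivative of vol_res k along phi_k is vol_res k.+1, and vol_res k vanishes on the
    wall as long as another vector follows. *)
Lemma has_integral_vol_model (k : 'I_p) a : (k.+1 < p)%N ->
  has_integral `]0, 1[%classic (fun t => vol_model k.+1 (a - t *: intrmx (phi k)))
    (vol_model k a - vol_model k (a - intrmx (phi k))).
Proof.
move=> kp; have [q [q1 q2]] := vol_res_line k a.
pose Q := - (q \Po (- 'X)).
have QE t : Q.[t] = - vol_res k (a - t *: intrmx (phi k)).
  by rewrite -scaleNr q1 /Q !hornerE horner_comp !hornerE.
have Q'E t : (Q^`()).[t] = vol_res k.+1 (a - t *: intrmx (phi k)).
  rewrite -scaleNr q2 /Q derivN deriv_comp derivN derivX mulrN mulr1 opprK.
  by rewrite horner_comp !hornerE.
have pE t : pairing (a - t *: intrmx (phi k)) ER = pairing a ER + t * - e k.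
  by rewrite pairingB pairingZ pairing_int mulrN.
have := @has_integral_half R (pairing a ER) (- e k)
  (fun t => vol_model k.+1 (a - t *: intrmx (phi k))) Q.
rewrite oppr_eq0 !QE scale0r scale1r subr0 !mulrN opprK.
have AE b : vol_model k b = (0 < pairing b ER)%R%:R * vol_res k b.
  by rewrite /vol_model (ltn_eqF kp) /=; case: ifP => _; rewrite ?mul1r ?mul0r.
rewrite !AE pairingB pairing_int addrC => h; apply: h => [||t|t]; rewrite ?E0 //.
- move=> t t0; rewrite QE vol_res_wall ?pE // tail_coef1S (ltn_eqF kp) mulr0 oppr0 //.
- by move=> t0; rewrite Q'E vol_model_pos // pE.
- by move=> t0; rewrite vol_model_neg // pE.
Qed.

End Continuous.

(** * The jump of the volume *)

Section VolJump.
Context {R : realType}.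
Local Notation intrmx := (map_mx (intr : int -> R)).

(** The integrals over segments commute with translations. *)
Lemma has_integral_nablas r (ds : seq 'rV[R]_r) (f : 'rV[R]_r) (g G : 'rV[R]_r -> R) :
  (forall a, has_integral `]0, 1[%classic (fun t => g (a - t *: f)) (G a)) ->
  forall a, has_integral `]0, 1[%classic (fun t => nablas ds g (a - t *: f)) (nablas ds G a).
Proof.
elim: ds g G => [|d ds IH] g G hg a //=; apply: IH => {}a; rewrite /nabla.
apply: (@eq_has_integral _ _ (fun t => g (a - t *: f) - g (a - d - t *: f))) => //.
  by move=> t _; rewrite addrAC.
exact: has_integralB.
Qed.

(** The uniformity permits to integrate germs over segments. *)
Definition uniformly0 r (w : 'rV[R]_r) (g : 'rV[R]_r -> R) := forall B, exists n0 : nat,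
  forall n, (n0 <= n)%N -> forall a, small B a -> g (a + w *+ n) = 0.

Lemma small_bound r (a : 'rV[R]_r) : exists2 B : R, 0 < B & small B a.
Proof.
exists (1 + \sum_i `|a 0 i|); first by rewrite ltr_pwDl // sumr_ge0.
by move=> i; rewrite (bigD1 i) //= addrCA ltrDl ltr_pwDl // sumr_ge0.
Qed.

Lemma smallD r (a b : 'rV[R]_r) B C : small B a -> small C b -> small (B + C) (a + b).
Proof. by move=> ha hb i; rewrite mxE; apply: le_lt_trans (ler_normD _ _) _; rewrite ltrD. Qed.

Lemma smallN r (a : 'rV[R]_r) B : small B a -> small B (- a).
Proof. by move=> ha i; rewrite mxE normrN. Qed.

Lemma smallZ r (a : 'rV[R]_r) B t c : 0 <= B -> `|t| <= c -> small B a -> small (c * B + 1) (t *: a).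
Proof.
move=> B0 tc ha i; rewrite mxE normrM; apply: (@le_lt_trans _ _ (c * B)); last by rewrite ltrDl.
by apply: ler_pM => //; exact: ltW.
Qed.

Lemma uniformly0_step r (w f : 'rV[R]_r) ds g G :
  (forall a, has_integral `]0, 1[%classic (fun t => g (a - t *: f)) (G a)) ->
  uniformly0 w (nablas ds g) -> uniformly0 w (nablas ds G).
Proof.
move=> hg hz B; have [C C0 fC] := small_bound f.
have [n0 hn0] := hz (B + (1 * C + 1)); exists n0 => n /hn0 h a aB.
apply: (has_integral_uniq (has_integral_nablas ds hg (a + w *+ n))).
apply: (@eq_has_integral _ _ (fun=> 0)) => //; last exact: has_integral0.
move=> t /=; rewrite in_itv /= => /andP[t0 t1]; rewrite addrAC h //.
by apply: smallD => //; apply: smallN; apply: smallZ => //; rewrite ?(ltW C0) // gtr0_norm // ltW.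
Qed.

Lemma uniformly0_eventually0 r (w : 'rV[R]_r) g a : uniformly0 w g -> eventually0 w g a.
Proof. by move=> hz; have [B B0 aB] := small_bound a; have [n0 h] := hz B; exists n0 => n /h; exact. Qed.

Lemma vol_poly_chamber r (Phi : seq 'rV[int]_r) c v (a : 'rV[R]_r) : is_vol_poly Phi c v ->
  c a -> v a = vol Phi a.
Proof.
move=> [_ v0 vE] ca; have [e|ne] := pselect (c = exterior R Phi); last first.
  by apply: vE => //; exact: subset_closure.
by move: ca; rewrite e => -[sa na]; rewrite (v0 e) // vol_out.
Qed.

Lemma span_full r (T U : seq 'rV[int]_r) (E : 'cV[int]_r) phi :
  Rspan R T = hyperplane R E -> \rank (rseqmx R T) = r.-1 -> {subset T <= U} ->
  phi \in U -> pairing phi E != 0 -> Rspan R U = setT.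
Proof.
move=> TE rT TU phiU phiE; have le := @Rspan_le R _ _ _ TU.
apply/seteqP; split => // x _; rewrite /Rspan /=; apply: submx_full.
suff lt : (r.-1 < \rank (rseqmx R U))%N.
  rewrite /row_full; apply/eqP.
  by have := rank_leq_col (rseqmx R U); move: lt; clear; lia.
rewrite -rT ltnNge; apply: contra phiE => ge.
have {}ge : (rseqmx R U <= rseqmx R T)%MS by rewrite -(mxrank_leqif_sup le) eqn_leq ge mxrankS.
have : Rspan R T (intrmx phi).
  by apply: submx_trans ge; apply: Rspan_in.
by rewrite TE /hyperplane /= pairing_int => /eqP; rewrite intr_eq0.
Qed.

Lemma vol_cons_wall_gen r (E : 'cV[int]_r) (psi : 'rV[int]_r) (T : seq 'rV[int]_r) : (0 < r)%N ->
  primitive E -> Rspan R T = hyperplane R E -> \rank (rseqmx R T) = r.-1 -> pairing psi E != 0 ->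
  forall a : 'rV[R]_r, let x := pairing a (intrmx E) / (pairing psi E)%:~R in
  vol (psi :: T) a = (0 <= x)%R%:R * vol T (a - x *: intrmx psi) / `|(pairing psi E)%:~R|.
Proof. by case: r E psi T => // n E psi T _ pE TE rT pe a; exact: vol_cons_wall. Qed.

Section Main.
Variables (r : nat) (Phi : seq 'rV[int]_r) (E : 'cV[int]_r) (c1 c2 c12 : set 'rV[R]_r).
Local Notation ER := (intrmx E : 'cV[R]_r).
Local Notation Phi0 := [seq phi <- Phi | pairing phi E == 0].
Let S := [seq phi <- Phi | pairing phi E != 0].
Hypotheses (Phi_gen : Zspan Phi = setT) (E_prim : primitive E)
    (W_wall : wall Phi (hyperplane R E)).
Variables (h : 'cV[R]_r) (Phi_half : half_space Phi h).
Hypotheses (c1_chamber : chamber Phi c1) (c2_chamber : chamber Phi c2)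
    (c1_c2_adj : adjacent_chambers Phi E c1 c2) (c12_chamber : chamber Phi0 c12)
    (c12_closure : closure c1 `&` closure c2 `&` hyperplane R E `<=` closure c12).

Lemma vol_jump (v1 v2 v12 : 'rV[R]_r -> R) (V12 : mpoly.mpoly r R) :
  is_vol_poly Phi c1 v1 -> is_vol_poly Phi c2 v2 -> is_vol_poly Phi0 c12 v12 ->
  (forall a, hyperplane R E a -> polyval V12 a = v12 a) ->
  forall a, v1 a - v2 a = vol_res E S V12 0 a.
Proof.
move=> hv1 hv2 hv12 V12E.
have full := @Zspan_Rspan R _ _ Phi_gen.
have [w [eps [eps0 wE cone]]] := local_cone full W_wall c1_chamber c2_chamber c1_c2_adj c12_chamber c12_closure.
have [nu [_ _ _ _ spanW]] := wall_Phi0 W_wall.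
have [rankW r0] := W_rank W_wall; have [g gE] := primitive_one r0 E_prim.
have E0 (k : 'I_(size S)) : (pairing S`_k E)%:~R != 0 :> R.
  by have := mem_nth 0 (ltn_ord k); rewrite mem_filter intr_eq0 => /andP[].
pose W : 'rV[R]_r := intrmx w.
have WE : pairing W ER = 0 by rewrite pairing_int wE.
have WnE a n : pairing (a + W *+ n) ER = pairing a ER.
  by rewrite pairingD -scaler_nat pairingZ WE mulr0 addr0.
pose f d := vol (drop d S ++ Phi0) : 'rV[R]_r -> R.
pose Err d a := f d a - vol_model E S V12 d a.
pose phiR d : 'rV[R]_r := intrmx S`_d.
have hspd d : half_space (drop d S ++ Phi0) h.
  move=> psi; rewrite mem_cat => /orP[/mem_drop|]; rewrite mem_filter => /andP[_]; exact: Phi_half.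
have pE : (0 < size S)%N.
  rewrite lt0n; apply/eqP => /size0nil Snil.
  have := full; have := perm_walls Phi E; rewrite -/S Snil /= => pe full'.
  have gW : Rspan R Phi0 (intrmx g).
    have : Rspan R Phi (intrmx g) by rewrite full'.
    rewrite /Rspan /= => /submx_trans; apply; apply: Rspan_le => x.
    by rewrite (perm_mem pe).
  move: gW; rewrite spanW /hyperplane /= pairing_int gE => /eqP; rewrite intr_eq0 //.
have spand d : (d < size S)%N -> Rspan R (drop d S ++ Phi0) = setT.
  move=> dp; apply: (span_full spanW rankW (phi := S`_d)) => [x xT||].
  - by rewrite mem_cat xT orbT.
  - by rewrite (drop_nth 0 dp) mem_head.
  by have := mem_nth 0 dp; rewrite mem_filter => /andP[].
have fullS : Rspan R (S ++ Phi0) = setT by have := spand 0%N pE; rewrite drop0.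
have step d : (d.+1 < size S)%N -> forall a,
    has_integral `]0, 1[%classic (fun t => Err d.+1 (a - t *: phiR d)) (nabla (phiR d) (Err d) a).
  move=> dp a; have dp' := ltnW dp.
  have -> : nabla (phiR d) (Err d) a = (f d a - f d (a - phiR d)) -
     (vol_model E S V12 d a - vol_model E S V12 d (a - phiR d)).
    by rewrite /nabla /Err; ring.
  apply: has_integralB => //; last exact: (has_integral_vol_model V12 E0 (k := Ordinal dp')).
  rewrite /f (drop_nth 0 dp') cat_cons; apply: (vol_nabla (h := h)); first exact: spand.
  by rewrite -cat_cons -drop_nth.
(* In front of Phi0 stands a single vector psi, and pr is the projection onto W
   along psi: far in the direction W, Err depends on the projection only. *)
have base d : d.+1 = size S -> uniformly0 W (nabla (phiR d) (Err d)).
  move=> dS; have dp : (d < size S)%N by rewrite -dS.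
  pose psi := S`_d; pose ep : R := (pairing psi E)%:~R.
  have ep0 : ep != 0 := E0 (Ordinal dp).
  have epE : pairing (phiR d) ER = ep by rewrite pairing_int.
  pose pr (b : 'rV[R]_r) := b - (pairing b ER / ep) *: phiR d.
  have prE b : pairing (pr b) ER = 0 by rewrite pairingB pairingZ epE divfK ?subrr.
  have prD b : pr (b - phiR d) = pr b.
    rewrite /pr pairingB epE mulrBl divff // scalerBl scale1r opprB addrA.
    by rewrite subrK.
  have prW b n : pr (b + W *+ n) = pr b + W *+ n by rewrite /pr WnE addrAC.
  have fE b : f d b = (0 <= pairing b ER / ep)%R%:R * vol Phi0 (pr b) / `|ep|.
    rewrite /f (drop_nth 0 dp) drop_oversize ?dS //; apply: vol_cons_wall_gen => //.
    by have := ep0; rewrite intr_eq0.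
  have QE b : vol_res E S V12 d b = polyval V12 (pr b) / ep.
    have -> : b = pr b + (pairing b ER / ep) *: phiR d by rewrite subrK.
    rewrite (vol_res_last V12 E0 (k := Ordinal dp)) //=.
    have := tail_coef1S E (Ordinal dp); rewrite /= dS eqxx => tail_coef1E.
    by rewrite vol_res_wall // tail_coef1E /pr subrK.
  have ErrE b : vol Phi0 (pr b) = polyval V12 (pr b) ->
      Err d b = (if ep < 0 then -1 else 0) * (polyval V12 (pr b) / ep).
    move=> vE; rewrite /Err fE vE /vol_model dS eqxx QE /=.
    have := ep0; rewrite -(ltr0z R) -/psi -/ep; case: (ltrgtP ep 0) => // s _.
      rewrite ltr0_norm // ler_ndivlMr // mul0r leNgt.
      by case: (0 < pairing b ER); rewrite /= ?mulr0n ?mulr1n ?invrN; ring.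
    rewrite gtr0_norm // ler_pdivlMr // mul0r.
    by case: (0 <= pairing b ER); rewrite /= ?mulr0n ?mulr1n; ring.
  move=> B; have [D D0 psiD] := small_bound (phiR d); have [C C0 hC] := small_pairing ER.
  pose B1 := Num.max B 1; pose B2 := B1 + D.
  have B20 : 0 < B2 by rewrite addr_gt0 // lt_max ltr01 orbT.
  pose B3 := B2 + (C * B2 / `|ep| * D + 1).
  have B30 : 0 < B3.
    rewrite addr_gt0 // ltr_wpDl // mulr_ge0 ?(ltW D0) // divr_ge0 // mulr_ge0 ?(ltW C0) ?(ltW B20) //.
  have [n0 hn0] := @eventually_small R 1 (const_mx B3) _ eps0.
  exists n0 => n /hn0[n1 n2] a aB.
  have aB1 : small B1 a by apply: smallS aB; rewrite le_max lexx.
  have key b : small B2 b -> vol Phi0 (pr (b + W *+ n)) = polyval V12 (pr (b + W *+ n)).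
    move=> bB; rewrite V12E // (vol_poly_chamber hv12) // prW -scaler_nat addrC.
    suff sm : small (n%:R * eps) (pr b).
      by have [_ _ cn] := cone n%:R (pr b) n1 sm; apply: cn; exact: prE.
    apply: (@smallS _ _ B3); first by have := n2 0; rewrite mxE gtr0_norm // => /ltW.
    apply: smallD => //; apply: smallN; apply: smallZ => //; first exact: ltW.
    rewrite normrM normfV ler_pM2r ?invr_gt0 ?normr_gt0 //.
    by apply: ltW; exact: hC.
  have aB2 : small B2 a by apply: smallS aB1; rewrite lerDl ltW.
  have aB2' : small B2 (a - phiR d) by apply: smallD => //; exact: smallN.
  have e1 := ErrE _ (key _ aB2); have e2 := ErrE _ (key _ aB2').
  by rewrite /nabla e1 (addrAC a) e2 !prW prD subrr.
have main m d : (d + m.+1)%N = size S -> uniformly0 W (nablas [seq intrmx x | x <- drop d S] (Err d)).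
  elim: m d => [|m IH] d dm.
    have dp : (d < size S)%N by lia.
    rewrite (drop_nth 0 dp) /= drop_oversize; last by rewrite -dm addn1.
    by apply: base; lia.
  have dp : (d < size S)%N by lia.
  rewrite (drop_nth 0 dp) /=; apply: (uniformly0_step (g := Err d.+1) (f := phiR d)).
    by apply: step; lia.
  by apply: IH; lia.
have lines (k : 'rV[R]_r -> R) c : is_vol_poly Phi c k -> poly_on_lines k.
  move=> [[P PE] _ _]; apply: (poly_on_lines_poly _ (poly_on_lines_polyval P)) => a.
  by rewrite PE ?full.
have polyl (F : 'rV[R]_r -> R) : poly_on_lines F -> poly_on_rays F.
  by move=> hF a b; have [q qE] := hF a b; exists q => n; rewrite -qE scaler_nat.
have near_c c k y : is_vol_poly Phi c k ->
    (forall T : R, 0 < T -> small (T * eps) y -> c (T *: W + y)) ->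
    eventually0 W (fun x => vol Phi x - k x) y.
  move=> hk hc; have [n0 hn0] := eventually_small y eps0.
  exists n0 => n /hn0[n1 n2]; rewrite (vol_poly_chamber hk) ?subrr //.
  by rewrite -scaler_nat addrC; exact: hc.
apply: (@wall_jump R _ W (fun x => pairing x ER) _ _ [seq intrmx x | x <- S] (vol Phi) (vol_model E S V12 0)
  v1 v2 (vol_res E S V12 0) (intrmx g)) => //.
- by move=> a b; rewrite pairingD.
- exact: polyl (lines _ _ hv1).
- exact: polyl (lines _ _ hv2).
- exact: polyl (vol_res_on_lines _ _ _ _).
- by rewrite pairing_int gE.
- by move=> d /mapP[x]; rewrite mem_filter => /andP[x0 _] ->; rewrite pairing_int intr_eq0.
- by move=> a a0; apply: (near_c c1 v1) => // T T0 bs; have [q _ _] := cone T _ T0 bs; exact: q.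
- by move=> a a0; apply: (near_c c2 v2) => // T T0 bs; have [_ q _] := cone T _ T0 bs; exact: q.
- by move=> a a0; exact: vol_model_neg.
- by move=> a a0; exact: vol_model_pos.
move=> a; have := @uniformly0_eventually0 _ W _ a (main (size S).-1 0%N _); rewrite drop0 => hz.
have -> : (fun x => vol Phi x - vol_model E S V12 0 x) = Err 0%N; last by apply: hz; rewrite add0n prednK.
apply/funext => x; rewrite /Err /f drop0; congr (_ - _).
apply: (vol_perm_eq x (perm_walls Phi E) (rank_full fullS) (b := 1%:M)).
by rewrite span_lattice_full //; exact: Zbasis1.
Qed.

End Main.
End VolJump.

(** * The theorem *)

Section VolResidue.
Context {R : realType}.
Local Notation intrmx := (map_mx (intr : int -> R)).

Lemma vol_residue r (Phi : seq 'rV[int]_r) (E : 'cV[int]_r) (P : mpoly.mpoly r R) (a : 'rV[R]_r) :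
  has_residue0 (fun z => diffop P (fun x =>
      expR (pairing a (x + z *: intrmx E)) /
      \prod_(phi <- Phi | pairing phi E != 0) pairing (intrmx phi) (x + z *: intrmx E)) 0)
    (vol_res E [seq phi <- Phi | pairing phi E != 0] P 0 a).
Proof.
set S := [seq phi <- Phi | pairing phi E != 0].
have dF (s : R) : s != 0 -> is_derive s (1 : R) (fun z => z^-1) (riccati false s^-1).
  move=> s0; have := @is_deriveV R (fun z => z) s 1 1 s0 (is_derive_id s (1 : R)).
  suff -> : - s ^- 2 *: 1 = riccati false s^-1 by [].
  by rewrite /riccati /GRing.scale /= mulr1 mul0r sub0r expr2 invfM.
have hF : \forall z \near (0 : R)^', z^-1 = 1 / z by near=> z; rewrite div1r.
have := @diffop_residue R r Phi E P false _ _ _ (@vol_lam R r E S) a (has_expansion1 (R := R)) hF dF.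
have -> : (fun z => diffop P (fun x =>
      expR (pairing a (x + z *: intrmx E)) *
      \prod_(phi <- Phi | pairing phi E != 0) (pairing (intrmx phi) (x + z *: intrmx E))^-1) 0) =
  (fun z => diffop P (fun x =>
      expR (pairing a (x + z *: intrmx E)) /
      \prod_(phi <- Phi | pairing phi E != 0) pairing (intrmx phi) (x + z *: intrmx E)) 0).
  apply/funext => z; congr (diffop _ _ _); apply/funext => x; congr (_ * _).
  by rewrite prodfV.
apply=> k z z0; rewrite /vol_lam -/S !hornerE invfM mulrC //.
Unshelve. all: by end_near. Qed.

End VolResidue.

Theorem theorem1 (R : realType) (r : nat) (Phi : seq 'rV[int]_r) (E : 'cV[int]_r)
    (c1 c2 c12 : set 'rV[R]_r)
    (Phi_neq0 : 0 \notin Phi)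
    (Phi_gen : Zspan Phi = setT)
    (Phi_half : in_open_half_space R Phi)
    (E_prim : primitive E)
    (W_wall : wall Phi (hyperplane R E))
    (c1_chamber : chamber Phi c1)
    (c2_chamber : chamber Phi c2)
    (c1_c2_adj : adjacent_chambers Phi E c1 c2) :
  let ER : 'cV[R]_r := map_mx intr E in
  let W : set 'rV[R]_r := hyperplane R E in
  let Phi0 := [seq phi <- Phi | pairing phi E == 0] in
  chamber Phi0 c12 ->
  closure c1 `&` closure c2 `&` W `<=` closure c12 ->
  (forall (v1 v2 v12 : 'rV[R]_r -> R) (V12 : mpoly.mpoly r R),
     is_vol_poly Phi c1 v1 ->
     is_vol_poly Phi c2 v2 ->
     is_vol_poly Phi0 c12 v12 ->
     (forall a, W a -> polyval V12 a = v12 a) ->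
     forall a : 'rV[R]_r,
       has_residue0
         (fun z : R =>
            diffop V12
              (fun x : 'cV[R]_r =>
                 expR (pairing a (x + z *: ER)) /
                 \prod_(phi <- Phi | pairing phi E != 0)
                    pairing (map_mx intr phi) (x + z *: ER))
              0)
         (v1 a - v2 a))
  /\
  (unimodular R Phi ->
   forall (k1 k2 k12 : 'rV[R]_r -> R) (K12 : mpoly.mpoly r R),
     is_num_poly Phi c1 k1 ->
     is_num_poly Phi c2 k2 ->
     is_num_poly Phi0 c12 k12 ->
     (forall a, W a -> polyval K12 a = k12 a) ->
     forall a : 'rV[R]_r,
       has_residue0
         (fun z : R =>
            diffop K12
              (fun x : 'cV[R]_r =>
                 expR (pairing a (x + z *: ER)) /
                 \prod_(phi <- Phi | pairing phi E != 0)
                    (1 - expR (- pairing (map_mx intr phi) (x + z *: ER))))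
              0)
         (k1 a - k2 a)).
Proof.
move=> ER W Phi0 c12_chamber c12_closure.
have [h Phi_h] := Phi_half.
split=> [v1 v2 v12 V12 hv1 hv2 hv12 V12E a|uni k1 k2 k12 K12 hk1 hk2 hk12 K12E a].
  rewrite (vol_jump Phi_gen E_prim W_wall Phi_h c1_chamber c2_chamber c1_c2_adj c12_chamber
    c12_closure hv1 hv2 hv12 V12E).
  exact: vol_residue.
rewrite (num_jump Phi_gen E_prim W_wall Phi_h c1_chamber c2_chamber c1_c2_adj c12_chamber
  c12_closure uni hk1 hk2 hk12 K12E).
apply: num_residue => k; have := mem_nth 0 (ltn_ord k); rewrite mem_filter => /andP[kE kPhi].
have [_ r0] := W_rank W_wall.
exact: unimodular_pm1 Phi_gen W_wall uni (primitive_one r0 E_prim) kPhi kE.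
Qed.
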